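(* Any GLP $\{\boldsymbol{\xi}_t\}_{0\le t\le1}$ is weak Markov consistent, but not necessarily strong Markov consistent (that is, every GLP satisfies the weak Markov consistency condition, and there exist GLPs that do not satisfy the strong Markov consistency condition).
   Context: All processes are càdlàg on a probability space $(\Omega,\mathcal{F},\mathbb{P})$. Markov consistency. Let $\{\mathbf{X}_t\}$ be an $n$-dimensional real-valued Markov process with coordinates $\{X^{(i)}_t\}$, $\mathcal{F}^{\mathbf{X}}_t=\sigma(\mathbf{X}_u:0\le u\le t)$ and $\mathcal{F}^{X^{(i)}}_t=\sigma(X^{(i)}_u:0\le u\le t)$. It satisfies the weak Markov consistency condition if $\mathbb{P}(X^{(i)}_t\in B\mid\mathcal{F}^{X^{(i)}}_s)=\mathbb{P}(X^{(i)}_t\in B\mid X^{(i)}_s)$ for every $i=1,\dots,n$, every $B\in\mathcal{B}(\mathbb{R})$ and all $s<t$ in the index set. It satisfies the strong Markov consistency condition if $\mathbb{P}(X^{(i)}_t\in B\mid\mathcal{F}^{\mathbf{X}}_s)=\mathbb{P}(X^{(i)}_t\in B\mid X^{(i)}_s)$ for every $i=1,\dots,n$, every $B\in\mathcal{B}(\mathbb{R})$ and all $s<t$ in the index set. Lévy random bridge (LRB). Let $T>0$, let $\nu$ be a probability law on $\mathbb{R}$, and let $\{X_t\}$ be a real-valued Lévy process such that $X_t$ has a density $f_t$ for all $t\in(0,T]$, with $f_t(x)=\int_{\mathbb{R}}f_{t-s}(x-y)f_s(y)\,dy$ for $0<s<t\le T$, $x\in\mathbb{R}$, and $0<f_T(z)<\infty$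 for $\nu$-a.e. $z$. A process $\{L_t\}_{0\le t\le T}$ is an LRB with generating law $\nu$ if $L_T$ has law $\nu$ and, for all $k\ge 1$, $0<t_1<\cdots<t_k<T$, $(x_1,\dots,x_k)\in\mathbb{R}^k$ and $\nu$-a.e. $z$, $\mathbb{P}(L_{t_1}\le x_1,\dots,L_{t_k}\le x_k\mid L_T=z)=\mathbb{P}(X_{t_1}\le x_1,\dots,X_{t_k}\le x_k\mid X_T=z)$. Equivalently (with $t_0=0$, $x_0=0$), $$\mathbb{P}(L_{t_1}\in dx_1,\dots,L_{t_k}\in dx_k,L_T\in dz)=\prod_{i=1}^k\big(f_{t_i-t_{i-1}}(x_i-x_{i-1})\,dx_i\big)\frac{f_{T-t_k}(z-x_k)}{f_T(z)}\,\nu(dz).$$ Generalised Liouville process (GLP). Let $n\ge2$, $m_1,\dots,m_n>0$, $u_0=0$, $u_i=u_{i-1}+m_i$. A process $\{\boldsymbol{\xi}_t\}_{0\le t\le1}$ is an $n$-dimensional GLP with generating law $\nu$ and activity parameter $\mathbf{m}=(m_1,\dots,m_n)^\top$ if it is equal in law to the process with coordinates $L_{tm_i+u_{i-1}}-L_{u_{i-1}}$, $i=1,\dots,n$, $0\le t\le1$, for some LRB $\{L_t\}_{0\le t\le u_n}$ with generating law $\nu$. It is assumed throughout that $\nu$ has no continuous singular part. *)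

(* Defs.v *)
From HB Require Import structures.
From mathcomp Require Import all_boot all_order all_algebra.
From mathcomp Require Import all_classical all_reals all_analysis measurable_realfun.

Set Implicit Arguments.
Unset Strict Implicit.
Unset Printing Implicit Defensive.

Import Order.TTheory GRing.Theory Num.Theory.
Import numFieldNormedType.Exports.

Local Open Scope classical_set_scope.
Local Open Scope ring_scope.
Local Open Scope ereal_scope.

(* Time is always indexed by the whole of [R]: for a process on an interval,
   only the times in that interval are ever constrained or used. *)

(* At the endpoints of [I] one of the two one-sided filters is trivial, and the
   corresponding condition is vacuous. *)
Definition cadlag (R : realType) (I : set R) (x : R -> R) : Prop :=
  forall t, I t ->
    x @ within I (at_right t) --> x t /\
    (exists l : R, x @ within I (at_left t) --> l).

Section processes.
Context (R : realType) (d : measure_display) (Omega : measurableType d)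
  (P : probability Omega R).

Definition cadlag_process (I : set R) (X : R -> Omega -> R) : Prop :=
  forall w, cadlag I (X ^~ w).

(* Every increment may be left unconstrained (take [B j = setT]), so the product
   rule for the full family gives mutual independence. *)
Definition independent_increments (X : R -> Omega -> R) : Prop :=
  forall (k : nat) (t : nat -> R) (B : nat -> set R),
    (0 <= t 0%N)%R -> (forall j, (j < k)%N -> (t j <= t j.+1)%R) ->
    (forall j, measurable (B j)) ->
    P (\bigcap_(j in [set j | (j < k)%N])
         [set w | B j (X (t j.+1) w - X (t j) w)%R]) =
    \prod_(j < k) P [set w | B j (X (t j.+1) w - X (t j) w)%R].

Definition stationary_increments (X : R -> Omega -> R) : Prop :=
  forall (s t : R) (B : set R), (0 <= s <= t)%R -> measurable B ->
    P [set w | B (X t w - X s w)%R] =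
    P [set w | B (X (t - s) w - X 0 w)%R].

Definition levy_process (X : R -> {RV P >-> R}) : Prop :=
  [/\ cadlag_process [set t | (0 <= t)%R] X,
      {ae P, forall w, X 0%R w = 0%R},
      independent_increments X
    & stationary_increments X].

Definition has_density (X : {RV P >-> R}) (f : R -> \bar R) : Prop :=
  [/\ measurable_fun setT f, (forall x, 0 <= f x)
    & forall B, measurable B ->
        distribution P X B = \int[lebesgue_measure]_(x in B) f x].

(* [g] is a version of [z |-> P (A | Y = z)] *)
Definition cond_prob_at (A : set Omega) (Y : {RV P >-> R}) (g : R -> \bar R)
    : Prop :=
  measurable_fun setT g /\
  forall B, measurable B ->
    P (A `&` Y @^-1` B) = \int[distribution P Y]_(z in B) g z.

(* [Y] is a version of [P (A | G)], for a sub-sigma-algebra [G] *)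
Definition cond_prob (G : set_system Omega) (A : set Omega) (Y : Omega -> R)
    : Prop :=
  [/\ forall B, measurable B -> G (Y @^-1` B),
      P.-integrable setT (EFin \o Y)
    & forall C, G C -> \int[P]_(w in C) (Y w)%:E = P (A `&` C)].

(* [P (A | G) = P (A | H)] almost surely; as versions are almost surely unique,
   it does not matter which ones are compared. *)
Definition cond_prob_eq (G H : set_system Omega) (A : set Omega) : Prop :=
  exists Y Z : Omega -> R,
    [/\ cond_prob G A Y, cond_prob H A Z & {ae P, forall w, Y w = Z w}].

End processes.

(* sigma(X_j : j in D) *)
Definition sigma_of (R : realType) (J Omega : Type) (X : J -> Omega -> R)
    (D : set J) : set_system Omega :=
  <<s \bigcup_(j in D) preimage_set_system setT (X j) measurable >>.

Section markov_consistency.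
Context (R : realType) (d : measure_display) (Omega : measurableType d)
  (P : probability Omega R) (n : nat) (X : 'I_n -> R -> {RV P >-> R}).

Definition coord_filtration (i : 'I_n) (t : R) : set_system Omega :=
  sigma_of (fun u => X i u : Omega -> R) [set u | (0 <= u <= t)%R].

Definition full_filtration (t : R) : set_system Omega :=
  sigma_of (fun p : 'I_n * R => X p.1 p.2 : Omega -> R)
    [set p | (0 <= p.2 <= t)%R].

Definition coord_sigma (i : 'I_n) (t : R) : set_system Omega :=
  sigma_of (fun u => X i u : Omega -> R) [set t].

Definition weak_markov_consistent (I : set R) : Prop :=
  forall (i : 'I_n) (B : set R) (s t : R),
    measurable B -> I s -> I t -> (s < t)%R ->
    cond_prob_eq P (coord_filtration i s) (coord_sigma i s) (X i t @^-1` B).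

Definition strong_markov_consistent (I : set R) : Prop :=
  forall (i : 'I_n) (B : set R) (s t : R),
    measurable B -> I s -> I t -> (s < t)%R ->
    cond_prob_eq P (full_filtration s) (coord_sigma i s) (X i t @^-1` B).

End markov_consistency.

Section levy_random_bridge.
Context (R : realType).

(* For [txs = [:: (t_1, x_1); ...; (t_k, x_k)]], this is the integral over
   y_1 <= x_1, ..., y_k <= x_k of
   f_{t_1 - t_0} (y_1 - y_0) ... f_{t_k - t_{k-1}} (y_k - y_{k-1})
     f_{T - t_k} (z - y_k). *)
Fixpoint bridge_integral (f : R -> R -> \bar R) (T z t0 y0 : R)
    (txs : seq (R * R)) : \bar R :=
  match txs with
  | [::] => f (T - t0)%R (z - y0)%R
  | (t, x) :: txs' =>
      \int[lebesgue_measure]_(y in `]-oo, x])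
        (f (t - t0)%R (y - y0)%R * bridge_integral f T z t y txs')
  end.

(* P (X_{t_1} <= x_1, ..., X_{t_k} <= x_k | X_T = z) for a Levy process with
   transition densities [f].  The event [X_T = z] is null, and the generating law
   may charge Lebesgue-null sets, so the version given by the densities is part
   of the definition. *)
Definition bridge_cdf (f : R -> R -> \bar R) (T z : R) (txs : seq (R * R))
    : \bar R :=
  bridge_integral f T z 0 0 txs / f T z.

Definition levy_random_bridge (T : R) (nu : probability R R)
    (d : measure_display) (Omega : measurableType d) (P : probability Omega R)
    (L : R -> {RV P >-> R}) : Prop :=
  (0 < T)%R /\ cadlag_process `[0%R, T] L /\
  (forall B, measurable B -> distribution P (L T) B = nu B) /\
  exists (d' : measure_display) (Omega' : measurableType d')
    (P' : probability Omega' R) (X : R -> {RV P' >-> R})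
    (f : R -> R -> \bar R),
  [/\ levy_process X,
      forall t, (0 < t <= T)%R -> has_density (X t) (f t),
      forall s t x, (0 < s)%R -> (s < t)%R -> (t <= T)%R ->
        f t x =
        \int[lebesgue_measure]_(y in setT) (f (t - s)%R (x - y)%R * f s y),
      {ae nu, forall z, 0 < f T z < +oo}
    & forall txs : seq (R * R), (0 < size txs)%N ->
        path <%R 0%R (rcons (map fst txs) T) ->
        exists g : R -> \bar R,
          cond_prob_at [set w | forall tx, tx \in txs -> (L tx.1 w <= tx.2)%R]
            (L T) g /\
          {ae nu, forall z, g z = bridge_cdf f T z txs}].

(* [nu] is the sum of a discrete and an absolutely continuous measure *)
Definition no_continuous_singular_part (nu : probability R R) : Prop :=
  exists mud muc : {measure set R -> \bar R},
    [/\ forall B, measurable B -> nu B = mud B + muc B,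
        exists2 C : set R, countable C & mud (~` C) = 0
      & muc `<< (lebesgue_measure : set R -> \bar R)].

End levy_random_bridge.

Section generalised_liouville.
Context (R : realType) (n : nat).

(* Equality of the laws of two [R^n]-valued processes on the time set [I], as
   measures on the cylinder sigma-algebra of the path space. *)
Definition equal_in_law (I : set R)
    (d : measure_display) (Omega : measurableType d) (P : probability Omega R)
    (d' : measure_display) (Omega' : measurableType d')
    (P' : probability Omega' R)
    (X : 'I_n -> R -> Omega -> R) (Y : 'I_n -> R -> Omega' -> R) : Prop :=
  forall A : set ('I_n -> R -> R),
    sigma_of (fun (p : 'I_n * R) (x : 'I_n -> R -> R) => x p.1 p.2)
      [set p | I p.2] A ->
    P [set w | A (fun i t => X i t w)] = P' [set w | A (fun i t => Y i t w)].

(* [u_{i-1}] when the coordinates are numbered from 1 *)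
Definition partial_activity (m : 'I_n -> R) (i : 'I_n) : R :=
  (\sum_(j < n | (j < i)%N) m j)%R.

Definition generalised_liouville (m : 'I_n -> R) (nu : probability R R)
    (d : measure_display) (Omega : measurableType d) (P : probability Omega R)
    (xi : 'I_n -> R -> {RV P >-> R}) : Prop :=
  [/\ (2 <= n)%N,
      forall i, (0 < m i)%R,
      no_continuous_singular_part nu,
      forall i, cadlag_process `[0%R, 1%R] (xi i)
    & exists (d' : measure_display) (Omega' : measurableType d')
        (P' : probability Omega' R) (L : R -> {RV P' >-> R}),
      levy_random_bridge (\sum_i m i)%R nu L /\
      equal_in_law `[0%R, 1%R] P P' xi
        (fun i t w => L (t * m i + partial_activity m i)%R w
                      - L (partial_activity m i) w)%R].

End generalised_liouville.

(* Main.v *)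
Require Import Defs.
From HB Require Import structures.
From mathcomp Require Import all_boot all_order all_algebra.
From mathcomp Require Import all_classical all_reals all_analysis measurable_realfun.
From mathcomp Require Import ring lra.

Set Implicit Arguments.
Unset Strict Implicit.
Unset Printing Implicit Defensive.

Import Order.TTheory GRing.Theory Num.Theory.
Import numFieldNormedType.Exports.

Local Open Scope classical_set_scope.
Local Open Scope ring_scope.

(** Weak consistency.  Let [X] be the Levy process behind a bridge [L] on
    [[0, T]] and [nu] the law of [L T].  Before the time [T] the bridge is a Doob
    transform of [X]: the joint law of [L] on [[0, s]] and of [L T] has the
    density [f_(T-s) (z - X s) / f_T z] with respect to the product of the law of
    [X] and [nu], so [L] on [[0, s]] has the density [H_s (X s)] with respect to
    [X], where [H_s y] is the integral of [f_(T-s) (z - y) / f_T z] against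
    [nu (dz)] ([bridge_joint_law], [bridge_weight]).  The point is that the
    increments of [L] are stationary: as [X u] is independent of the later
    increments of [X], it can be integrated out, and the Chapman-Kolmogorov
    equation turns the weight [H_(u+v) (x + y)] into [H_v y].  So
    [v |-> L (u + v) - L u] is the transform of [X] by the same weights [H]
    whatever [u] is ([bridge_increments]).  A coordinate of a generalised
    Liouville process is such a process of increments with its time scaled, and
    a Doob transform is Markov: the conditional law at [t] given the past up to
    [s] is [f_(t-s) (y - x) H_t y dy / H_s x], a function of the present position
    [x] alone ([weak_markov_of_boxes]).

    Failure of strong consistency.  Take two coordinates of unit activity and a
    gamma process [X] on [[0, 2]] conditioned by the event [X 2 <= 4].
    Conditioning a Levy process by an event of its terminal value changes the
    law of that value and keeps the bridge laws, so the result is a Levy random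
    bridge, with an absolutely continuous generating law
    ([conditioned_is_bridge]).  At time [1/2] the first coordinate is [X (1/2)] and
    the second is [X (3/2) - X 1].  If the second exceeds [2], there
    is no room for the first to exceed [2] at time [1]: the conditional
    probability of that event given both coordinates vanishes there.  Given the
    first coordinate alone, it is positive whenever [X (1/2) < 1/2].  The two
    cannot agree, because the second coordinate exceeds [2] with positive
    probability, also when [X (1/2) < 1/2] ([conditioned_not_strong]).

    A gamma process has to be constructed.  Its increments are nonnegative, so
    it has monotone paths, and right-continuity comes from a decreasing limit
    instead of a continuity criterion for random paths.  The increments over the
    dyadic intervals of length [2^-n] are obtained by successive splitting: given
    the increment over an interval, the one over its left half is drawn from its
    conditional law, a quantile function applied to a fresh uniform variable, and
    the Chapman-Kolmogorov equation makes the two halves independent with the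
    right laws ([half_law], [split_law], [state_law]).  All these uniform
    variables come from a single one, since the binary digits of even and of odd
    rank of a uniform variable give two independent uniform variables
    ([even_odd_bits_independent]).  Sums of increments over fine meshes decrease
    to the process ([subordinator]). *)

Local Open Scope ereal_scope.

(** * Measures determined by half-lines, densities and limits of laws *)

(** Monotone limits commute with multiplication by any [c >= 0], also by
    [+oo], where continuity of the product fails at [0 * +oo]: a nondecreasing
    sequence with limit [0] is constantly [0]. *)
Lemma cvg_nondecreasing_mule (R : realType) (u : (\bar R)^nat) (l c : \bar R) :
  (forall n, 0 <= u n) -> nondecreasing_seq u -> u @ \oo --> l -> 0 <= c ->
  (fun n => u n * c) @ \oo --> l * c.
Proof.
move=> u0 ndu ul c0.
have [cfin|] := boolP (c \is a fin_num); first exact: cvgeZr.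
rewrite ge0_fin_numE// -leNgt leye_eq => /eqP ->.
have lE : l = ereal_sup (range u).
  by rewrite -(cvg_lim _ ul)//; exact/cvg_lim/ereal_nondecreasing_cvgn.
have uk n : u n <= l by rewrite lE; apply: ereal_sup_ubound; exists n.
have l0 : 0 <= l by exact: le_trans (u0 0%N) (uk 0%N).
have [l_gt0|le0] := ltP 0 l; last first.
  have -> : l = 0 by apply/le_anti; rewrite le0 l0.
  rewrite mul0e (_ : (fun _ => _) = cst 0); first exact: cvg_cst.
  apply/funext => n /=; rewrite (_ : u n = 0) ?mul0e//.
  by apply/le_anti; rewrite u0 (le_trans (uk n) le0).
rewrite gt0_muley//; apply: cvg_near_cst.
move: l_gt0; rewrite lE => /ereal_sup_gt[_ [n0 _ <-] un0].
by exists n0 => // n /= n0n; rewrite gt0_muley// (lt_le_trans un0)//; exact: ndu.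
Qed.

Section density.
Context d (T : measurableType d) (R : realType).
Variables (mu : {measure set T -> \bar R}) (g : T -> \bar R).
Hypotheses (mg : measurable_fun setT g) (g0 : forall x, 0 <= g x).

(** The two proofs are arguments of the constant so that the measure structure
    below can be inferred from the term. *)
Definition weighted_measure of measurable_fun setT g & (forall x, 0 <= g x) :=
  fun A : set T => \int[mu]_(x in A) g x.

Local Notation wm := (weighted_measure mg g0).

Let wm0 : wm set0 = 0. Proof. by rewrite /weighted_measure integral_set0. Qed.

Let wm_ge0 A : 0 <= wm A.
Proof. by apply: integral_ge0 => x _; exact: g0. Qed.

Let wm_sigma_additive : semi_sigma_additive wm.
Proof.
move=> F mF tF mUF; rewrite /weighted_measure ge0_integral_bigcup//; last first.
  exact: measurable_funTS.
apply: is_cvg_ereal_nneg_natsum_cond => n _ _.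
by apply: integral_ge0 => x _; exact: g0.
Qed.

HB.instance Definition _ := isMeasure.Build _ _ _ wm wm0 wm_ge0
  wm_sigma_additive.

Import HBNNSimple.

(** True for the simple functions that increase to [f], hence for [f] by
    monotone convergence on both sides. *)
Lemma integral_of_density (m : {measure set T -> \bar R}) :
  (forall A, measurable A -> m A = \int[mu]_(x in A) g x) ->
  forall f, measurable_fun setT f -> (forall x, 0 <= f x) ->
  \int[m]_x f x = \int[mu]_x (f x * g x).
Proof.
move=> mE f mf f0; pose h := nnsfun_approx measurableT mf.
have hf x : (EFin \o h n) x @[n --> \oo] --> f x.
  exact: cvg_nnsfun_approx.
have ndh x : nondecreasing_seq (fun n => (h n x)%:E).
  by move=> a b ab; rewrite lee_fin; exact/lefP/nd_nnsfun_approx.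
transitivity (limn (fun n => \int[m]_x (h n x)%:E)).
  rewrite -monotone_convergence//.
  - by apply: eq_integral => x _; apply/esym/cvg_lim => //; exact: hf.
  - by move=> n; exact/measurable_EFinP.
  - by move=> n x _; rewrite lee_fin.
transitivity (limn (fun n => \int[mu]_x ((h n x)%:E * g x))); last first.
  rewrite -monotone_convergence//.
  - apply: eq_integral => x _; apply/cvg_lim => //.
    have h0 n : 0 <= (h n x)%:E by rewrite lee_fin.
    exact: (cvg_nondecreasing_mule h0 (ndh x) (hf x) (g0 x)).
  - by move=> n; apply: emeasurable_funM => //; exact/measurable_EFinP.
  - by move=> n x _; rewrite mule_ge0 ?lee_fin.
  - by move=> x _ a b ab; rewrite lee_wpmul2r//; exact: ndh.
congr (limn _); apply/funext => n.
have mi r : measurable_fun setT (fun x => (r * \1_(h n @^-1` [set r]) x)%:E).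
  by apply/measurable_EFinP; exact: measurable_funM.
transitivity (\int[m]_x
   (\sum_(y \in range (h n)) (y * \1_(h n @^-1` [set y]) x)%:E)).
  by apply: eq_integral => t _; rewrite /= fimfunE -fsumEFin.
rewrite ge0_integral_fsum//; last by move=> r x _; exact: nnfun_muleindic_ge0.
transitivity (\int[mu]_x (\sum_(y \in range (h n))
    (y * \1_(h n @^-1` [set y]) x)%:E * g x)); last first.
  apply: eq_integral => x _; rewrite -ge0_mule_fsuml; last first.
    by move=> r; exact: nnfun_muleindic_ge0.
  by rewrite fsumEFin// -fimfunE.
rewrite ge0_integral_fsum//; last 2 first.
  - by move=> r; apply: emeasurable_funM.
  - by move=> r x _; rewrite mule_ge0// nnfun_muleindic_ge0.
apply: eq_fsbigr => r rhn.
have r0 : (0 <= r)%R by case/set_mem: rhn => x _ <-.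
under eq_integral do rewrite EFinM.
rewrite ge0_integralZl//; last exact/measurable_EFinP.
rewrite integral_indic// setIT mE//.
under [RHS]eq_integral do rewrite EFinM -muleA.
rewrite ge0_integralZl//; last 2 first.
  by apply: emeasurable_funM => //; exact/measurable_EFinP.
  by move=> x _; rewrite mule_ge0.
congr (_ * _); rewrite integral_mkcond; apply: eq_integral => x _.
by rewrite epatch_indic muleC.
Qed.

End density.

Section cylinders.
Context (R : realType) (J : eqType).

Definition cylinder (Omega : Type) (V : J -> Omega -> R) (l : seq (J * set R))
    : set Omega :=
  \big[setI/setT]_(p <- l) (V p.1 @^-1` p.2).

Definition rays (l : seq (J * R)) : seq (J * set R) :=
  [seq (p.1, `]-oo, p.2]%classic) | p <- l].

Lemma cylinder_cons (Omega : Type) (V : J -> Omega -> R) p l :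
  cylinder V (p :: l) = V p.1 @^-1` p.2 `&` cylinder V l.
Proof. by rewrite /cylinder big_cons. Qed.

Lemma cylinder_cat (Omega : Type) (V : J -> Omega -> R) l1 l2 :
  cylinder V (l1 ++ l2) = cylinder V l1 `&` cylinder V l2.
Proof. by rewrite /cylinder big_cat. Qed.

Lemma cylinderP (Omega : Type) (V : J -> Omega -> R) l w :
  cylinder V l w <-> forall p, p \in l -> p.2 (V p.1 w).
Proof.
elim: l => [|p l IH]; first by rewrite /cylinder big_nil; split.
rewrite cylinder_cons; split => [[wp wl] q|wl].
  by rewrite inE => /predU1P[->//|]; exact: (IH.1 wl).
split; first exact/wl/mem_head.
by apply/IH => q ql; apply: wl; rewrite inE ql orbT.
Qed.

Lemma cylinder_preimage (Omega Omega' : Type) (V : J -> Omega -> R)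
    (phi : Omega' -> Omega) l :
  phi @^-1` cylinder V l = cylinder (fun j w => V j (phi w)) l.
Proof.
elim: l => [|p l IH]; first by rewrite /cylinder !big_nil preimage_setT.
by rewrite !cylinder_cons preimage_setI IH.
Qed.

Lemma cylinder_ext (Omega : Type) (V V' : J -> Omega -> R) l :
  (forall p, p \in l -> V p.1 = V' p.1) -> cylinder V l = cylinder V' l.
Proof.
by move=> VV'; rewrite /cylinder; apply: eq_big_seq => p /VV' ->.
Qed.

Lemma cylinder_raysE (Omega : Type) (V : J -> Omega -> R) l :
  cylinder V (rays l) = [set w | forall p, p \in l -> (V p.1 w <= p.2)%R].
Proof.
elim: l => [|p l IH]; first by rewrite /cylinder big_nil; apply/seteqP; split.
rewrite /= cylinder_cons IH; apply/seteqP; split => [w [/= wp wl] q|w wpl].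
  rewrite inE => /predU1P[->|/wl//].
  by move: wp; rewrite in_itv.
split=> /=; first by rewrite in_itv /= wpl// mem_head.
by move=> q ql; apply: wpl; rewrite inE ql orbT.
Qed.

Lemma sigma_algebra_setC (Omega : Type) (S : set_system Omega) A :
  sigma_algebra setT S -> S A -> S (~` A).
Proof. by move=> [_ SC _] SA; rewrite -setTD; exact: SC. Qed.

Lemma sigma_algebra_setI (Omega : Type) (S : set_system Omega) A B :
  sigma_algebra setT S -> S A -> S B -> S (A `&` B).
Proof.
move=> sS SA SB; rewrite -(setCK (A `&` B)) setCI; apply: sigma_algebra_setC => //.
rewrite -bigcup2E; case: (sS) => S0 _; apply => n; rewrite /bigcup2.
by case: ifPn => _; [|case: ifPn => _ //]; exact: sigma_algebra_setC.
Qed.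

(** Half-lines generate the Borel sets, so the sets whose preimage lies in
    [S], a sigma-algebra, contain all of them as soon as they contain
    half-lines. *)
Lemma sigma_of_sub (Omega : Type) (V : J -> Omega -> R) (D : set J)
    (S : set_system Omega) : sigma_algebra setT S ->
  (forall j x, D j -> S (V j @^-1` `]-oo, x])) ->
  sigma_of V D `<=` S.
Proof.
move=> sS SV; case: (sS) => S0 _ SU; apply: smallest_sub => // _ [j Dj [B mB <-]].
rewrite setTI; move: B mB.
apply: smallest_sub; first split.
- by rewrite preimage_set0.
- by move=> A SA; rewrite setTD preimage_setC; exact: sigma_algebra_setC.
- by move=> F SF; rewrite preimage_bigcup; exact: SU.
- move=> _ [[a b] _ <-] /=.
  rewrite (_ : `]a, b]%classic = `]-oo, b]%classic `&` ~` `]-oo, a]%classic); last first.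
    rewrite setCitvl; apply/seteqP; split=> x /=; rewrite !in_itv/= andbT.
      by case/andP.
    by case=> -> ->.
  by rewrite preimage_setI preimage_setC; apply: sigma_algebra_setI => //;
      [|apply: sigma_algebra_setC => //]; exact: SV.
Qed.

Lemma sigma_of_measurable d (Omega : measurableType d) (V : J -> Omega -> R)
    (D : set J) :
  (forall j, D j -> measurable_fun setT (V j)) ->
  sigma_of V D `<=` measurable.
Proof.
move=> mV; apply: sigma_of_sub; first exact: sigma_algebra_measurable.
by move=> j x Dj; rewrite -[X in measurable X]setTI; exact: mV.
Qed.

Lemma sigma_of_preimage (Omega : Type) (V : J -> Omega -> R) (D : set J) j B :
  D j -> measurable B -> sigma_of V D (V j @^-1` B).
Proof.
move=> Dj mB; apply: sub_sigma_algebra; exists j => //.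
by exists B => //; rewrite setTI.
Qed.

Lemma sigma_of_setI (Omega : Type) (V : J -> Omega -> R) (D : set J) A B :
  sigma_of V D A -> sigma_of V D B -> sigma_of V D (A `&` B).
Proof. by apply: sigma_algebra_setI; exact: smallest_sigma_algebra. Qed.

Lemma sigma_of_cylinder (Omega : Type) (V : J -> Omega -> R) (D : set J) l :
  (forall p, p \in l -> D p.1 /\ measurable p.2) ->
  sigma_of V D (cylinder V l).
Proof.
elim: l => [|p l IH] lD.
  rewrite /cylinder big_nil -(setD0 setT).
  by apply: sigma_algebraCD; exact: sigma_algebra0.
rewrite cylinder_cons; apply: sigma_of_setI.
  by have [Dp mp] := lD _ (mem_head _ _); exact: sigma_of_preimage.
by apply: IH => q ql; apply: lD; rewrite inE ql orbT.
Qed.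

Lemma rays_measurable (D : set J) l : (forall p, p \in l -> D p.1) ->
  forall p, p \in rays l -> D p.1 /\ measurable p.2.
Proof. by move=> lD _ /mapP[q ql ->]; split; [exact: lD|exact: measurable_itv]. Qed.

Lemma measurable_cylinder d (Omega : measurableType d) (V : J -> Omega -> R) l :
  (forall p, p \in l -> measurable_fun setT (V p.1) /\ measurable p.2) ->
  measurable (cylinder V l).
Proof.
move=> ml; rewrite /cylinder big_seq; apply: bigsetI_measurable => p pl.
by have [mV mp] := ml _ pl; rewrite -[X in measurable X]setTI; exact: mV.
Qed.

(** The cylinders over half-lines are stable under intersection (concatenate
    the lists) and generate [sigma_of V D]: the pi-lambda theorem applies. *)
Lemma sigma_of_unique d (Omega : measurableType d) (V : J -> Omega -> R)
    (D : set J) (m1 m2 : {measure set Omega -> \bar R}) :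
  (forall j, D j -> measurable_fun setT (V j)) ->
  (forall l, (forall p, p \in l -> D p.1) ->
    m1 (cylinder V (rays l)) = m2 (cylinder V (rays l))) ->
  m1 setT < +oo ->
  forall A, sigma_of V D A -> m1 A = m2 A.
Proof.
move=> mV m12 m1oo A sA.
pose G := [set C | exists2 l, (forall p, p \in l -> D p.1) &
                   C = cylinder V (rays l)].
have mG : G `<=` measurable.
  move=> _ [l lD ->]; apply: (sigma_of_measurable mV).
  by apply: sigma_of_cylinder; exact: rays_measurable.
have GT : G setT by exists [::] => //; rewrite /cylinder big_nil.
apply: (@g_sigma_algebra_measure_unique _ R _ G mG (fun=> setT)) => //.
- by rewrite bigcup_const//; exists 0%N.
- move=> _ _ [l1 l1D ->] [l2 l2D ->]; exists (l1 ++ l2).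
    by move=> p; rewrite mem_cat => /orP[/l1D|/l2D].
  by rewrite /rays map_cat cylinder_cat.
- by move=> _ [l lD ->]; exact: m12.
move: A sA; apply: sigma_of_sub; first exact: smallest_sigma_algebra.
move=> j x Dj; apply: sub_sigma_algebra; exists [:: (j, x)].
  by move=> p; rewrite inE => /eqP ->.
by rewrite /= cylinder_cons /cylinder big_nil setIT.
Qed.

End cylinders.

Lemma probability_lty d (T : measurableType d) (R : realType)
  (P : probability T R) A : measurable A -> P A < +oo.
Proof. by move=> mA; exact: le_lt_trans (probability_le1 P mA) (ltry 1). Qed.

Lemma integral_probability_cst d (T : measurableType d) (R : realType)
  (P : probability T R) (c : \bar R) : \int[P]_x c = c.
Proof.
have -> : \int[P]_x c = c * P setT by exact: integral_cst.
by rewrite probability_setT mule1.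
Qed.

Lemma ae_eq_measure d (T : measurableType d) (R : realType)
    (mu : {measure set T -> \bar R}) A B :
  measurable A -> measurable B -> {ae mu, forall w, A w <-> B w} -> mu A = mu B.
Proof.
move=> mA mB AB; rewrite -[A]setIT -[B]setIT -!integral_indic//.
apply: ge0_ae_eq_integral => //.
- exact/measurable_EFinP.
- exact/measurable_EFinP.
apply: filterS AB => w [AB BA] _; congr EFin; rewrite !indicE.
by congr (_%:R); congr nat_of_bool; apply/idP/idP; rewrite !inE.
Qed.

Section image_measures.
Context d1 d2 (T1 : measurableType d1) (T2 : measurableType d2) (R : realType).

Definition image_measure (m : {measure set T1 -> \bar R}) (f : T1 -> T2)
    (mf : measurable_fun setT f) : {measure set T2 -> \bar R} :=
  measure_function_pushforward__canonical__measure_function_Measure m mf.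

Lemma image_measureE m f (mf : measurable_fun setT f) A :
  image_measure m mf A = m (f @^-1` A).
Proof. by []. Qed.

Lemma ge0_integral_image m f (mf : measurable_fun setT f) (h : T2 -> \bar R) :
  measurable_fun setT h -> (forall x, 0 <= h x) ->
  \int[image_measure m mf]_x h x = \int[m]_x h (f x).
Proof. by move=> mh h0; rewrite [LHS]ge0_integral_pushforward. Qed.

End image_measures.

Lemma measurable_pair_cst d1 d2 (T1 : measurableType d1) (T2 : measurableType d2)
  (y : T2) : measurable_fun setT (fun x : T1 => (x, y)).
Proof.
have mc : measurable_fun setT (cst y : T1 -> T2) by exact: measurable_cst.
exact: (measurable_fun_pair (@measurable_id _ T1 setT) mc).
Qed.

Section joint_laws.
Context d1 d2 (T1 : measurableType d1) (T2 : measurableType d2) (R : realType).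

(** Rectangles are stable under intersection and generate the product
    sigma-algebra. *)
Lemma eq_measure_prod (m1 m2 : {measure set (T1 * T2) -> \bar R}) :
  (forall A B, measurable A -> measurable B -> m1 (A `*` B) = m2 (A `*` B)) ->
  m1 setT < +oo -> forall C, measurable C -> m1 C = m2 C.
Proof.
move=> m12 m1oo C mC.
apply: (measure_unique [set C | exists A, d1.-measurable A /\
  exists B, d2.-measurable B /\ C = A `*` B] (fun=> setT)) => //.
- rewrite measurable_prod_measurableType; congr (<<s _ >>).
  apply/seteqP; split => [_ [A mA [B mB <-]]|_ [A [mA [B [mB ->]]]]].
    by exists A; split => //; exists B.
  by exists A => //; exists B.
- move=> _ _ [A1 [mA1 [B1 [mB1 ->]]]] [A2 [mA2 [B2 [mB2 ->]]]].
  rewrite -setXI; exists (A1 `&` A2); split; first exact: measurableI.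
  by exists (B1 `&` B2); split => //; exact: measurableI.
- by move=> _; exists setT; split => //; exists setT; split => //; rewrite setXTT.
- by rewrite bigcup_const//; exists 0%N.
- by move=> _ [A [mA [B [mB ->]]]]; exact: m12.
Qed.

Lemma eq_joint_integral d1' d2' (O1 : measurableType d1') (O2 : measurableType d2')
    (m1 : {measure set O1 -> \bar R}) (m2 : {measure set O2 -> \bar R})
    (X1 : O1 -> T1) (Y1 : O1 -> T2) (X2 : O2 -> T1) (Y2 : O2 -> T2)
    (h : T1 * T2 -> \bar R) :
  measurable_fun setT X1 -> measurable_fun setT Y1 ->
  measurable_fun setT X2 -> measurable_fun setT Y2 ->
  (forall A B, measurable A -> measurable B ->
    m1 (X1 @^-1` A `&` Y1 @^-1` B) = m2 (X2 @^-1` A `&` Y2 @^-1` B)) ->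
  m1 setT < +oo ->
  measurable_fun setT h -> (forall x, 0 <= h x) ->
  \int[m1]_w h (X1 w, Y1 w) = \int[m2]_w h (X2 w, Y2 w).
Proof.
move=> mX1 mY1 mX2 mY2 m12 m1oo mh h0.
pose Z1 w := (X1 w, Y1 w); pose Z2 w := (X2 w, Y2 w).
have mZ1 : measurable_fun setT Z1 by exact/measurable_fun_pairP.
have mZ2 : measurable_fun setT Z2 by exact/measurable_fun_pairP.
rewrite -(ge0_integral_image m1 mZ1)// -(ge0_integral_image m2 mZ2)//.
apply: eq_measure_integral => C mC _.
by apply: eq_measure_prod.
Qed.

End joint_laws.

Section independent_pairs.
Context d (O : measurableType d) d1 (T1 : measurableType d1)
  d2 (T2 : measurableType d2) (R : realType) (Q : probability O R).

Lemma measurable_integral_snd (Y : O -> T2) (h : T1 * T2 -> \bar R) :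
  measurable_fun setT Y -> measurable_fun setT h -> (forall x, 0 <= h x) ->
  measurable_fun setT (fun x => \int[Q]_w h (x, Y w)).
Proof.
move=> mY mh h0.
have mhY : measurable_fun setT (fun z : T1 * O => h (z.1, Y z.2)).
  have mY2 : measurable_fun setT (Y \o snd : T1 * O -> T2).
    exact: measurableT_comp.
  by apply: (measurableT_comp mh); exact: (measurable_fun_pair measurable_fst mY2).
exact: (measurable_fun_fubini_tonelli_F (m2 := Q) (fun z => h (z.1, Y z.2))).
Qed.

Lemma integral_independent (X : {mfun O >-> T1}) (Y : O -> T2)
    (h : T1 * T2 -> \bar R) :
  measurable_fun setT Y ->
  (forall A B, measurable A -> measurable B ->
    Q (X @^-1` A `&` Y @^-1` B) = Q (X @^-1` A) * Q (Y @^-1` B)) ->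
  measurable_fun setT h -> (forall x, 0 <= h x) ->
  \int[Q]_w h (X w, Y w) = \int[distribution Q X]_x \int[Q]_w h (x, Y w).
Proof.
move=> mY indep mh h0.
have mhY : measurable_fun setT (fun z : T1 * O => h (z.1, Y z.2)).
  have mY2 : measurable_fun setT (Y \o snd : T1 * O -> T2).
    exact: measurableT_comp.
  apply: (measurableT_comp mh); apply/measurable_fun_pairP; split => /=.
    exact: measurable_fst.
  exact: mY2.
rewrite -(fubini_tonelli1 (m1 := distribution Q X) (m2 := Q)
  (fun z => h (z.1, Y z.2)))//.
apply: (eq_joint_integral (X2 := fst) (Y2 := Y \o snd)) => //.
- exact: (measurableT_comp mY).
- move=> A B mA mB; transitivity (Q (X @^-1` A) * Q (Y @^-1` B)); first exact: indep.
  have -> : [set x | A x.1] `&` (Y \o snd) @^-1` B = A `*` (Y @^-1` B) :> set (T1 * O).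
    by apply/seteqP; split.
  apply/esym/product_measure1E => //.
  by rewrite -[X in measurable X]setTI; exact: mY.
- exact: probability_lty.
Qed.

End independent_pairs.

Section path_space.
Context (R : realType) (J : eqType) (D : set J).

Definition path_cylinders : set_system (J -> R) :=
  \bigcup_(j in D) preimage_set_system setT (fun v : J -> R => v j) measurable.

(** The sigma-algebra on paths depends on the set [D] of times: the past and
    the future of one process are measurable maps to different such spaces. *)
Definition path_space := g_sigma_algebraType path_cylinders.

HB.instance Definition _ := Measurable.on path_space.

Lemma measurable_coordinate j : D j ->
  measurable_fun setT (fun v : path_space => v j).
Proof.
move=> Dj _ B mB; rewrite setTI.
exact: (@sigma_of_preimage _ _ _ (fun k (v : J -> R) => v k)).
Qed.

Lemma measurable_path d (T : measurableType d) (V : J -> T -> R) :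
  (forall j, D j -> measurable_fun setT (V j)) ->
  measurable_fun setT (fun w => V ^~ w : path_space).
Proof.
move=> mV _ A sA; rewrite setTI; move: A sA.
suff : sigma_of (fun j (v : J -> R) => v j) D `<=`
       [set A | measurable ((fun w => V ^~ w) @^-1` A)] by [].
apply: sigma_of_sub.
  split=> [|A mA|F mF] /=; first by rewrite preimage_set0.
  - by rewrite setTD preimage_setC; exact: measurableC.
  - by rewrite preimage_bigcup; exact: bigcupT_measurable.
by move=> j x Dj /=; rewrite -[X in measurable X]setTI; exact: mV.
Qed.

Lemma path_law_unique d1 d2 (T1 : measurableType d1) (T2 : measurableType d2)
    (m1 : {measure set T1 -> \bar R}) (m2 : {measure set T2 -> \bar R})
    (V1 : J -> T1 -> R) (V2 : J -> T2 -> R) :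
  (forall j, D j -> measurable_fun setT (V1 j)) ->
  (forall j, D j -> measurable_fun setT (V2 j)) ->
  (forall l, (forall p, p \in l -> D p.1) ->
    m1 (cylinder V1 (rays l)) = m2 (cylinder V2 (rays l))) ->
  m1 setT < +oo ->
  forall A : set path_space, measurable A ->
    m1 ((fun w => V1 ^~ w) @^-1` A) = m2 ((fun w => V2 ^~ w) @^-1` A).
Proof.
move=> mV1 mV2 m12 m1oo A mA.
apply: (sigma_of_unique (m1 := image_measure m1 (measurable_path mV1))
  (m2 := image_measure m2 (measurable_path mV2))
  (V := fun j (v : path_space) => v j) (D := D)) => //.
- exact: measurable_coordinate.
- move=> l lD.
  have preE U (V : J -> U -> R) :=
    cylinder_preimage (fun j (v : J -> R) => v j) (fun w => V ^~ w) (rays l).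
  have := m12 l lD.
  by rewrite -[cylinder V1 _](preE _ V1) -[cylinder V2 _](preE _ V2).
Qed.

(** The bound at the time [j0] tends to infinity, which removes it from the
    list. This serves when finite-dimensional laws are known only for lists of
    times that contain [j0], as for a weight at the time [j0]. *)
Lemma path_law_unique_at (j0 : J) d1 d2 (T1 : measurableType d1)
    (T2 : measurableType d2)
    (m1 : {measure set T1 -> \bar R}) (m2 : {measure set T2 -> \bar R})
    (V1 : J -> T1 -> R) (V2 : J -> T2 -> R) :
  D j0 ->
  (forall j, D j -> measurable_fun setT (V1 j)) ->
  (forall j, D j -> measurable_fun setT (V2 j)) ->
  (forall l x, (forall p, p \in l -> D p.1) ->
    m1 (cylinder V1 (rays ((j0, x) :: l))) =
    m2 (cylinder V2 (rays ((j0, x) :: l)))) ->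
  m1 setT < +oo ->
  forall A : set path_space, measurable A ->
    m1 ((fun w => V1 ^~ w) @^-1` A) = m2 ((fun w => V2 ^~ w) @^-1` A).
Proof.
move=> Dj0 mV1 mV2 m12 m1oo; apply: path_law_unique => // l lD.
have approx d (U : measurableType d) (m : {measure set U -> \bar R})
    (V : J -> U -> R) : (forall j, D j -> measurable_fun setT (V j)) ->
    m (cylinder V (rays ((j0, n%:R) :: l))) @[n --> \oo] -->
    m (cylinder V (rays l)).
  move=> mV.
  have mC l' : (forall p, p \in l' -> D p.1) -> measurable (cylinder V (rays l')).
    move=> l'D; apply: measurable_cylinder => _ /mapP[q ql ->] /=.
    by split; [exact/mV/l'D|exact: measurable_itv].
  have DlD n : forall p, p \in (j0, n) :: l -> D p.1.
    by move=> p; rewrite inE => /predU1P[->|/lD].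
  have -> : cylinder V (rays l) = \bigcup_n cylinder V (rays ((j0, n%:R) :: l)).
    apply/seteqP; split => [w wl|w [n _]]; last by rewrite /= cylinder_cons => -[].
    exists (Num.truncn (V j0 w)).+1 => //=; rewrite cylinder_cons; split => //=.
    by rewrite in_itv/= ltW// truncnS_gt.
  apply: nondecreasing_cvg_mu.
  - by move=> n; exact/mC/DlD.
  - by apply: bigcupT_measurable => n; exact/mC/DlD.
  - move=> n m' nm; apply/subsetPset => w; rewrite /= !cylinder_cons => -[/= wn wl].
    split=> //=; move: wn; rewrite !in_itv/= => /le_trans; apply.
    by rewrite ler_nat.
apply: cvg_unique (approx _ _ m1 _ mV1) _ => //.
rewrite (_ : (fun n => m1 _) = (fun n => m2 (cylinder V2 (rays ((j0, n%:R) :: l))))).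
  exact: approx.
by apply/funext => n; exact: m12.
Qed.

End path_space.

Section lebesgue_affine.
Context (R : realType).
Local Notation mu := (@lebesgue_measure R).

(** The image of Lebesgue measure under [x |-> c x + a], multiplied by [c],
    gives half-open intervals their length, so it is Lebesgue measure. *)
Lemma ge0_integral_affine (c a : R) (f : R -> \bar R) : (0 < c)%R ->
  measurable_fun setT f -> (forall x, 0 <= f x) ->
  \int[mu]_x f x = c%:E * \int[mu]_x f (c * x + a)%R.
Proof.
move=> c0 mf f0.
have mphi0 : measurable_fun setT (fun x : R => (c * x + a)%R).
  by apply: measurable_funD => //; exact: measurable_funM.
pose phi (x : measurableTypeR R) : measurableTypeR R := (c * (x : R) + a)%R.
have mphi : measurable_fun setT phi by exact: mphi0.
pose k : {nonneg R} := NngNum (ltW c0).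
transitivity (\int[mscale k (image_measure mu mphi)]_x f x).
  apply: eq_measure_integral => A mA _; apply: lebesgue_measure_unique => //.
  move=> _ [[p q] _ <-]; change (mu `]p, q] = c%:E * mu (phi @^-1` `]p, q])).
  have -> : phi @^-1` `]p, q]%classic = `]((p - a) / c)%R, ((q - a) / c)%R]%classic.
    by apply/seteqP; split => x /=; rewrite !in_itv/= /phi ltr_pdivrMr// ler_pdivlMr//
      ltrBlDr lerBrDr mulrC.
  rewrite !lebesgue_measure_itv/= !lte_fin ltr_pM2r ?invr_gt0// ltrD2r.
  case: ifPn => _; last by rewrite mule0.
  rewrite -!EFinB -EFinM; congr EFin; rewrite -mulrBl mulrCA divff ?gt_eqF// mulr1.
  by rewrite opprD opprK addrACA addNr addr0.
by rewrite ge0_integral_mscale// ge0_integral_image.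
Qed.

Lemma ge0_integral_shift (a : R) (f : R -> \bar R) :
  measurable_fun setT f -> (forall x, 0 <= f x) ->
  \int[mu]_x f (x + a)%R = \int[mu]_x f x.
Proof.
move=> mf f0; rewrite (@ge0_integral_affine 1 a f)// mul1e.
by apply: eq_integral => x _; rewrite mul1r.
Qed.

Lemma ge0_integral_reflect (a : R) (f : R -> \bar R) :
  measurable_fun setT f -> (forall x, 0 <= f x) ->
  \int[mu]_x f (a - x)%R = \int[mu]_x f x.
Proof.
move=> mf f0.
have mg : measurable_fun setT (fun x : R => f (x + a)%R).
  by apply: (measurableT_comp mf); exact: measurable_funD.
rewrite -(@ge0_integral_shift a f)//.
have mN : measurable_fun setT (-%R : measurableTypeR R -> measurableTypeR R).
  by [].
transitivity (\int[image_measure mu mN]_x f (x + a)%R).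
  by rewrite ge0_integral_image//; apply: eq_integral => x _; rewrite addrC.
by apply: eq_measure_integral => A mA _; exact: lebesgue_measureN.
Qed.

End lebesgue_affine.

Section independent_event.
Context d (O : measurableType d) (R : realType) (Q : probability O R).

(** Both sides are finite measures of [A], so that it is enough to compare
    them on cylinders over half-lines. *)
Lemma path_independent_event (J : eqType) (D : set J) (E : set O)
    (V : J -> O -> R) :
  measurable E -> (forall j, D j -> measurable_fun setT (V j)) ->
  (forall l, (forall p, p \in l -> D p.1) ->
    Q (E `&` cylinder V (rays l)) = Q E * Q (cylinder V (rays l))) ->
  forall A : set (path_space R D), measurable A ->
    Q (E `&` (fun w => V ^~ w) @^-1` A) = Q E * Q ((fun w => V ^~ w) @^-1` A).
Proof.
move=> mE mV prodV A mA.
have Qfin : Q E \is a fin_num by exact: fin_num_measure.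
pose q : {nonneg R} := NngNum (fine_ge0 (measure_ge0 Q E)).
have qE : Q E = q%:num%:E by rewrite /= fineK.
have := @path_law_unique R J D _ _ O O (mrestr Q mE) (mscale q Q) V V mV mV.
move=> uniq; rewrite setIC qE; apply: uniq => //.
  move=> l lD; change (Q (cylinder V (rays l) `&` E) =
    q%:num%:E * Q (cylinder V (rays l))).
  by rewrite -qE setIC; exact: prodV.
by apply: probability_lty; exact: measurableI.
Qed.

End independent_event.

Section lebesgue_density.
Context (R : realType).
Local Notation leb := (@lebesgue_measure R).

Let measurable_id_lebesgue : measurable_fun setT (id : measurableTypeR R -> R).
Proof. by move=> _ A mA; rewrite setTI. Qed.

Let lebR : {measure set R -> \bar R} := image_measure leb measurable_id_lebesgue.

(** Lebesgue measure lives on a copy of [R] with its own measurable structure.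
    Transporting it by the identity makes the general density formula
    applicable to measures on [R]. *)
Lemma integral_of_lebesgue_density (m : {measure set R -> \bar R})
    (g h : R -> \bar R) :
  measurable_fun setT g -> (forall x, 0 <= g x) ->
  (forall A, measurable A -> m A = \int[leb]_(x in A) g x) ->
  measurable_fun setT h -> (forall x, 0 <= h x) ->
  \int[m]_x h x = \int[leb]_x (h x * g x).
Proof.
move=> mg g0 mE mh h0.
rewrite (@integral_of_density _ _ _ lebR g mg g0 m)//.
  rewrite ge0_integral_image//; first exact: emeasurable_funM.
  by move=> x; exact: mule_ge0.
move=> A mA; rewrite mE// integral_mkcond ge0_integral_image//.
- by rewrite [LHS]integral_mkcond.
- by apply/(measurable_restrictT _ mA); exact: measurable_funTS.
- by move=> x; exact: erestrict_ge0.
Qed.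

End lebesgue_density.

Lemma fubini_lebesgue d (U : measurableType d) (R : realType)
    (m : probability U R) (h : R * U -> \bar R) :
  measurable_fun setT h -> (forall x, 0 <= h x) ->
  \int[lebesgue_measure]_x \int[m]_y h (x, y) =
  \int[m]_y \int[lebesgue_measure]_x h (x, y).
Proof.
move=> mh h0.
exact: (fubini_tonelli (m1 := @lebesgue_measure R) (m2 := m) h).
Qed.
Lemma measurable_integral_lebesgue d (U : measurableType d) (R : realType)
     (h : R * U -> \bar R) :
  measurable_fun setT h -> (forall x, 0 <= h x) ->
  measurable_fun setT (fun y => \int[lebesgue_measure]_x h (x, y)).
Proof.
move=> mh h0.
exact: (measurable_fun_fubini_tonelli_G (m1 := @lebesgue_measure R) h).
Qed.

Section cylinder_limit.
Context (R : realType) (J : eqType) d (Omega : measurableType d)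
  (P : probability Omega R).

Definition shift_rays (e : R) (l : seq (J * R)) : seq (J * R) :=
  [seq (p.1, p.2 + e)%R | p <- l].

(** The half-line part of the portmanteau theorem, for pointwise convergence.
    Raising the bounds by [e] puts the limit cylinder inside the inferior
    limit of the approximating ones, which gives the upper estimate [p e]; the
    superior limit of the unshifted ones lies inside the limit cylinder, which
    gives the lower estimate [p 0]. The two estimates meet by right-continuity
    of [p] at [0]. *)
Lemma cylinder_limit (W : nat -> J -> Omega -> R) (W' : J -> Omega -> R)
    (l : seq (J * R)) (p : R -> \bar R) :
  (forall n q, q \in l -> measurable_fun setT (W n q.1)) ->
  (forall q, q \in l -> measurable_fun setT (W' q.1)) ->
  (forall q w, q \in l -> W n q.1 w @[n --> \oo] --> W' q.1 w) ->
  (forall e, (0 <= e)%R ->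
    P (cylinder (W n) (rays (shift_rays e l))) @[n --> \oo] --> p e) ->
  p (n.+1%:R^-1)%R @[n --> \oo] --> p 0%R ->
  P (cylinder W' (rays l)) = p 0%R.
Proof.
move=> mW mW' WW' Wp p0.
have mC V e : (forall q, q \in l -> measurable_fun setT (V q.1)) ->
    measurable (cylinder V (rays (shift_rays e l)) : set Omega).
  move=> mV; apply: measurable_cylinder => _ /mapP[_ /mapP[q ql ->] ->] /=.
  by split; [exact: mV|exact: measurable_itv].
have shift0 : shift_rays 0 l = l.
  by rewrite /shift_rays -[RHS]map_id; apply: eq_map => -[? ?]; rewrite /= addr0.
have mW'l : measurable (cylinder W' (rays l)).
  by rewrite -shift0; exact: mC.
have mWn n e : measurable (cylinder (W n) (rays (shift_rays e l))).
  by apply: mC => q; exact: mW.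
apply/le_anti/andP; split.
- rewrite -(cvg_lim _ p0)//; apply: lime_ge; first exact: cvgP p0.
  apply: nearW => k; set e : R := k.+1%:R^-1%R.
  pose B N := \bigcap_(n >= N) cylinder (W n) (rays (shift_rays e l)).
  have mB N : measurable (B N) by exact: bigcap_measurableType.
  have BU : P (B N) @[N --> \oo] --> P (\bigcup_N B N).
    apply: nondecreasing_cvg_mu => //; first exact: bigcupT_measurable.
    move=> N M NM; apply/subsetPset => w Bw n /= Mn; apply: Bw => /=.
    exact: leq_trans Mn.
  apply: (@le_trans _ _ (P (\bigcup_N B N))).
    apply: le_measure; rewrite ?inE//; first exact: bigcupT_measurable.
    move=> w; rewrite cylinder_raysE => wl.
    suff [N _ NP] : \forall n \near \oo, forall q, q \in l ->
        (W n q.1 w <= q.2 + e)%R.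
      exists N => // n /= Nn; rewrite cylinder_raysE => _ /mapP[q ql ->] /=.
      exact: NP.
    suff near_l (l' : seq (J * R)) : {subset l' <= l} -> \forall n \near \oo, forall q,
        q \in l' -> (W n q.1 w <= q.2 + e)%R by exact: near_l.
    elim: l' => [_|q l' IH ql]; first by exists 0%N.
    have e0 : (0 < e)%R by rewrite invr_gt0.
    have {}IH := IH (fun q ql' => ql _ (mem_behead (s := _ :: _) ql')).
    have Wq : \forall n \near \oo, (W n q.1 w < q.2 + e)%R.
      apply: cvgr_lt; first by apply: WW'; exact/ql/mem_head.
      by rewrite (le_lt_trans (wl _ (ql _ (mem_head _ _)))) ?ltrDl.
    move: IH Wq; apply: filterS2 => n IHn Wn q2.
    by rewrite inE => /predU1P[->|/IHn//]; exact: ltW.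
  rewrite -(cvg_lim _ BU)//; apply: lime_le.
    exact: cvgP BU.
  apply: nearW => N.
  have e0 : (0 <= e)%R by rewrite invr_ge0.
  rewrite -(cvg_lim _ (Wp e e0))//; apply: lime_ge.
    exact: cvgP (Wp e e0).
  exists N => // n /= Nn; apply: le_measure; rewrite ?inE//.
  by move=> w; exact.
- have [F mF] : exists F : (set Omega)^nat, F = fun n => cylinder (W n) (rays l).
    by eexists.
  have mF' n : measurable (F n) by rewrite mF -shift0.
  have mU n : measurable (\bigcup_(k >= n) F k) by exact: bigcup_measurable.
  have supP := lim_sup_set_cvg P F mF' (probability_lty P (mU 0%N)).
  apply: (@le_trans _ _ (P (lim_sup_set F))).
    rewrite -(cvg_lim _ supP)//; apply: lime_ge.
      exact: cvgP supP.
    apply: nearW => N; have Wp0 := Wp 0%R (lexx 0%R).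
    rewrite -(cvg_lim _ Wp0)//; apply: lime_le.
      exact: cvgP Wp0.
    exists N => // n /= Nn; apply: le_measure; rewrite ?inE//.
    by rewrite shift0 mF => w wl; exists n.
  apply: le_measure; rewrite ?inE//.
    by apply: bigcapT_measurable => n; exact: mU.
  move=> w supw; rewrite cylinder_raysE => q ql.
  rewrite leNgt; apply/negP => qw.
  have [N _ NP] : \forall n \near \oo, (q.2 < W n q.1 w)%R.
    by apply: cvgr_gt qw; exact: WW'.
  have [k /= Nk] := supw N I; rewrite mF cylinder_raysE => /(_ q ql).
  by rewrite leNgt NP.
Qed.

End cylinder_limit.

(** * Bridges as transforms of a Levy process, and weak consistency *)

Section independent_families.
Context d (O : measurableType d) (R : realType) (Q : probability O R).

(** Independence of [Z 0] from each cylinder of the later variables extends to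
    their whole sigma-algebra. *)
Lemma independent_head (Z : nat -> O -> R) (k : nat) :
  (forall j, measurable_fun setT (Z j)) ->
  (forall B : nat -> set R, (forall j, measurable (B j)) ->
    Q (\bigcap_(j in [set j | (j < k.+1)%N]) Z j @^-1` B j) =
    \prod_(j < k.+1) Q (Z j @^-1` B j)) ->
  forall (B : set R) (A : set (path_space R [set j | (0 < j <= k)%N])),
    measurable B -> measurable A ->
    Q (Z 0%N @^-1` B `&` (fun w => Z ^~ w) @^-1` A) =
    Q (Z 0%N @^-1` B) * Q ((fun w => Z ^~ w) @^-1` A).
Proof.
move=> mZ prodZ B A mB mA.
have mZB j C : measurable C -> measurable (Z j @^-1` C).
  by move=> mC; rewrite -[X in measurable X]setTI; exact: mZ.
apply: path_independent_event => //; first exact: mZB.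
move=> l lk.
pose Bl j : set R := \big[setI/setT]_(p <- l | p.1 == j) `]-oo, p.2]%classic.
have mBl j : measurable (Bl j).
  by apply: bigsetI_measurable => p _; exact: measurable_itv.
have Bl0 : Bl 0%N = setT.
  rewrite /Bl big_seq_cond big1// => p /andP[/lk/= + /eqP p0].
  by rewrite p0.
have cylE : cylinder Z (rays l) =
    \bigcap_(j in [set j | (j < k.+1)%N]) Z j @^-1` Bl j.
  rewrite cylinder_raysE; apply/seteqP; split => [w wl j _|w wB p pl].
  - rewrite /Bl /= -bigcap_seq_cond => p /= /andP[pl /eqP pj].
    by rewrite in_itv/= -pj; exact: wl.
  - have /(_ p.1) : (\bigcap_(j in [set j | (j < k.+1)%N]) Z j @^-1` Bl j) w by [].
    have /andP[_ pk] := lk _ pl.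
    rewrite /= ltnS => /(_ pk); rewrite /Bl -bigcap_seq_cond.
    by move=> /(_ p); rewrite /= pl eqxx in_itv/=; exact.
have -> : Q (Z 0%N @^-1` B `&` cylinder Z (rays l)) =
    Q (\bigcap_(j in [set j | (j < k.+1)%N])
         Z j @^-1` (if j == 0%N then B else Bl j)).
  rewrite cylE; congr (Q _); apply/seteqP; split => [w [wB wl] j jk/=|w wB].
    by case: eqP => [->//|_]; exact: wl.
  split; first exact: (wB 0%N).
  move=> j jk; have := wB j jk => /=; case: eqP => [-> _|//].
  by rewrite Bl0.
rewrite prodZ; last by move=> j; case: ifP.
rewrite cylE prodZ// !big_ord_recl/= Bl0 preimage_setT.
by rewrite [Q setT]probability_setT mul1e.
Qed.

End independent_families.

Section levy_increments.
Context d (O : measurableType d) (R : realType) (Q : probability O R).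
Variable X : R -> {RV Q >-> R}.
Hypothesis indepX : independent_increments Q X.

(** A cylinder over the times [t1 < ... < tk] of the path after [t1] is read
    off from finitely many successive increments, which are independent of the
    increment over [[t0, t1]]. *)
Lemma levy_increment_tail (t0 t1 : R) (B : set R)
    (A : set (path_space R [set t | (t1 <= t)%R])) :
  (0 <= t0 <= t1)%R -> measurable B -> measurable A ->
  Q ((X t1 \- X t0)%R @^-1` B `&` (fun w t => X t w - X t1 w)%R @^-1` A) =
  Q ((X t1 \- X t0)%R @^-1` B) * Q ((fun w t => X t w - X t1 w)%R @^-1` A).
Proof.
move=> /andP[t00 t01] mB mA.
apply: (path_independent_event (V := fun t w => (X t w - X t1 w)%R)) => //.
- by rewrite -[X in measurable X]setTI; exact: measurable_funB.
- by move=> t _; exact: measurable_funB.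
move=> l lt1; pose ts := sort <=%R (map fst l).
pose tau j := if j is j'.+1 then nth (last t1 ts) (t1 :: ts) j' else t0.
pose Z j w := (X (tau j.+1) w - X (tau j) w)%R.
have ts_path : path <=%R t1 ts.
  rewrite path_min_sorted; first exact: sort_le_sorted.
  by apply/allP => t; rewrite mem_sort => /mapP[p /lt1 ? ->].
have tau_nd j : (j < (size ts).+1)%N -> (tau j <= tau j.+1)%R.
  case: j => [_//|j]; rewrite ltnS => jts /=.
  by have /pathP -/(_ (last t1 ts) j jts) := ts_path.
have mZ j : measurable_fun setT (Z j) by exact: measurable_funB.
have head := @independent_head _ O R Q Z (size ts) mZ.
pose V' t (z : path_space R [set j | (0 < j <= size ts)%N]) : R :=
  (\sum_(1 <= j < (index t ts).+2) z j)%R.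
have tsE t : t \in map fst l -> (index t ts < size ts)%N.
  by rewrite index_mem mem_sort.
have cylE : cylinder (fun t w => (X t w - X t1 w)%R) (rays l) =
    (fun w => Z ^~ w) @^-1` cylinder V' (rays l).
  rewrite !cylinder_raysE; apply/seteqP; split => w wl p pl; move: (wl p pl);
    rewrite /V' /Z telescope_sumr//= nth_index ?mem_sort//; exact: map_f.
rewrite cylE; apply: head => //.
  by move=> B' mB'; exact: indepX.
apply: measurable_cylinder => p pl; split; last first.
  by case/mapP : pl => q ql ->; exact: measurable_itv.
have sum_meas n : (n <= size ts)%N -> measurable_fun setT
    (fun z : path_space R [set j | (0 < j <= size ts)%N] =>
       \sum_(1 <= j < n.+1) z j)%R.
  elim: n => [_|n IH nts].
    by rewrite (_ : (fun _ => _) = cst 0%R)//; apply/funext => z; rewrite big_geq.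
  rewrite (_ : (fun _ => _) =
    (fun z : path_space R [set j | (0 < j <= size ts)%N] =>
       \sum_(1 <= j < n.+1) z j + z n.+1)%R); last first.
    by apply/funext => z; rewrite big_nat_recr.
  apply: (measurable_funD (IH (ltnW nts))).
  by apply: measurable_coordinate; rewrite /= nts.
by apply: sum_meas; apply: tsE; case/mapP : pl => q ql ->; exact: map_f.
Qed.

End levy_increments.

Section box_integral.
Context (R : realType).

(** A bridge density ends with a factor attached to the terminal value and a
    weighted law ends with a weight; [g] stands for either of them. Allowing
    arbitrary sets, and [setT] in particular, makes it possible to add a time. *)
Fixpoint box_integral (f g : R -> R -> \bar R) (t0 y0 : R)
    (l : seq (R * set R)) : \bar R :=
  match l with
  | [::] => g t0 y0
  | (t, A) :: l' =>
      \int[lebesgue_measure]_(y in A)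
        (f (t - t0)%R (y - y0)%R * box_integral f g t y l')
  end.

Lemma bridge_integralE (f : R -> R -> \bar R) T z t0 y0 txs :
  bridge_integral f T z t0 y0 txs =
  box_integral f (fun t y => f (T - t)%R (z - y)%R) t0 y0 (rays txs).
Proof.
elim: txs t0 y0 => [//|[t x] txs IH] t0 y0 /=.
by apply: eq_integral => y _; rewrite IH.
Qed.

Lemma box_integral_rcons (f g : R -> R -> \bar R) t0 y0 l t A :
  box_integral f g t0 y0 (rcons l (t, A)) =
  box_integral f (fun s x => \int[lebesgue_measure]_(y in A)
    (f (t - s)%R (y - x)%R * g t y)) t0 y0 l.
Proof.
elim: l t0 y0 => [//|[s B] l IH] t0 y0 /=.
by apply: eq_integral => y _; rewrite IH.
Qed.

Lemma box_integral_shift (f g : R -> R -> \bar R) a t0 y0 l :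
  box_integral f (fun t => g (t - a)%R) (t0 + a)%R y0 [seq (p.1 + a, p.2)%R | p <- l] =
  box_integral f g t0 y0 l.
Proof.
elim: l t0 y0 => [|[t A] l IH] t0 y0 /=; first by rewrite addrK.
apply: eq_integral => y _; rewrite IH.
by rewrite opprD addrACA subrr addr0.
Qed.

End box_integral.

Section levy_boxes.
Context d (O : measurableType d) (R : realType) (Q : probability O R).
Variables (X : R -> {RV Q >-> R}) (T : R) (f : R -> R -> \bar R).
Hypothesis levyX : levy_process X.
Hypothesis densX : forall t, (0 < t <= T)%R -> has_density (X t) (f t).
Local Notation leb := (@lebesgue_measure R).

Lemma density_ge0 t : (0 < t <= T)%R -> forall x, 0 <= f t x.
Proof. by move=> /densX[]. Qed.

Lemma density_measurable t : (0 < t <= T)%R -> measurable_fun setT (f t).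
Proof. by move=> /densX[]. Qed.

Lemma increment_density s t B : (0 <= s)%R -> (s < t)%R -> (t <= T)%R ->
  measurable B ->
  distribution Q (X t \- X s)%R B = \int[leb]_(x in B) f (t - s)%R x.
Proof.
move=> s0 st tT mB; case: levyX => _ X0 _ statX.
have ts0 : (0 < t - s <= T)%R by rewrite subr_gt0 st /=; lra.
have [_ _ <- //] := densX ts0.
have := statX s t B; rewrite s0 ltW//= => /(_ isT mB) E.
transitivity (Q [set w | B (X (t - s) w - X 0 w)%R]); first exact: E.
apply: ae_eq_measure.
- by rewrite -[X in measurable X]setTI; exact: measurable_funB.
- by rewrite -[X in measurable X]setTI; exact: measurable_funP.
- by apply: filterS X0 => w /= ->; rewrite subr0.
Qed.

(** Splitting off the starting point [yv.1] from the path [yv.2] of increments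
    after [t0] is what allows an induction on the list of times: after one
    step, the new starting point is independent of the new path. *)
Definition box_functional (g : R -> R -> \bar R) (t0 : R) (l : seq (R * set R))
    (yv : R * path_space R [set t | (t0 <= t)%R]) : \bar R :=
  (\1_(cylinder (fun t (yv : R * path_space R [set t | (t0 <= t)%R]) =>
      (yv.1 + yv.2 t)%R) l) yv)%:E *
  g (last t0 (map fst l)) (yv.1 + yv.2 (last t0 (map fst l)))%R.

Arguments box_functional : clear implicits.

Lemma measurable_shifted_coordinate (t0 t : R) : (t0 <= t)%R ->
  measurable_fun setT
    (fun yv : R * path_space R [set t | (t0 <= t)%R] => (yv.1 + yv.2 t)%R).
Proof.
move=> t0t; apply: measurable_funD => //.
by apply: (measurableT_comp (measurable_coordinate _)).
Qed.

Lemma measurable_box_functional g (t0 : R) (l : seq (R * set R)) :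
  measurable_fun setT (g (last t0 (map fst l))) ->
  path <%R t0 (map fst l) -> (forall p, p \in l -> measurable p.2) ->
  measurable_fun setT (box_functional g t0 l).
Proof.
move=> mg lpath ml.
have le_t0 t : t \in t0 :: map fst l -> (t0 <= t)%R.
  rewrite inE => /predU1P[->//|tl].
  by have /allP/(_ t tl)/ltW := order_path_min lt_trans lpath.
apply: emeasurable_funM.
  apply/measurable_EFinP/measurable_indic.
  apply: measurable_cylinder => p pl; split; last exact: ml.
  by apply: measurable_shifted_coordinate; rewrite le_t0// inE map_f ?orbT.
apply: (measurableT_comp mg); apply: measurable_shifted_coordinate.
by apply: le_t0; exact: mem_last.
Qed.

Lemma box_functional_ge0 g t0 l yv :
  (forall x, 0 <= g (last t0 (map fst l)) x) -> 0 <= box_functional g t0 l yv.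
Proof. by move=> g0; rewrite mule_ge0// lee_fin. Qed.

(** Each nested integral integrates the density of one increment, which is
    independent of the following path. *)
Lemma box_integralE g (t0 y0 : R) (l : seq (R * set R)) :
  measurable_fun setT (g (last t0 (map fst l))) ->
  (forall x, 0 <= g (last t0 (map fst l)) x) ->
  (0 <= t0)%R -> path <%R t0 (map fst l) -> (last t0 (map fst l) <= T)%R ->
  (forall p, p \in l -> measurable p.2) ->
  box_integral f g t0 y0 l =
  \int[Q]_w box_functional g t0 l (y0, fun t => X t w - X t0 w)%R.
Proof.
elim: l t0 y0 => [|[t1 A] l IH] t0 y0 /= mg g0 t00.
  move=> _ _ _; under eq_integral do
    rewrite /box_functional /= subrr addr0 /cylinder big_nil indicT mul1e.
  by rewrite integral_probability_cst.
move=> /andP[t01 lpath] lT ml.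
have mA : measurable A by exact: (ml (t1, A)) (mem_head _ _).
have ml' p : p \in l -> measurable p.2.
  by move=> pl; apply: ml; rewrite inE pl orbT.
have t10 : (0 <= t1)%R by rewrite (le_trans t00)// ltW.
have t1T : (t1 <= T)%R.
  apply: le_trans lT; have := mem_last t1 (map fst l).
  rewrite inE => /predU1P[->//|tl].
  by have /allP/(_ _ tl)/ltW := order_path_min lt_trans lpath.
pose h (dv : R * path_space R [set t | (t1 <= t)%R]) :=
  (\1_A (y0 + dv.1)%R)%:E * box_functional g t1 l ((y0 + dv.1)%R, dv.2).
have my0 : measurable_fun setT
    (fun dv : R * path_space R [set t | (t1 <= t)%R] => (y0 + dv.1)%R).
  exact: measurable_funD.
have mh : measurable_fun setT h.
  apply: emeasurable_funM.
    by apply/measurable_EFinP; apply: (measurableT_comp _ my0).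
  apply: (measurableT_comp (measurable_box_functional mg lpath ml')).
  exact: (measurable_fun_pair my0 measurable_snd).
have h0 dv : 0 <= h dv by rewrite mule_ge0 ?lee_fin// box_functional_ge0.
pose V w : path_space R [set t | (t1 <= t)%R] := fun t => (X t w - X t1 w)%R.
have mV : measurable_fun setT V.
  apply: (measurable_path (V := fun t w => (X t w - X t1 w)%R)) => t _.
  exact: measurable_funB.
transitivity (\int[Q]_w h ((X t1 \- X t0)%R w, V w)); last first.
  apply: eq_integral => w _; rewrite /h /box_functional /=.
  rewrite cylinder_cons indicI/= EFinM -muleA.
  have E t : (y0 + (X t1 w - X t0 w) + (X t w - X t1 w) = y0 + (X t w - X t0 w))%R.
    by ring.
  congr (_ * (_%:E * _)).
    rewrite !indicE; congr (_%:R); congr nat_of_bool.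
    by apply/idP/idP; rewrite !inE => /cylinderP wl; apply/cylinderP => p /wl /=;
      rewrite /V E.
  by rewrite /V E.
rewrite (integral_independent (X := (X t1 \- X t0)%R) mV)//; last first.
  by move=> B C mB mC; apply: levy_increment_tail => //; [case: levyX|rewrite t00 ltW].
have mF : measurable_fun setT (fun x => \int[Q]_w h (x, V w)).
  exact: measurable_integral_snd.
have F0 x : 0 <= \int[Q]_w h (x, V w) by exact: integral_ge0.
have mft : measurable_fun setT (f (t1 - t0)%R) by apply: density_measurable; lra.
have ft0 x : 0 <= f (t1 - t0)%R x by apply: density_ge0; lra.
rewrite (integral_of_lebesgue_density mft ft0)//; last first.
  by move=> B mB; exact: increment_density.
rewrite -(ge0_integral_shift (- y0)); last 2 first.
- exact: emeasurable_funM.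
- by move=> x; exact: mule_ge0.
rewrite integral_mkcond; apply: eq_integral => y _.
rewrite patchE; case: ifPn => yA.
  rewrite muleC IH//; congr (_ * _); apply: eq_integral => w _.
  by rewrite /h /= addrC subrK indicE yA mul1e.
rewrite (_ : \int[Q]_w _ = 0) ?mul0e//; apply: integral0_eq => w _.
by rewrite /h /= addrC subrK indicE (negbTE yA) mul0e.
Qed.

End levy_boxes.

Section sorting_rays.
Context (R : realType).

(** Two bounds at the same time merge into their minimum, so the times can be
    kept distinct. *)
Lemma insert_ray (t0 : R) (p : R * R) l :
  (t0 < p.1)%R -> path <%R t0 (map fst l) ->
  exists l', [/\ path <%R t0 (map fst l'), map fst l' =i p.1 :: map fst l &
    forall Omega (V : R -> Omega -> R),
      cylinder V (rays l') = cylinder V (rays (p :: l))].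
Proof.
elim: l t0 => [|q l IH] t0 t0p /=.
  by exists [:: p]; rewrite /= t0p.
move=> /andP[t0q ql]; have [pq|qp|pq] := ltgtP p.1 q.1.
- by exists (p :: q :: l); rewrite /= t0p pq.
- have [l' [l'path l'l l'E]] := IH _ qp ql.
  exists (q :: l'); split => [|x|Omega V].
  + by rewrite /= t0q.
  + by rewrite /= !inE l'l inE orbCA.
  + by rewrite /= !cylinder_cons l'E /= cylinder_cons setICA.
- exists ((p.1, Num.min p.2 q.2) :: l); split => [|x|Omega V].
  + by rewrite /= t0p pq.
  + by rewrite /= !inE pq orbA orbb.
  + rewrite /= !cylinder_cons setIA -pq -preimage_setI; congr (_ @^-1` _ `&` _).
    by apply/seteqP; split => x /=; rewrite !in_itv/= le_min => /andP.
Qed.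

Lemma sort_rays (t0 : R) (l : seq (R * R)) :
  (forall p, p \in l -> (t0 < p.1)%R) ->
  exists l', [/\ path <%R t0 (map fst l'), map fst l' =i map fst l &
    forall Omega (V : R -> Omega -> R),
      cylinder V (rays l') = cylinder V (rays l)].
Proof.
elim: l => [_|p l IH lt0]; first by exists [::].
have [|l1 [l1path l1l l1E]] := IH.
  by move=> q ql; apply: lt0; rewrite inE ql orbT.
have [l' [l'path l'l l'E]] := insert_ray (lt0 _ (mem_head _ _)) l1path.
exists l'; split => // [x|Omega V]; first by rewrite l'l /= !inE l1l.
by rewrite l'E /= !cylinder_cons l1E.
Qed.

Lemma last_sorted_max (t0 s : R) (l : seq R) :
  path <%R t0 l -> s \in l -> (forall t, t \in l -> (t <= s)%R) -> last t0 l = s.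
Proof.
elim: l t0 => [//|t l IH] t0 /= /andP[_ tl]; rewrite inE => /predU1P[->|sl] lmax.
  case: l tl lmax {IH} => [//|u l] /= /andP[tu _] lmax.
  by have := lmax u; rewrite !inE eqxx orbT leNgt tu => /(_ isT).
by apply: IH => // u ul; apply: lmax; rewrite inE ul orbT.
Qed.

Lemma path_lt_last (t0 t : R) l : path <%R t0 l -> t \in l -> (t0 < t <= last t0 l)%R.
Proof.
move=> lpath tl; have /allP/(_ _ tl) -> /= := order_path_min lt_trans lpath.
elim: l t0 lpath tl => [//|t1 l IH] t0 /= /andP[_ t1l]; rewrite inE.
move=> /predU1P[->|tl]; last exact: IH.
have := mem_last t1 l; rewrite inE => /predU1P[->//|ll].
by have /allP/(_ _ ll)/ltW := order_path_min lt_trans t1l.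
Qed.

Lemma path_shift (t0 u : R) l : path <%R t0 l ->
  path <%R (t0 + u)%R [seq (t + u)%R | t <- l].
Proof.
by elim: l t0 => //= t l IH t0 /andP[t0t tl]; rewrite ltrD2r t0t IH.
Qed.

End sorting_rays.

Section levy_box_from.
Context d (O : measurableType d) (R : realType) (Q : probability O R).
Variables (X : R -> {RV Q >-> R}) (T : R) (f : R -> R -> \bar R).
Hypothesis levyX : levy_process X.
Hypothesis densX : forall t, (0 < t <= T)%R -> has_density (X t) (f t).

(** Stationarity: only the differences of the times enter the nested integral,
    so it describes the increments after any time [u]. *)
Lemma levy_box_integral (u : R) (g : R -> R -> \bar R) (l : seq (R * set R)) :
  let v := last 0%R (map fst l) in
  measurable_fun setT (g v) -> (forall x, 0 <= g v x) ->
  (0 <= u)%R -> path <%R 0%R (map fst l) -> (u + v <= T)%R ->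
  (forall p, p \in l -> measurable p.2) ->
  box_integral f g 0 0 l =
  \int[Q]_w ((\1_(cylinder (fun t w => X (u + t) w - X u w)%R l) w)%:E *
             g v (X (u + v) w - X u w)%R).
Proof.
move=> v mg g0 u0 lpath vT ml.
rewrite -(@box_integral_shift _ f g u) add0r.
set ls := [seq _ | p <- l].
have mapE : map fst ls = [seq (t + u)%R | t <- map fst l].
  by rewrite /ls -!map_comp; exact: eq_map.
have lastE : last u (map fst ls) = (v + u)%R.
  by rewrite mapE -[X in last X _]add0r (last_map (fun t => t + u)%R).
rewrite (box_integralE levyX densX) ?lastE; last 6 first.
- by rewrite addrK.
- by move=> x; rewrite addrK.
- exact: u0.
- by have := path_shift u lpath; rewrite add0r mapE.
- by rewrite addrC.
- by move=> _ /mapP[q ql ->]; exact: (ml q ql).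
apply: eq_integral => w _; rewrite /box_functional lastE addrK add0r.
rewrite [(v + u)%R]addrC; congr (_%:E * _).
rewrite !indicE; congr (_%:R); congr nat_of_bool.
have E (t : R) : (0 + (X (t + u) w - X u w) = X (u + t) w - X u w)%R.
  by rewrite add0r (addrC t).
apply/idP/idP; rewrite !inE => /cylinderP wl; apply/cylinderP.
  by move=> p pl; have := wl _ (map_f _ pl); rewrite /= E.
by move=> _ /mapP[p pl ->]; have := wl _ pl; rewrite /= E.
Qed.

Lemma levy_box_integral0 (g : R -> R -> \bar R) (l : seq (R * set R)) :
  let v := last 0%R (map fst l) in
  measurable_fun setT (g v) -> (forall x, 0 <= g v x) ->
  path <%R 0%R (map fst l) -> (v <= T)%R ->
  (forall p, p \in l -> measurable p.2) ->
  box_integral f g 0 0 l =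
  \int[Q]_w ((\1_(cylinder (fun t w => X t w - X 0 w)%R l) w)%:E *
             g v (X v w - X 0 w)%R).
Proof.
move=> v mg g0 lpath vT ml.
rewrite (levy_box_integral (u := 0%R)) ?add0r//.
apply: eq_integral => w _; rewrite -/v; congr (_%:E * _).
rewrite !indicE; congr (_%:R); congr nat_of_bool.
by apply/idP/idP; rewrite !inE => /cylinderP wl; apply/cylinderP => q /wl;
  rewrite add0r.
Qed.

End levy_box_from.

Section bridge_law.
Context (R : realType) (T : R) (f : R -> R -> \bar R) (nu : probability R R).
Context d (O : measurableType d) (Q : probability O R) (X : R -> {RV Q >-> R}).
Context d' (O' : measurableType d') (P : probability O' R) (L : R -> {RV P >-> R}).
Hypothesis T0 : (0 < T)%R.
Hypothesis levyX : levy_process X.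
Hypothesis densX : forall t, (0 < t <= T)%R -> has_density (X t) (f t).
Hypothesis CK : forall s t x, (0 < s)%R -> (s < t)%R -> (t <= T)%R ->
  f t x = \int[lebesgue_measure]_(y in setT) (f (t - s)%R (x - y)%R * f s y).
Hypothesis fT : {ae nu, forall z, 0 < f T z < +oo}.
Hypothesis cadlagL : cadlag_process `[0%R, T] L.
Hypothesis lawLT : forall B, measurable B -> distribution P (L T) B = nu B.
Hypothesis bridgeL : forall txs : seq (R * R), (0 < size txs)%N ->
  path <%R 0%R (rcons (map fst txs) T) ->
  exists g : R -> \bar R,
    cond_prob_at [set w | forall tx, tx \in txs -> (L tx.1 w <= tx.2)%R]
      (L T) g /\
    {ae nu, forall z, g z = bridge_cdf f T z txs}.
Local Notation leb := (@lebesgue_measure R).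

(** The inverse of [f T z] as a real number. It agrees with the inverse in
    [\bar R] for almost every [z], and it is finite everywhere. *)
Definition inv_density (z : R) : \bar R := ((fine (f T z))^-1)%:E.

Lemma inv_density_ae : {ae nu, forall z, inv_density z = (f T z)^-1}.
Proof.
apply: filterS fT => z /andP[fz0 fzoo]; rewrite /inv_density.
rewrite -[in RHS](@fineK _ (f T z)) ?ge0_fin_numE ?(ltW fz0)// inver.
by rewrite gt_eqF// fine_gt0// fz0.
Qed.

Lemma inv_density_ge0 z : 0 <= inv_density z.
Proof.
have [Tz _] : (forall x, 0 <= f T x) /\ True.
  by split=> // x; apply: (density_ge0 densX); rewrite T0 lexx.
by rewrite lee_fin invr_ge0 fine_ge0.
Qed.

Lemma measurable_inv_density : measurable_fun setT inv_density.
Proof.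
have fT0 x : 0 <= f T x by apply: (density_ge0 densX); rewrite T0 lexx.
apply/measurable_EFinP.
rewrite (_ : (fun _ => _) = (fun z => fine (f T z) `^ (-1))%R); last first.
  by apply/funext => z; rewrite powR_inv1// fine_ge0.
apply: (measurableT_comp (measurable_powR _)).
apply: (measurableT_comp (fine_measurable measurableT)).
by apply: (density_measurable densX); rewrite T0 lexx.
Qed.

(** The density at [y] of the bridge at the time [s], with end point [z],
    relative to the law of the Levy process. *)
Definition bridge_kernel (s z y : R) : \bar R :=
  f (T - s)%R (z - y)%R * inv_density z.

Lemma bridge_kernel_ge0 s z y : (0 <= s < T)%R -> 0 <= bridge_kernel s z y.
Proof.
move=> sT; rewrite mule_ge0 ?inv_density_ge0//.
by apply: (density_ge0 densX); lra.
Qed.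

Lemma measurable_bridge_kernel s d1 (U : measurableType d1) (a b : U -> R) :
  (0 <= s < T)%R -> measurable_fun setT a -> measurable_fun setT b ->
  measurable_fun setT (fun u => bridge_kernel s (a u) (b u)).
Proof.
move=> sT ma mb; apply: emeasurable_funM.
  have mf : measurable_fun setT (f (T - s)%R).
    by apply: (density_measurable densX); lra.
  by apply: (measurableT_comp mf); exact: measurable_funB.
exact: (measurableT_comp measurable_inv_density ma).
Qed.

Let Y t w := (X t w - X 0 w)%R.

(** By definition the bridge density is the nested integral with terminal
    factor [f (T - v) (z - y)], which is an expectation over the Levy process. *)
Lemma bridge_box_prob (l : seq (R * R)) B : (0 < size l)%N ->
  path <%R 0%R (rcons (map fst l) T) -> measurable B ->
  P (cylinder L (rays l) `&` L T @^-1` B) =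
  \int[nu]_(z in B) \int[Q]_w ((\1_(cylinder Y (rays l)) w)%:E *
    bridge_kernel (last 0%R (map fst l)) z (Y (last 0%R (map fst l)) w)).
Proof.
move=> l0 lpath mB; have [g [[mg gP] gE]] := bridgeL l0 lpath.
set s := last 0%R (map fst l).
have [lpath' sT] : path <%R 0%R (map fst l) /\ (s < T)%R.
  by move: lpath; rewrite rcons_path => /andP[].
have s0 : (0 <= s)%R.
  rewrite /s; have := mem_last 0%R (map fst l); rewrite inE => /predU1P[->//|sl].
  by have /allP/(_ _ sl)/ltW := order_path_min lt_trans lpath'.
have sT' : (0 <= s < T)%R by rewrite s0.
have ml (p : R * set R) : p \in rays l -> measurable p.2.
  by case/mapP => q _ ->; exact: measurable_itv.
have mY t : measurable_fun setT (Y t) by exact: measurable_funB.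
have mcyl : measurable (cylinder Y (rays l)).
  by apply: measurable_cylinder => p /ml.
have mh : measurable_fun setT (fun zw : R * O =>
    (\1_(cylinder Y (rays l)) zw.2)%:E * bridge_kernel s zw.1 (Y s zw.2)).
  apply: emeasurable_funM.
    apply/measurable_EFinP; apply: (measurableT_comp _ measurable_snd).
    exact: measurable_indic.
  apply: measurable_bridge_kernel => //.
  exact: (measurableT_comp (mY s) measurable_snd).
have h0 (zw : R * O) :
    0 <= (\1_(cylinder Y (rays l)) zw.2)%:E * bridge_kernel s zw.1 (Y s zw.2).
  by rewrite mule_ge0 ?lee_fin ?bridge_kernel_ge0.
rewrite cylinder_raysE gP//.
transitivity (\int[nu]_(z in B) g z).
  by apply: eq_measure_integral => A mA _; exact: lawLT.
apply: ae_eq_integral => //.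
- exact: measurable_funTS.
- apply: measurable_funTS.
  exact: (measurable_integral_snd Q (h := fun zw => _)
    (@measurable_id _ _ setT) mh h0).
apply: filterS2 gE inv_density_ae => z -> invE _.
rewrite /bridge_cdf bridge_integralE.
have Ts : (0 < T - s <= T)%R by rewrite subr_gt0 sT/=; lra.
have mapE : map fst (rays l) = map fst l by rewrite -map_comp.
have mg' : measurable_fun setT (fun y : R => f (T - s)%R (z - y)%R).
  apply: (measurableT_comp (density_measurable densX Ts)).
  exact: measurable_funB.
rewrite (box_integralE levyX densX) ?mapE//; last 2 first.
- by move=> x; exact: (density_ge0 densX).
- exact: ltW.
rewrite -invE -ge0_integralZr//; last 3 first.
- have mp : measurable_fun setT (fun w =>
      (0%R, fun t => Y t w) : R * path_space R [set t | (0 <= t)%R]).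
    apply: measurable_fun_pair => //.
    exact: (@measurable_path R R [set t | (0 <= t)%R] _ O Y (fun t _ => mY t)).
  apply: (measurableT_comp _ mp).
  by apply: measurable_box_functional; rewrite ?mapE.
- by move=> w _; apply: box_functional_ge0 => x; rewrite mapE; exact: (density_ge0 densX).
- exact: inv_density_ge0.
apply: eq_integral => w _; rewrite /box_functional /= mapE -/s add0r -muleA.
congr (_%:E * _); rewrite !indicE; congr (_%:R); congr nat_of_bool.
by apply/idP/idP; rewrite !inE => /cylinderP wl; apply/cylinderP => p /wl /=;
  rewrite add0r.
Qed.

(** The two sides agree on cylinders that contain the time [s], and these
    determine the joint law of the path and of the terminal value. *)
Lemma bridge_joint_law s (h : path_space R [set t | (0 < t <= s)%R] * R -> \bar R) :
  (0 < s < T)%R -> measurable_fun setT h -> (forall x, 0 <= h x) ->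
  \int[P]_w h (L ^~ w, L T w) =
  \int[Q]_w \int[nu]_z (h (Y ^~ w, z) * bridge_kernel s z (Y s w)).
Proof.
move=> /andP[s0 sT] mh h0; have sT' : (0 <= s < T)%R by rewrite ltW.
pose D := [set t | (0 < t <= s)%R].
have mY t : measurable_fun setT (Y t) by exact: measurable_funB.
pose k (wz : O * R) := bridge_kernel s wz.2 (Y s wz.1).
have mk : measurable_fun setT k.
  apply: measurable_bridge_kernel => //.
  exact: (measurableT_comp (mY s) measurable_fst).
have k0 wz : 0 <= k wz by exact: bridge_kernel_ge0.
pose M : {measure set (O * R) -> \bar R} := weighted_measure (Q \x nu)%E mk k0.
pose X2 (wz : O * R) : path_space R D := Y ^~ wz.1.
have mX2 : measurable_fun setT X2.
  exact: (measurableT_comp (measurable_path (fun t _ => mY t)) measurable_fst).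
have mLp : measurable_fun setT (fun w => L ^~ w : path_space R D).
  exact: (measurable_path (V := fun t w => L t w)).
have mZB B : measurable B -> measurable (L T @^-1` B).
  by move=> mB; rewrite -[X in measurable X]setTI; exact: measurable_funP.
transitivity (\int[M]_wz h (X2 wz, wz.2)); last first.
  rewrite (@integral_of_density _ _ _ (Q \x nu)%E k mk k0 M)//; last first.
    apply: (measurableT_comp mh); exact: (measurable_fun_pair mX2 measurable_snd).
  apply: (fubini_tonelli1 (m1 := Q) (m2 := nu) (fun wz => h (X2 wz, wz.2) * k wz)).
    apply: emeasurable_funM => //.
    by apply: (measurableT_comp mh); exact: (measurable_fun_pair mX2 measurable_snd).
  by move=> wz; exact: mule_ge0.
apply: (eq_joint_integral (m1 := P) (m2 := M) (X1 := fun w => L ^~ w : path_space R D)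
  (Y1 := L T) (X2 := X2) (Y2 := snd)) => //; last exact: probability_lty.
move=> A B mA mB.
have mTB : measurable (setT `*` B : set (O * R)) by exact: measurableX.
have -> : snd @^-1` B = setT `*` B :> set (O * R) by apply/seteqP; split => // x [].
pose V2 t (wz : O * R) := Y t wz.1.
apply: (path_law_unique_at (j0 := s) (D := D) (m1 := mrestr P (mZB _ mB))
   (m2 := mrestr M mTB) (V1 := fun t w => L t w) (V2 := V2)) => //.
- by rewrite /D /= s0 lexx.
- by move=> t _; exact: (measurableT_comp (mY t) measurable_fst).
- move=> l x lD.
  change (P (cylinder (fun t w => L t w) (rays ((s, x) :: l)) `&` L T @^-1` B) =
    \int[Q \x nu]_(wz in cylinder V2 (rays ((s, x) :: l)) `&` (setT `*` B)) k wz).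
  have [|l' [l'path l'l l'E]] := @sort_rays R 0%R ((s, x) :: l).
    by move=> p; rewrite inE => /predU1P[->//|/lD/andP[]].
  have ls : last 0%R (map fst l') = s.
    apply: (@last_sorted_max _ _ s) => // [|t]; rewrite l'l ?mem_head//.
    by move=> /mapP[p + ->]; rewrite inE => /predU1P[->//|/lD/andP[]].
  rewrite -!l'E bridge_box_prob//; last 2 first.
  + by case: l' ls {l'path l'l l'E} => //=; move: s0; lra.
  + by rewrite rcons_path l'path ls.
  rewrite ls; set C := cylinder Y (rays l').
  have mC : measurable C.
    apply: measurable_cylinder => _ /mapP[q _ ->] /=.
    by split=> //; exact: measurable_itv.
  pose e (wz : O * R) := ((\1_C wz.1)%:E * k wz) * (\1_B wz.2)%:E.
  have me : measurable_fun setT e.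
    apply: emeasurable_funM; first apply: emeasurable_funM => //.
      apply/measurable_EFinP; apply: (measurableT_comp _ measurable_fst).
      exact: measurable_indic.
    apply/measurable_EFinP; apply: (measurableT_comp _ measurable_snd).
    exact: measurable_indic.
  have e0 wz : 0 <= e wz.
    by apply: mule_ge0; [apply: mule_ge0 => //|]; rewrite lee_fin.
  transitivity (\int[Q \x nu]_wz e wz); last first.
    rewrite [RHS]integral_mkcond; apply: eq_integral => -[w z] _.
    have -> : e (w, z) = k (w, z) * ((\1_C w)%:E * (\1_B z)%:E).
      have ACA (a b c : \bar R) : a * b * c = b * (a * c).
        by rewrite muleA [b * a]muleC.
      exact: ACA.
    rewrite epatch_indic indicI /= EFinM; congr (_ * (_%:E * _%:E)).
      rewrite !indicE; congr (_%:R); congr nat_of_bool.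
      by apply/idP/idP; rewrite !inE => /cylinderP wl; apply/cylinderP.
    by rewrite !indicE in_setX in_setT.
  rewrite (fubini_tonelli1 (m1 := Q) (m2 := nu) e me e0) (fubini_tonelli _ me e0).
  rewrite [LHS]integral_mkcond; apply: eq_integral => z _.
  rewrite epatch_indic -ge0_integralZr//.
  + apply: emeasurable_funM; first exact/measurable_EFinP/measurable_indic.
    exact: measurable_bridge_kernel.
  + by move=> w _; rewrite mule_ge0 ?lee_fin// bridge_kernel_ge0.
  + by rewrite lee_fin.
- by apply: probability_lty; apply: measurableI => //; exact: mZB.
Qed.

(** The function of the Doob transform: averaging over the end point leaves a
    weight that depends on the position at the time [s] only. *)
Definition bridge_weight (s y : R) : \bar R := \int[nu]_z bridge_kernel s z y.

Local Notation H := bridge_weight.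

Lemma bridge_weight_ge0 s y : (0 <= s < T)%R -> 0 <= H s y.
Proof. by move=> sT; apply: integral_ge0 => z _; exact: bridge_kernel_ge0. Qed.

Lemma measurable_bridge_weight s : (0 <= s < T)%R -> measurable_fun setT (H s).
Proof.
move=> sT; apply: (@measurable_integral_snd _ _ _ _ _ _ _ nu id
  (fun yz : R * R => bridge_kernel s yz.2 yz.1)) => //.
- by apply: measurable_bridge_kernel.
- by move=> yz; exact: bridge_kernel_ge0.
Qed.

Lemma measurable_density_shift s x : (0 < s <= T)%R ->
  measurable_fun setT (fun y : R => f s (y - x)%R).
Proof.
move=> sT; apply: (measurableT_comp (density_measurable densX sT)).
exact: measurable_funB.
Qed.

(** The Chapman-Kolmogorov equation of [f], averaged over the end point: [H]
    is space-time harmonic. *)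
Lemma bridge_weight_chapman_kolmogorov a b x : (0 <= a)%R -> (a < b)%R -> (b < T)%R ->
  \int[leb]_y (f (b - a)%R (y - x)%R * H b y) = H a x.
Proof.
move=> a0 ab bT.
have baT : (0 < b - a <= T)%R by lra.
have Tb : (0 < T - b <= T)%R by lra.
have bT' : (0 <= b < T)%R by lra.
pose h (yz : R * R) := f (b - a)%R (yz.1 - x)%R * bridge_kernel b yz.2 yz.1.
have mh : measurable_fun setT h.
  apply: emeasurable_funM; last exact: measurable_bridge_kernel.
  exact: (measurableT_comp (measurable_density_shift x baT)).
have f0 y : 0 <= f (b - a)%R y by exact: (density_ge0 densX).
have h0 yz : 0 <= h yz by rewrite mule_ge0// bridge_kernel_ge0.
transitivity (\int[leb]_y \int[nu]_z h (y, z)).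
  apply: eq_integral => y _; rewrite /bridge_weight -ge0_integralZl//.
  + exact: measurable_bridge_kernel.
  + by move=> z _; exact: bridge_kernel_ge0.
rewrite fubini_lebesgue//; apply: eq_integral => z _.
have CKz : f (T - a)%R (z - x)%R =
    \int[leb]_y (f (b - a)%R (z - x - y)%R * f (T - b)%R y).
  rewrite (@CK (T - b)%R (T - a)%R); [|lra..].
  by apply: eq_integral => y _; congr (f _ _ * _); ring.
rewrite [RHS]/bridge_kernel CKz.
have mfz : measurable_fun setT (fun y : R => f (b - a)%R (z - x - y)%R).
  apply: (measurableT_comp (density_measurable densX baT)).
  exact: measurable_funB.
have mfb : measurable_fun setT (f (T - b)%R) by exact: (density_measurable densX).
have fb0 y : 0 <= f (T - b)%R y by exact: (density_ge0 densX).
rewrite -ge0_integralZr//; last 3 first.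
- exact: emeasurable_funM.
- by move=> y _; exact: mule_ge0.
- exact: inv_density_ge0.
rewrite -[RHS](ge0_integral_reflect z)//; last 2 first.
- apply: emeasurable_funM; first exact: emeasurable_funM.
  exact: measurable_cst.
- by move=> y; rewrite !mule_ge0// inv_density_ge0.
apply: eq_integral => y _; rewrite /h /= /bridge_kernel muleA; congr (_ * _ * _).
by congr (f _ _); ring.
Qed.

(** The position at the time [u] is independent of the increments after [u],
    and [f u] is its density. *)
Lemma integrate_out_start u
    (Psi : R * path_space R [set t | (u <= t)%R] -> \bar R) :
  (0 < u <= T)%R -> measurable_fun setT Psi -> (forall x, 0 <= Psi x) ->
  \int[Q]_w Psi (Y u w, fun t => X t w - X u w)%R =
  \int[Q]_w \int[leb]_x (Psi (x, fun t => X t w - X u w)%R * f u x).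
Proof.
move=> /[dup] uT /andP[u0 uT'] mPsi Psi0.
pose V w : path_space R [set t | (u <= t)%R] := (fun t => X t w - X u w)%R.
have mV : measurable_fun setT V.
  apply: (measurable_path (V := fun t w => (X t w - X u w)%R)) => t _.
  exact: measurable_funB.
have lawD A : measurable A ->
    distribution Q (X u \- X 0)%R A = \int[leb]_(x in A) f u x.
  by move=> mA; rewrite (increment_density levyX densX)// subr0.
transitivity (\int[Q]_w Psi ((X u \- X 0)%R w, V w)); first by [].
rewrite (integral_independent (X := (X u \- X 0)%R) mV)//; last first.
  move=> A B mA mB; apply: levy_increment_tail => //; last by rewrite lexx ltW.
  by case: levyX.
have mPsiV : measurable_fun setT (fun xw : R * O => Psi (xw.1, V xw.2)).
  apply: (measurableT_comp mPsi); apply: measurable_fun_pair => //.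
  exact: (measurableT_comp mV measurable_snd).
rewrite (fubini_tonelli (m1 := distribution Q (X u \- X 0)%R) (m2 := Q)
  (fun xw => Psi (xw.1, V xw.2)) mPsiV)//.
apply: eq_integral => w _.
apply: integral_of_lebesgue_density => //.
- exact: (density_measurable densX).
- exact: (density_ge0 densX).
- apply: (measurableT_comp mPsi) => /=.
  have mVw : measurable_fun setT (cst (V w) : R -> path_space R [set t | (u <= t)%R]).
    exact: measurable_cst.
  exact: (measurable_fun_pair (@measurable_id _ R setT) mVw).
Qed.

(** When these increments end at [y], their weight is the integral of [f u x *
    H (u + v) (x + y)] over the position [x] at the time [u]; it equals [H v
    y], because [H] is harmonic between the times [v] and [u + v]. So [u]
    disappears. *)
Lemma bridge_increment_interior u (l : seq (R * R)) : (0 < u)%R ->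
  (0 < size l)%N -> path <%R 0%R (map fst l) ->
  (u + last 0%R (map fst l) < T)%R ->
  P (cylinder (fun v w => L (u + v) w - L u w)%R (rays l)) =
  box_integral f H 0 0 (rays l).
Proof.
move=> u0 l0 lpath lT.
set v := last 0%R (map fst l) in lT *.
have vin : v \in map fst l.
  by rewrite /v; case: (l) l0 => //= p l1 _; exact: mem_last.
have le_v p : p \in l -> (0 < p.1 <= v)%R.
  by move=> pl; apply: path_lt_last => //; exact: map_f.
have v_gt0 : (0 < v)%R.
  by have /andP[] := path_lt_last lpath vin.
have sT : (0 < u + v < T)%R by lra.
have sT' : (0 <= u + v < T)%R by lra.
have mY t : measurable_fun setT (Y t) by exact: measurable_funB.
pose Dl (t : R) (z : R -> R) := (z (u + t) - z u)%R.
have mDl (D : set R) : (forall p, p \in l -> D (u + p.1)%R) -> D u ->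
    measurable (cylinder Dl (rays l) : set (path_space R D)).
  move=> Dp Du; apply: measurable_cylinder => _ /mapP[p pl ->] /=.
  split; last exact: measurable_itv.
  by apply: measurable_funB; apply: measurable_coordinate => //; exact: Dp.
have mDl1 : measurable (cylinder Dl (rays l) :
    set (path_space R [set t | (0 < t <= u + v)%R])).
  by apply: mDl => [p /le_v|] /=; lra.
have mDl2 : measurable (cylinder Dl (rays l) :
    set (path_space R [set t | (u <= t)%R])).
  by apply: mDl => [p /le_v|] /=; lra.
transitivity (\int[P]_w (\1_(cylinder Dl (rays l)) (L ^~ w))%:E).
  rewrite -[X in P X]setIT -integral_indic//; last first.
    apply: measurable_cylinder => _ /mapP[p pl ->] /=.
    by split; [exact: measurable_funB|exact: measurable_itv].
  by apply: eq_integral => w _; rewrite -(cylinder_preimage Dl (fun w => L ^~ w)).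
rewrite (@bridge_joint_law (u + v)%R (fun xz => (\1_(cylinder Dl (rays l)) xz.1)%:E))//; last first.
  apply/measurable_EFinP; apply: (measurableT_comp _ measurable_fst).
  exact: measurable_indic.
pose V w (t : R) := (X t w - X u w)%R.
pose Psi (xp : R * path_space R [set t | (u <= t)%R]) :=
  (\1_(cylinder Dl (rays l)) xp.2)%:E * H (u + v)%R (xp.1 + xp.2 (u + v))%R.
have cylV w : \1_(cylinder Dl (rays l)) (Y ^~ w) = \1_(cylinder Dl (rays l)) (V w) :> R.
  rewrite !indicE; congr (_%:R); congr nat_of_bool.
  have E t : Dl t (Y ^~ w) = Dl t (V w) by rewrite /Dl /Y /V; ring.
  by apply/idP/idP; rewrite !inE => /cylinderP wl; apply/cylinderP => p /wl; rewrite E.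
transitivity (\int[Q]_w Psi (Y u w, V w)%R).
  apply: eq_integral => w _; rewrite /Psi /= cylV ge0_integralZl//.
  - by congr (_ * H _ _); rewrite /Y /V; ring.
  - exact: measurable_bridge_kernel.
  - by move=> z _; exact: bridge_kernel_ge0.
rewrite integrate_out_start; last 3 first.
- lra.
- apply: emeasurable_funM.
    apply/measurable_EFinP; apply: (measurableT_comp _ measurable_snd).
    exact: measurable_indic.
  apply: (measurableT_comp (measurable_bridge_weight sT')).
  by apply: measurable_shifted_coordinate; lra.
- by move=> x; rewrite mule_ge0 ?lee_fin// bridge_weight_ge0.
rewrite (levy_box_integral levyX densX (u := u)) -/v; last 6 first.
- by rewrite -map_comp; apply: measurable_bridge_weight; rewrite /= -/v; lra.
- by move=> x; rewrite -map_comp; apply: bridge_weight_ge0; rewrite /= -/v; lra.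
- exact: ltW.
- by rewrite -map_comp.
- by rewrite -map_comp /= -/v; lra.
- by move=> _ /mapP[q _ ->]; exact: measurable_itv.
apply: eq_integral => w _.
have -> : last 0%R (map fst (rays l)) = v by rewrite -map_comp.
transitivity ((\1_(cylinder Dl (rays l)) (V w))%:E * H v (V w (u + v)%R)); last first.
  congr (_%:E * _); rewrite !indicE; congr (_%:R); congr nat_of_bool.
  have E t : (Dl t (V w) = X (u + t) w - X u w)%R by rewrite /Dl /V; ring.
  by apply/idP/idP; rewrite !inE => /cylinderP wl; apply/cylinderP => p /wl;
    rewrite E.
rewrite -(@bridge_weight_chapman_kolmogorov v (u + v)%R (V w (u + v)%R)); [|lra..].
have uT : (0 < u <= T)%R by lra.
have mg : measurable_fun setT
    (fun x : R => f u (x - V w (u + v))%R * H (u + v)%R x).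
  apply: emeasurable_funM; first exact: measurable_density_shift.
  exact: measurable_bridge_weight.
have g0 (x : R) : 0 <= f u (x - V w (u + v))%R * H (u + v)%R x.
  by rewrite mule_ge0// ?bridge_weight_ge0//; exact: (density_ge0 densX).
rewrite addrK -ge0_integralZl//.
rewrite -[RHS](ge0_integral_shift (V w (u + v)%R)); last 2 first.
- by apply: emeasurable_funM => //; exact: measurable_cst.
- by move=> x; rewrite mule_ge0// lee_fin.
apply: eq_integral => x _; rewrite /Psi /= addrK -muleA; congr (_ * _).
by rewrite muleC.
Qed.

(** The same disappearance of [u] when the last time is [T]: the last
    increment is [z - d] with [d] the position at [u], and reflecting the
    Lebesgue integral exchanges the roles of [d] and of the increment. *)
Lemma bridge_weight_terminal u s y A : (0 < u)%R -> (u <= s)%R -> (s < T)%R ->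
  measurable A ->
  \int[leb]_d ((\int[nu]_z ((\1_A (z - d)%R)%:E * bridge_kernel s z (d + y)%R)) * f u d) =
  \int[leb]_(y' in A) (f (T - u - (s - u))%R (y' - y)%R * H (T - u)%R y').
Proof.
move=> u0 us sT mA; have uT : (0 < u <= T)%R by lra.
have sT' : (0 <= s < T)%R by lra.
have Tu : (0 <= T - u < T)%R by lra.
have Ts : (0 < T - s <= T)%R by lra.
have f0 t x : (0 < t <= T)%R -> 0 <= f t x by move=> ?; exact: (density_ge0 densX).
have mf t : (0 < t <= T)%R -> measurable_fun setT (f t).
  by move=> ?; exact: (density_measurable densX).
pose h (dz : R * R) := (\1_A (dz.2 - dz.1)%R)%:E * bridge_kernel s dz.2 (dz.1 + y)%R * f u dz.1.
have mh : measurable_fun setT h.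
  apply: emeasurable_funM; last exact: (measurableT_comp (mf _ uT)).
  apply: emeasurable_funM.
    apply/measurable_EFinP; apply: (measurableT_comp (measurable_indic mA)).
    exact: measurable_funB.
  by apply: measurable_bridge_kernel => //; exact: measurable_funD.
have h0 dz : 0 <= h dz.
  by rewrite mule_ge0 ?f0// mule_ge0 ?lee_fin// bridge_kernel_ge0.
transitivity (\int[leb]_d \int[nu]_z h (d, z)).
  apply: eq_integral => x _; rewrite -ge0_integralZr ?f0//.
    apply: emeasurable_funM; last exact: measurable_bridge_kernel.
    apply/measurable_EFinP; apply: (measurableT_comp (measurable_indic mA)).
    exact: measurable_funB.
  by move=> z _; rewrite mule_ge0 ?lee_fin// bridge_kernel_ge0.
rewrite fubini_lebesgue//.
pose k (yz : R * R) := (\1_A yz.1)%:E * (f (T - s)%R (yz.1 - y)%R *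
  bridge_kernel (T - u)%R yz.2 yz.1).
have mk : measurable_fun setT k.
  apply: emeasurable_funM.
    apply/measurable_EFinP; exact: (measurableT_comp (measurable_indic mA)).
  apply: emeasurable_funM; last exact: measurable_bridge_kernel.
  exact: (measurableT_comp (measurable_density_shift y Ts)).
have k0 yz : 0 <= k yz.
  by rewrite mule_ge0 ?lee_fin// mule_ge0 ?f0// bridge_kernel_ge0.
transitivity (\int[nu]_z \int[leb]_y' k (y', z)).
  apply: eq_integral => z _; rewrite -(ge0_integral_reflect z); last 2 first.
  - exact: (measurableT_comp mh (measurable_pair_cst z)).
  - by [].
  apply: eq_integral => y' _; rewrite /k /h /= /bridge_kernel.
  have -> : (z - (z - y') = y')%R by ring.
  have -> : (z - (z - y' + y) = y' - y)%R by ring.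
  have -> : (T - (T - u) = u)%R by ring.
  by rewrite -!muleA; congr (_ * (_ * _)); rewrite muleC.
rewrite -fubini_lebesgue// [RHS]integral_mkcond; apply: eq_integral => y' _.
rewrite epatch_indic /k /= [RHS]muleC /bridge_weight.
have -> : (T - u - (s - u) = T - s)%R by ring.
have mb : measurable_fun setT (fun z => bridge_kernel (T - u)%R z y').
  exact: measurable_bridge_kernel.
have b0 z : 0 <= bridge_kernel (T - u)%R z y' by exact: bridge_kernel_ge0.
rewrite ge0_integralZl//.
- by rewrite ge0_integralZl//; exact: f0.
- by apply: emeasurable_funM.
- by move=> z _; rewrite mule_ge0 ?f0.
Qed.

(** Here the last increment ends at [T] and is a function of the terminal
    value, which [bridge_joint_law] keeps as a separate variable. *)
Lemma bridge_increment_terminal u (l : seq (R * R)) x : (0 < u)%R ->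
  path <%R 0%R (rcons (map fst l) (T - u)%R) ->
  P (cylinder (fun v w => L (u + v) w - L u w)%R (rays (rcons l (T - u, x)%R))) =
  box_integral f H 0 0 (rays (rcons l (T - u, x)%R)).
Proof.
move=> u0; set v := last 0%R (map fst l).
rewrite rcons_path -/v => /andP[lpath vT].
have v0 : (0 <= v)%R.
  have := mem_last 0%R (map fst l); rewrite inE => /predU1P[/(_ =P _)/eqP|vl].
    by rewrite -/v => ->.
  by have /andP[/ltW] := path_lt_last lpath vl.
have le_v p : p \in l -> (0 < p.1 <= v)%R.
  by move=> pl; apply: path_lt_last => //; exact: map_f.
have sT : (0 < u + v < T)%R by lra.
have sT' : (0 <= u + v < T)%R by lra.
have uT : (0 < u <= T)%R by lra.
pose A := `]-oo, x]%classic : set R.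
have mA : measurable A by exact: measurable_itv.
have mY t : measurable_fun setT (Y t) by exact: measurable_funB.
pose Dl (t : R) (z : R -> R) := (z (u + t) - z u)%R.
have mDl (D : set R) : (forall p, p \in l -> D (u + p.1)%R) -> D u ->
    measurable (cylinder Dl (rays l) : set (path_space R D)).
  move=> Dp Du; apply: measurable_cylinder => _ /mapP[p pl ->] /=.
  split; last exact: measurable_itv.
  by apply: measurable_funB; apply: measurable_coordinate => //; exact: Dp.
have mDl1 : measurable (cylinder Dl (rays l) :
    set (path_space R [set t | (0 < t <= u + v)%R])).
  by apply: mDl => [p /le_v|] /=; lra.
have mDl2 : measurable (cylinder Dl (rays l) :
    set (path_space R [set t | (u <= t)%R])).
  by apply: mDl => [p /le_v|] /=; lra.
pose h (pz : path_space R [set t | (0 < t <= u + v)%R] * R) : \bar R :=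
  (\1_(cylinder Dl (rays l)) pz.1)%:E * (\1_A (pz.2 - pz.1 u)%R)%:E.
have mA' : measurable_fun setT (fun y : R => (\1_A y)%:E : \bar R).
  by apply/measurable_EFinP; exact: measurable_indic.
have mh : measurable_fun setT h.
  apply: emeasurable_funM.
    apply/measurable_EFinP; apply: (measurableT_comp _ measurable_fst).
    exact: measurable_indic.
  have mu : measurable_fun setT
      (fun p : path_space R [set t | (0 < t <= u + v)%R] => p u).
    by apply: measurable_coordinate; rewrite /=; lra.
  apply: (measurableT_comp mA'); apply: measurable_funB => //.
  exact: (measurableT_comp mu measurable_fst).
have h0 pz : 0 <= h pz by rewrite mule_ge0 ?lee_fin.
transitivity (\int[P]_w h (L ^~ w, L T w)).
  rewrite -[X in P X]setIT -integral_indic//; last first.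
    apply: measurable_cylinder => _ /mapP[p pl ->] /=.
    by split; [exact: measurable_funB|exact: measurable_itv].
  apply: eq_integral => w _.
  rewrite /rays map_rcons -cats1 cylinder_cat cylinder_cons [cylinder _ [::]]big_nil setIT.
  rewrite indicI /= EFinM -(cylinder_preimage Dl (fun w => L ^~ w)) /h /=.
  congr (_ * _%:E); rewrite !indicE; congr (_%:R); congr nat_of_bool.
  by rewrite (_ : (u + (T - u) = T)%R)//; ring.
rewrite bridge_joint_law//.
pose V w (t : R) := (X t w - X u w)%R.
pose Phi d y := \int[nu]_z ((\1_A (z - d)%R)%:E * bridge_kernel (u + v)%R z (d + y)%R).
pose Psi (xp : R * path_space R [set t | (u <= t)%R]) :=
  (\1_(cylinder Dl (rays l)) xp.2)%:E * Phi xp.1 (xp.2 (u + v)%R).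
have cylV w : \1_(cylinder Dl (rays l)) (Y ^~ w) = \1_(cylinder Dl (rays l)) (V w) :> R.
  rewrite !indicE; congr (_%:R); congr nat_of_bool.
  have E t : Dl t (Y ^~ w) = Dl t (V w) by rewrite /Dl /Y /V; ring.
  by apply/idP/idP; rewrite !inE => /cylinderP wl; apply/cylinderP => p /wl; rewrite E.
transitivity (\int[Q]_w Psi (Y u w, V w)%R).
  apply: eq_integral => w _; rewrite /Psi /h /= cylV.
  have YV : (Y u w + V w (u + v) = Y (u + v) w)%R by rewrite /Y /V; ring.
  rewrite /Phi YV -ge0_integralZl//; last 2 first.
  - apply: emeasurable_funM; last exact: measurable_bridge_kernel.
    by apply: (measurableT_comp mA'); exact: measurable_funB.
  - by move=> z _; rewrite mule_ge0 ?lee_fin// bridge_kernel_ge0.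
  by apply: eq_integral => z _; rewrite -muleA.
have mPhi : measurable_fun setT (fun dy : R * R => Phi dy.1 dy.2).
  apply: (@measurable_integral_snd _ _ _ _ _ _ _ nu id (fun dyz : (R * R) * R =>
    (\1_A (dyz.2 - dyz.1.1)%R)%:E * bridge_kernel (u + v)%R dyz.2 (dyz.1.1 + dyz.1.2)%R)) => //.
  - have m11 : measurable_fun setT (fun dyz : (R * R) * R => dyz.1.1).
      exact: (measurableT_comp measurable_fst measurable_fst).
    have m12 : measurable_fun setT (fun dyz : (R * R) * R => dyz.1.2).
      exact: (measurableT_comp measurable_snd measurable_fst).
    apply: emeasurable_funM; last first.
      by apply: measurable_bridge_kernel => //; exact: measurable_funD.
    by apply: (measurableT_comp mA'); exact: measurable_funB.
  - by move=> dyz; rewrite mule_ge0 ?lee_fin// bridge_kernel_ge0.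
have Phi0 a y : 0 <= Phi a y.
  by apply: integral_ge0 => z _; rewrite mule_ge0 ?lee_fin// bridge_kernel_ge0.
rewrite integrate_out_start//; last 2 first.
- apply: emeasurable_funM.
    apply/measurable_EFinP; apply: (measurableT_comp _ measurable_snd).
    exact: measurable_indic.
  have muv : measurable_fun setT
      (fun p : path_space R [set t | (u <= t)%R] => p (u + v)%R).
    by apply: measurable_coordinate; rewrite /=; lra.
  have mp : measurable_fun setT (fun xp : R * path_space R [set t | (u <= t)%R] =>
      (xp.1, xp.2 (u + v)%R)).
    exact: (measurable_fun_pair measurable_fst (measurableT_comp muv measurable_snd)).
  exact: (measurableT_comp mPhi mp).
- by move=> xp; rewrite mule_ge0 ?lee_fin.
have mapE : map fst (rays l) = map fst l by rewrite -map_comp.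
have Tuv : (0 < T - u - v <= T)%R by lra.
have Tu : (0 <= T - u < T)%R by lra.
rewrite /rays map_rcons box_integral_rcons -/(rays l).
pose G y := \int[leb]_(y' in A) (f (T - u - v)%R (y' - y)%R * H (T - u)%R y').
have mf : measurable_fun setT (f (T - u - v)%R) by exact: (density_measurable densX).
have f0 := density_ge0 densX Tuv.
have mG : measurable_fun setT G.
  rewrite (_ : G = fun y => \int[leb]_y' ((\1_A y')%:E *
      (f (T - u - v)%R (y' - y)%R * H (T - u)%R y'))); last first.
    apply/funext => y; rewrite /G integral_mkcond; apply: eq_integral => y' _.
    by rewrite epatch_indic muleC.
  apply: (@measurable_integral_lebesgue _ _ _ (fun yz : R * R => (\1_A yz.1)%:E *
      (f (T - u - v)%R (yz.1 - yz.2)%R * H (T - u)%R yz.1))).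
    apply: emeasurable_funM; first exact: (measurableT_comp mA').
    apply: emeasurable_funM.
      by apply: (measurableT_comp mf); exact: measurable_funB.
    exact: (measurableT_comp (measurable_bridge_weight Tu) measurable_fst).
  by move=> yz; rewrite mule_ge0 ?lee_fin// mule_ge0// bridge_weight_ge0.
have G0 y : 0 <= G y.
  apply: integral_ge0 => y' _; rewrite mule_ge0 ?bridge_weight_ge0//.
rewrite (levy_box_integral levyX densX (u := u)) ?mapE -/v//; last 3 first.
- exact: ltW.
- lra.
- by move=> _ /mapP[q _ ->]; exact: measurable_itv.
apply: eq_integral => w _.
transitivity ((\1_(cylinder Dl (rays l)) (V w))%:E * G (V w (u + v)%R)); last first.
  congr (_%:E * _); rewrite !indicE; congr (_%:R); congr nat_of_bool.
  have E t : (Dl t (V w) = X (u + t) w - X u w)%R by rewrite /Dl /V; ring.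
  by apply/idP/idP; rewrite !inE => /cylinderP wl; apply/cylinderP => p /wl;
    rewrite E.
have -> : G (V w (u + v)%R) = \int[leb]_d (Phi d (V w (u + v)%R) * f u d).
  rewrite /Phi bridge_weight_terminal//; [|lra..].
  by rewrite /G (_ : (u + v - u = v)%R)//; ring.
rewrite -ge0_integralZl//; last 2 first.
- apply: emeasurable_funM; last exact: (density_measurable densX).
  exact: (measurableT_comp mPhi (measurable_pair_cst (V w (u + v)%R))).
- by move=> y _; rewrite mule_ge0//; exact: (density_ge0 densX).
by apply: eq_integral => x' _; rewrite /Psi /= muleA.
Qed.

(** At the origin the kernel is [f_T z / f_T z]. *)
Lemma bridge_weight_start : H 0 0 = 1.
Proof.
rewrite /bridge_weight -[RHS](integral_probability_cst nu).
have T0' : ((0 : R) <= (0 : R) < T)%R by rewrite lexx T0.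
apply: ae_eq_integral => //.
  exact: measurable_bridge_kernel.
apply: filterS2 fT inv_density_ae => z /andP[fz0 fzoo] invE _.
by rewrite /bridge_kernel !subr0 invE divee ?gt_eqF// ge0_fin_numE ?(ltW fz0).
Qed.

(** The law of [L] at the time [0] is not part of the definition of a bridge,
    so the increments after [0] are reached as a limit of the increments after
    [eps > 0], whose law does not depend on [eps], by right-continuity of the
    paths. *)
Lemma bridge_increment_initial (l : seq (R * R)) :
  (0 < size l)%N -> path <%R 0%R (map fst l) -> (last 0%R (map fst l) < T)%R ->
  P (cylinder (fun v w => L (0 + v) w - L 0 w)%R (rays l)) =
  box_integral f H 0 0 (rays l).
Proof.
move=> l0 lpath; set v := last 0%R (map fst l) => vT.
have vin : v \in map fst l.
  by rewrite /v; case: (l) l0 => //= p l1 _; exact: mem_last.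
have le_v p : p \in l -> (0 < p.1 <= v)%R.
  by move=> pl; apply: path_lt_last => //; exact: map_f.
have v_gt0 : (0 < v)%R by have /andP[] := path_lt_last lpath vin.
(* small enough for the last time [eps n + v] to stay below [T] *)
pose eps n : R := ((T - v) / n.+2%:R)%R.
have eps_gt0 n : (0 < eps n)%R by rewrite divr_gt0 ?subr_gt0 ?ltr0n.
have eps_lt n : (eps n < T - v)%R.
  by rewrite ltr_pdivrMr ?ltr0n// ltr_pMr ?subr_gt0// ltr1n.
have eps0 : eps n @[n --> \oo] --> 0%R.
  rewrite -[X in _ --> X](mulr0 (T - v)%R); apply: cvgM; first exact: cvg_cst.
  by have := @cvg_harmonic R; rewrite -cvg_shiftS.
have Lcvg t w : (0 <= t <= v)%R -> L (eps n + t)%R w @[n --> \oo] --> L t w.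
  move=> tv; have tT : `[0%R, T]%classic t by rewrite /= in_itv/=; lra.
  have [Lt _] := cadlagL w tT.
  apply: (@cvg_comp _ _ _ (fun n => eps n + t)%R (L ^~ w) _ _ _ _ Lt).
  move=> A [e /= e0 eA].
  have [N _ NP] : \forall n \near \oo, (eps n < e)%R by apply: cvgr_lt eps0 _ _.
  exists N => // n /= Nn; apply: eA.
  - by rewrite /ball/= opprD addrCA subrr addr0 normrN gtr0_norm// NP.
  - by rewrite ltrDr.
  - by rewrite /= in_itv/=; have := eps_lt n; have := eps_gt0 n; lra.
pose p e := box_integral f H 0 0 (rays (shift_rays e l)).
have -> : box_integral f H 0 0 (rays l) = p 0%R.
  rewrite /p (_ : shift_rays 0 l = l)//.
  by rewrite /shift_rays -[RHS]map_id; apply: eq_map => -[? ?]; rewrite /= addr0.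
apply: (cylinder_limit (W := fun n t w => L (eps n + t) w - L (eps n) w)%R).
- by move=> n q _; exact: measurable_funB.
- by move=> q _; exact: measurable_funB.
- move=> q w ql; apply: cvgB; rewrite ?add0r; first by apply: Lcvg; have := le_v _ ql; lra.
  rewrite (_ : (fun _ => _) = (fun n => L (eps n + 0)%R w)).
    by apply: Lcvg; lra.
  by apply/funext => n; rewrite addr0.
- move=> e e0; rewrite (_ : (fun _ => _) = cst (p e)); first exact: cvg_cst.
  have mapE : map fst (shift_rays e l) = map fst l by rewrite -map_comp.
  apply/funext => n; rewrite /p/= bridge_increment_interior ?mapE ?size_map//.
  by rewrite -/v; have := eps_lt n; lra.
have vT' : (0 <= v < T)%R by lra.
have mY t : measurable_fun setT (Y t) by exact: measurable_funB.
have mN : measurable_fun setT (fun w => H v (Y v w)).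
  exact: (measurableT_comp (measurable_bridge_weight vT')).
have N0 w : 0 <= H v (Y v w) by exact: bridge_weight_ge0.
pose N : {measure set O -> \bar R} := weighted_measure Q mN N0.
have boxN (l' : seq (R * set R)) : path <%R 0%R (map fst l') -> last 0%R (map fst l') = v ->
    (forall q, q \in l' -> measurable q.2) ->
    box_integral f H 0 0 l' = N (cylinder Y l').
  move=> l'path l'v ml'.
  rewrite (levy_box_integral0 levyX densX) ?l'v//; last 3 first.
  - exact: measurable_bridge_weight.
  - by move=> x; exact: bridge_weight_ge0.
  - lra.
  rewrite /N /= /weighted_measure integral_mkcond; apply: eq_integral => w _.
  by rewrite epatch_indic muleC.
have pN e : p e = N (cylinder Y (rays (shift_rays e l))).
  apply: boxN; rewrite -?map_comp//.
  by move=> _ /mapP[q _ ->]; exact: measurable_itv.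
have NT : N setT < +oo.
  have -> : N setT = box_integral f H 0 0 [:: (v, setT)].
    rewrite boxN; [|by rewrite /= v_gt0|by []|].
      by rewrite cylinder_cons /cylinder big_nil preimage_setT setTI.
    move=> q; rewrite mem_seq1 => /eqP -> /=; exact: measurableT.
  rewrite /= (@bridge_weight_chapman_kolmogorov 0%R v 0%R)//.
  by rewrite bridge_weight_start ltry.
rewrite pN; under eq_fun do rewrite pN.
have mC e : measurable (cylinder Y (rays (shift_rays e l))).
  apply: measurable_cylinder => _ /mapP[q _ ->] /=.
  by split; [exact: mY|exact: measurable_itv].
have -> : cylinder Y (rays (shift_rays 0 l)) =
    \bigcap_n cylinder Y (rays (shift_rays n.+1%:R^-1 l)).
  apply/seteqP; split => w.
    move=> wl n _; move: wl; rewrite !cylinder_raysE => wl _ /mapP[q ql ->] /=.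
    by have := wl _ (map_f _ ql) => /= /le_trans; apply; rewrite lerD2l invr_ge0.
  move=> wl; rewrite cylinder_raysE => _ /mapP[q ql ->] /=; rewrite addr0.
  apply/ler_addgt0Pr => e e0.
  have [n _ ne] : \forall n \near \oo, (harmonic n < e)%R.
    by apply: cvgr_lt; [exact: cvg_harmonic|].
  have := wl n I; rewrite cylinder_raysE => /(_ _ (map_f _ ql)) /= /le_trans; apply.
  by rewrite lerD2l ltW// ne/=.
apply: nonincreasing_cvg_mu => //.
- by apply: le_lt_trans NT; apply: le_measure; rewrite ?inE//; exact: mC.
- by apply: bigcapT_measurable => n; exact: mC.
- move=> n m nm; apply/subsetPset => w; rewrite !cylinder_raysE => wl _ /mapP[q ql ->] /=.
  have := wl _ (map_f _ ql) => /= /le_trans; apply.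
  by rewrite lerD2l lef_pV2 ?posrE// ler_nat.
Qed.

(** If [u = 0], the increments stop before [T] because [m < T]; if [u > 0],
    they stop before [T] or at [T]. *)
Lemma bridge_increments u m (l : seq (R * R)) : (0 <= u)%R -> (u + m <= T)%R ->
  (m < T)%R -> (0 < size l)%N -> path <%R 0%R (map fst l) ->
  (last 0%R (map fst l) <= m)%R ->
  P (cylinder (fun v w => L (u + v) w - L u w)%R (rays l)) =
  box_integral f H 0 0 (rays l).
Proof.
move=> u0 umT mT l0 lpath lm.
have [u_gt0|u_le0] := ltP 0%R u; last first.
  have -> : u = 0%R by lra.
  by apply: bridge_increment_initial => //; lra.
have [lT|lT] := ltP (u + last 0%R (map fst l))%R T.
  exact: bridge_increment_interior.
have lE : last 0%R (map fst l) = (T - u)%R by lra.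
case/lastP: l l0 lpath lm lT lE => // l [v x] _; rewrite map_rcons last_rcons /=.
move=> lpath _ _ vE; rewrite vE in lpath *.
exact: bridge_increment_terminal.
Qed.

End bridge_law.

(** * Doob transforms are Markov *)

Section positive_times.
Context (R : realType) d (Omega : measurableType d) (P : probability Omega R)
  (xi : R -> {RV P >-> R}).
Hypothesis xi0 : {ae P, forall w, xi 0%R w = 0%R}.

Lemma integral_indic_ae_eq (E E' : set Omega) (k : Omega -> \bar R) :
  measurable E -> measurable E' -> measurable_fun setT k -> (forall w, 0 <= k w) ->
  {ae P, forall w, E w <-> E' w} ->
  \int[P]_(w in E) k w = \int[P]_(w in E') k w.
Proof.
move=> mE mE' mk k0 EE'; rewrite integral_mkcond [RHS]integral_mkcond.
apply: ge0_ae_eq_integral => //.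
- by apply/(measurable_restrictT _ mE); exact: measurable_funTS.
- by apply/(measurable_restrictT _ mE'); exact: measurable_funTS.
- by move=> w _; exact: erestrict_ge0.
- by move=> w _; exact: erestrict_ge0.
apply: filterS EE' => w [EE' E'E] _; rewrite !patchE.
by congr (if _ then _ else _); apply/idP/idP; rewrite !inE.
Qed.

(** At the time [0] the process is almost surely [0], so a bound there either
    holds almost surely or fails almost surely; laws are only prescribed at
    positive times. *)
Lemma positive_times_unique (D : set R) (k1 k2 : Omega -> \bar R) :
  (forall t, D t -> (0 <= t)%R) ->
  measurable_fun setT k1 -> (forall w, 0 <= k1 w) ->
  measurable_fun setT k2 -> (forall w, 0 <= k2 w) ->
  \int[P]_w k1 w < +oo ->
  (forall l, (forall p, p \in l -> D p.1 /\ (0 < p.1)%R) ->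
    \int[P]_(w in cylinder (fun t w => xi t w) (rays l)) k1 w =
    \int[P]_(w in cylinder (fun t w => xi t w) (rays l)) k2 w) ->
  forall C, sigma_of (fun t => xi t : Omega -> R) D C ->
    \int[P]_(w in C) k1 w = \int[P]_(w in C) k2 w.
Proof.
move=> D0 mk1 k10 mk2 k20 k1oo k12 C sC.
pose m1 : {measure set Omega -> \bar R} := weighted_measure P mk1 k10.
pose m2 : {measure set Omega -> \bar R} := weighted_measure P mk2 k20.
apply: (sigma_of_unique (m1 := m1) (m2 := m2) _ _ _ sC) => //.
move=> l lD.
change (\int[P]_(w in cylinder (fun t w => xi t w) (rays l)) k1 w =
  \int[P]_(w in cylinder (fun t w => xi t w) (rays l)) k2 w).
have mcyl l' : measurable (cylinder (fun t w => xi t w) (rays l')).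
  apply: measurable_cylinder => _ /mapP[q _ ->] /=.
  by split; [exact: measurable_funP|exact: measurable_itv].
(* either every bound at the time 0 is nonnegative, and can be dropped, or the cylinder is null *)
have [l0|/allPn[p pl]] := boolP (all (fun p : R * R => (p.1 == 0%R) ==> (0 <= p.2)%R) l).
  pose l' := [seq p <- l | (0 < p.1)%R].
  have ll' : {ae P, forall w, cylinder (fun t w => xi t w) (rays l) w <->
                       cylinder (fun t w => xi t w) (rays l') w}.
    apply: filterS xi0 => w w0; rewrite !cylinder_raysE; split => wl p.
      by rewrite mem_filter => /andP[_ /wl].
    move=> pl; have [p0|p0] := ltP 0%R p.1.
      by apply: wl; rewrite mem_filter p0.
    have pE : p.1 = 0%R by apply/le_anti; rewrite p0 D0//; exact: lD.
    by have /allP/(_ _ pl) := l0; rewrite pE eqxx /= w0.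
  rewrite !(integral_indic_ae_eq (mcyl l) (mcyl l') _ _ ll')//; apply: k12 => p.
  by rewrite mem_filter => /andP[p0 /lD].
rewrite negb_imply -ltNge => /andP[/eqP p0 p2].
have l0 : {ae P, forall w, cylinder (fun t w => xi t w) (rays l) w <-> set0 w}.
  apply: filterS xi0 => w w0; split => //; rewrite cylinder_raysE => /(_ p pl).
  by rewrite p0 w0 leNgt p2.
by rewrite !(integral_indic_ae_eq (mcyl l) measurable0 _ _ l0)// !integral_set0.
Qed.

End positive_times.

Section markov_from_boxes.
Context (R : realType) d (Omega : measurableType d) (P : probability Omega R)
  (xi : R -> {RV P >-> R}).
Context d' (O : measurableType d') (Q : probability O R) (Y : R -> {RV Q >-> R}).
Variables k H : R -> R -> \bar R.
Hypothesis mk : forall t, (0 < t <= 1)%R -> measurable_fun setT (k t).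
Hypothesis k0 : forall t x, (0 < t <= 1)%R -> 0 <= k t x.
Hypothesis mH : forall t, (0 <= t <= 1)%R -> measurable_fun setT (H t).
Hypothesis H0 : forall t x, (0 <= t <= 1)%R -> 0 <= H t x.
Hypothesis chapman_kolmogorov : forall s t x, (0 <= s)%R -> (s < t)%R -> (t <= 1)%R ->
  \int[lebesgue_measure]_y (k (t - s)%R (y - x)%R * H t y) = H s x.
Hypothesis xi0 : {ae P, forall w, xi 0%R w = 0%R}.
Hypothesis law_xi : forall l : seq (R * R), (0 < size l)%N ->
  path <%R 0%R (map fst l) -> (last 0%R (map fst l) <= 1)%R ->
  P (cylinder (fun t w => xi t w) (rays l)) = box_integral k H 0 0 (rays l).
Hypothesis law_Y : forall g l, let v := last 0%R (map fst l) in
  measurable_fun setT (g v) -> (forall x, 0 <= g v x) ->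
  path <%R 0%R (map fst l) -> (v <= 1)%R ->
  (forall p, p \in l -> measurable p.2) ->
  box_integral k g 0 0 l =
  \int[Q]_w ((\1_(cylinder (fun t w => Y t w) l) w)%:E * g v (Y v w)).

Let times s : set R := [set t | (0 < t <= s)%R].

(** The process [xi] on [[0, s]] has the density [H s (Y s)] with respect to
    [Y]. Cylinders that contain the time [s] are enough, and a list of times
    can be sorted. *)
Lemma path_integral_weighted s (h : path_space R (times s) -> \bar R) :
  (0 < s <= 1)%R -> measurable_fun setT h -> (forall v, 0 <= h v) ->
  \int[P]_w h (fun t => xi t w) = \int[Q]_w (h (fun t => Y t w) * H s (Y s w)).
Proof.
move=> s01 mh h0.
have s01' : (0 <= s <= 1)%R by lra.
have mN : measurable_fun setT (fun w => H s (Y s w)).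
  exact: (measurableT_comp (mH s01')).
have N0 w : 0 <= H s (Y s w) by exact: H0.
pose N : {measure set O -> \bar R} := weighted_measure Q mN N0.
have mxi : measurable_fun setT ((fun w => (fun t => xi t w)) : Omega -> path_space R (times s)).
  by apply: (measurable_path (V := fun t w => xi t w)) => t _.
have mY : measurable_fun setT ((fun w => (fun t => Y t w)) : O -> path_space R (times s)).
  by apply: (measurable_path (V := fun t w => Y t w)) => t _.
transitivity (\int[N]_w h (fun t => Y t w)); last first.
  apply: integral_of_density => //; first exact: (measurableT_comp mh mY).
rewrite -(ge0_integral_image P mxi)// -(ge0_integral_image N mY)//.
apply: eq_measure_integral => A mA _.
apply: (path_law_unique_at (j0 := s) (V1 := fun t w => xi t w) (V2 := fun t w => Y t w)) => //.
- by rewrite /times/=; lra.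
- move=> l x lD.
  have sl_gt0 p : p \in (s, x) :: l -> (0 < p.1)%R.
    by rewrite inE => /predU1P[->|/lD /andP[]//] /=; lra.
  have [l' [l'path l'l l'E]] := sort_rays sl_gt0.
  have l's : last 0%R (map fst l') = s.
    apply: last_sorted_max => //; first by rewrite l'l /= mem_head.
    move=> t; rewrite l'l /= inE => /predU1P[->//|/mapP[p pl ->]].
    by have /andP[] := lD _ pl.
  rewrite -!l'E; transitivity (box_integral k H 0 0 (rays l')).
    apply: law_xi; rewrite ?l's//; last lra.
    by case: (l') l's => //= /eqP; rewrite lt_eqF//; lra.
  have mapE : map fst (rays l') = map fst l' by rewrite -map_comp.
  rewrite law_Y ?mapE ?l's//; last 4 first.
  + exact: mH.
  + by move=> y; exact: H0.
  + lra.
  + by move=> _ /mapP[q _ ->]; exact: measurable_itv.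
  rewrite /N /= /weighted_measure integral_mkcond; apply: eq_integral => w _.
  by rewrite epatch_indic muleC.
- exact: (probability_lty P measurableT).
Qed.

Lemma law_xi_sets l : let v := last 0%R (map fst l) in
  (0 < v <= 1)%R -> path <%R 0%R (map fst l) ->
  (forall p, p \in l -> measurable p.2) ->
  P (cylinder (fun t w => xi t w) l) = box_integral k H 0 0 l.
Proof.
move=> v v01 lpath ml; rewrite law_Y -/v//; last 3 first.
- by apply: mH; lra.
- by move=> x; apply: H0; lra.
- lra.
pose Z t (p : path_space R (times v)) : R := p t.
have mZ : measurable (cylinder Z l : set (path_space R (times v))).
  apply: measurable_cylinder => p pl; split; last exact: ml.
  apply: measurable_coordinate; rewrite /times/=.
  by have := path_lt_last lpath (map_f fst pl).
have := @path_integral_weighted v (fun p => (\1_(cylinder Z l) p)%:E) v01.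
rewrite -[X in P X]setIT -integral_indic//; last first.
  apply: measurable_cylinder => p pl; split; [exact: measurable_funP|exact: ml].
have indE U (W : R -> U -> R) w :
    \1_(cylinder (fun t w => W t w) l) w = \1_(cylinder Z l) (fun t => W t w) :> R.
  rewrite !indicE; congr (_%:R); congr nat_of_bool.
  by apply/idP/idP; rewrite !inE => /cylinderP wl; apply/cylinderP => p /wl.
under eq_integral do rewrite indE.
move=> ->//.
- by apply: eq_integral => w _; rewrite (indE _ (fun t w => Y t w)).
- by apply/measurable_EFinP; exact: measurable_indic.
Qed.

(** A time [s] that is not in the list is added with the trivial condition
    [setT]. *)
Lemma sort_rays_at s (l : seq (R * R)) : (0 < s)%R ->
  (forall p, p \in l -> (0 < p.1 <= s)%R) ->
  exists l' : seq (R * set R), [/\ path <%R 0%R (map fst l'), last 0%R (map fst l') = s,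
    forall p, p \in l' -> measurable p.2 &
    forall U (V : R -> U -> R), cylinder V l' = cylinder V (rays l)].
Proof.
move=> s_gt0 ls.
have l_gt0 p : p \in l -> (0 < p.1)%R by move=> /ls /andP[].
have [l1 [l1path l1l l1E]] := sort_rays l_gt0.
have l1s t1 : t1 \in map fst l1 -> (t1 <= s)%R.
  by rewrite l1l => /mapP[p /ls/andP[_ ps] ->].
have mapE : map fst (rays l1) = map fst l1 by rewrite -map_comp.
have ml1 p : p \in rays l1 -> measurable p.2.
  by move=> /mapP[q _ ->]; exact: measurable_itv.
have [sl1|sl1] := boolP (s \in map fst l1).
  exists (rays l1); split; rewrite ?mapE//; exact: (last_sorted_max l1path).
(* adding the time [s] without a constraint *)
exists (rcons (rays l1) (s, setT)); split.
- rewrite map_rcons mapE rcons_path l1path /=.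
  have := mem_last 0%R (map fst l1); rewrite inE => /predU1P[->//|ll].
  rewrite lt_neqAle l1s// andbT; apply: contra sl1 => /eqP <-; exact: ll.
- by rewrite map_rcons last_rcons.
- by move=> p; rewrite mem_rcons inE => /predU1P[->/=|/ml1].
- by move=> U V; rewrite -cats1 cylinder_cat cylinder_cons [cylinder _ [::]]big_nil
    preimage_setT !setIT l1E.
Qed.

Section transition.
Variables (s t : R) (B : set R).
Hypotheses (s_gt0 : (0 < s)%R) (st : (s < t)%R) (t1 : (t <= 1)%R) (mB : measurable B).

Let G x := \int[lebesgue_measure]_(y in B) (k (t - s)%R (y - x)%R * H t y).

(** The conditional probability of [B] at the time [t] for the Doob transform
    with weights [H]. Taking real parts gives [0] where the weight vanishes or
    is infinite, and keeps the quotient in [[0, 1]] everywhere. *)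
Definition transition x : R := (fine (G x) / fine (H s x))%R.

Let st01 : (0 < t - s <= 1)%R. Proof. by move: s_gt0 st t1; lra. Qed.
Let t01 : (0 <= t <= 1)%R. Proof. by move: s_gt0 st t1; lra. Qed.
Let s01 : (0 <= s <= 1)%R. Proof. by move: s_gt0 st t1; lra. Qed.

Let GE x : G x = \int[lebesgue_measure]_y
  ((\1_B y)%:E * (k (t - s)%R (y - x)%R * H t y)).
Proof.
rewrite /G integral_mkcond; apply: eq_integral => y _.
by rewrite epatch_indic muleC.
Qed.

Let mkH (x : R) : measurable_fun setT (fun y : R => k (t - s)%R (y - x)%R * H t y).
Proof.
apply: emeasurable_funM; last exact: mH.
by apply: (measurableT_comp (mk st01)); exact: measurable_funB.
Qed.

Let mB1 : measurable_fun setT (fun y : R => (\1_B y)%:E : \bar R).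
Proof. by apply/measurable_EFinP; exact: measurable_indic. Qed.

Let kH0 (x y : R) : 0 <= k (t - s)%R (y - x)%R * H t y.
Proof. by rewrite mule_ge0 ?H0 ?k0. Qed.

Let mG : measurable_fun setT G.
Proof.
rewrite (_ : G = fun x => \int[lebesgue_measure]_y
  ((\1_B y)%:E * (k (t - s)%R (y - x)%R * H t y))); last exact/funext.
apply: (@measurable_integral_lebesgue _ _ _ (fun yz : R * R => (\1_B yz.1)%:E *
      (k (t - s)%R (yz.1 - yz.2)%R * H t yz.1))); last first.
  by move=> yz; rewrite mule_ge0 ?lee_fin.
apply: emeasurable_funM; first exact: (measurableT_comp mB1).
apply: emeasurable_funM.
  by apply: (measurableT_comp (mk st01)); exact: measurable_funB.
exact: (measurableT_comp (mH t01) measurable_fst).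
Qed.

Let G0 x : 0 <= G x. Proof. exact: integral_ge0. Qed.

Let GH x : G x <= H s x.
Proof.
rewrite -(@chapman_kolmogorov s t x) ?(ltW s_gt0)//.
by apply: ge0_subset_integral => //; exact: mkH.
Qed.

Lemma transition_ge0 x : (0 <= transition x)%R.
Proof. by rewrite divr_ge0 ?fine_ge0 ?H0. Qed.

Lemma transition_le1 x : (transition x <= 1)%R.
Proof.
have fH0 : (0 <= fine (H s x))%R by rewrite fine_ge0 ?H0.
have [fH|fH] := ltP 0%R (fine (H s x)); last first.
  by rewrite /transition (_ : fine (H s x) = 0%R) ?invr0 ?mulr0//; lra.
rewrite ler_pdivrMr// mul1r fine_le ?GH//.
- rewrite ge0_fin_numE//; apply: le_lt_trans (GH x) _.
  by case: (H s x) fH => [r||]//=; rewrite ?ltry ?ltxx.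
- by case: (H s x) fH => [r||]//=; rewrite ltxx.
Qed.

(** Where the weight is [0], so is the numerator, because [G <= H s]. *)
Lemma transitionE x : H s x < +oo -> (transition x)%:E * H s x = G x.
Proof.
move=> Hoo; have Hfin : H s x \is a fin_num by rewrite ge0_fin_numE ?H0.
have Gfin : G x \is a fin_num by rewrite ge0_fin_numE// (le_lt_trans (GH x)).
have [fH|fH] := eqVneq (fine (H s x)) 0%R.
  have Hx0 : H s x = 0 by rewrite -(fineK Hfin) fH.
  have := GH x; rewrite Hx0 mule0 => Gx; apply/esym/le_anti.
  by rewrite Gx G0.
by rewrite -[in LHS](fineK Hfin) -EFinM divfK// fineK.
Qed.

Lemma measurable_transition : measurable_fun setT transition.
Proof.
apply: measurable_funM.
  exact: (measurableT_comp (fine_measurable measurableT) mG).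
rewrite (_ : (fun _ => _) = (fun x => fine (H s x) `^ (-1))%R); last first.
  by apply/funext => x; rewrite powR_inv1// fine_ge0// H0.
apply: (measurableT_comp (measurable_powR _)).
exact: (measurableT_comp (fine_measurable measurableT) (mH s01)).
Qed.

(** The expectation of the weight is the total mass of the law of [xi]. *)
Lemma weight_finite : {ae Q, forall w, H s (Y s w) < +oo}.
Proof.
have mHY : measurable_fun setT (fun w => H s (Y s w)).
  exact: (measurableT_comp (mH s01)).
have iH : Q.-integrable setT (fun w => H s (Y s w)).
  apply/integrableP; split => //.
  under eq_integral do rewrite gee0_abs ?H0//.
  have s01' : (0 < s <= 1)%R by rewrite s_gt0; case/andP : s01.
  rewrite (_ : \int[Q]_w _ = \int[Q]_w (cst 1 (fun r => Y r w) * H s (Y s w))).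
    rewrite -(path_integral_weighted (h := cst 1))// ?lee01//.
    by rewrite [ltLHS](integral_probability_cst P) ltry.
  by apply: eq_integral => w _; rewrite /= mul1e.
have := integrable_ae measurableT iH.
by apply: filterS => w /(_ I); rewrite ge0_fin_numE ?H0.
Qed.

(** The denominator of [transition] cancels against the density [H s (Y s)],
    and the numerator is one more step of the nested integral, with the set
    [B] at the time [t]. *)
Lemma transition_cylinder (l : seq (R * R)) :
  (forall p, p \in l -> (0 < p.1 <= s)%R) ->
  \int[P]_(w in cylinder (fun r w => xi r w) (rays l)) (transition (xi s w))%:E =
  \int[P]_(w in cylinder (fun r w => xi r w) (rays l)) (\1_B (xi t w))%:E.
Proof.
move=> ls; have [l' [l'path l's ml' l'E]] := sort_rays_at s_gt0 ls.
have s01' : (0 < s <= 1)%R by rewrite s_gt0; case/andP : s01.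
rewrite -!l'E.
have mcyl : measurable (cylinder (fun r w => xi r w) l').
  by apply: measurable_cylinder => p pl; split; [exact: measurable_funP|exact: ml'].
pose Z r (p : path_space R (times s)) : R := p r.
have mZ : measurable (cylinder Z l' : set (path_space R (times s))).
  apply: measurable_cylinder => p pl; split; last exact: ml'.
  apply: measurable_coordinate; rewrite /times/= -l's.
  exact: path_lt_last l'path (map_f fst pl).
have indE U (W : R -> U -> R) w :
    \1_(cylinder (fun t w => W t w) l') w = \1_(cylinder Z l') (fun t => W t w) :> R.
  rewrite !indicE; congr (_%:R); congr nat_of_bool.
  by apply/idP/idP; rewrite !inE => /cylinderP wl; apply/cylinderP => p /wl.
have mp : measurable_fun setT (fun p : path_space R (times s) => (transition (p s))%:E).
  apply/measurable_EFinP; apply: (measurableT_comp measurable_transition).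
  by apply: measurable_coordinate; rewrite /times/= s_gt0/=.
transitivity (\int[Q]_w ((\1_(cylinder (fun r w => Y r w) l') w)%:E * G (Y s w))).
  transitivity (\int[P]_w ((\1_(cylinder Z l') (fun r => xi r w))%:E *
      (transition (xi s w))%:E)).
    rewrite integral_mkcond; apply: eq_integral => w _.
    by rewrite epatch_indic muleC; congr (_%:E * _); exact: indE.
  rewrite (path_integral_weighted (h := fun p =>
     (\1_(cylinder Z l') p)%:E * (transition (p s))%:E))//; last 2 first.
  - apply: emeasurable_funM => //; apply/measurable_EFinP; exact: measurable_indic.
  - by move=> v; rewrite mule_ge0 ?lee_fin// transition_ge0.
  have mYl : measurable (cylinder (fun r w => Y r w) l').
    by apply: measurable_cylinder => p pl; split; [exact: measurable_funP|exact: ml'].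
  have mYi : measurable_fun setT (fun w => (\1_(cylinder (fun r w => Y r w) l') w)%:E : \bar R).
    by apply/measurable_EFinP; exact: measurable_indic.
  transitivity (\int[Q]_w ((\1_(cylinder (fun r w => Y r w) l') w)%:E *
     (transition (Y s w))%:E * H s (Y s w))).
    by apply: eq_integral => w _; congr (_%:E * _ * _); exact/esym/indE.
  apply: ge0_ae_eq_integral => //.
  - apply: emeasurable_funM; last exact: (measurableT_comp (mH s01)).
    apply: emeasurable_funM => //; apply/measurable_EFinP.
    exact: (measurableT_comp measurable_transition).
  - by apply: emeasurable_funM => //; exact: (measurableT_comp mG).
  - by move=> w _; rewrite !mule_ge0 ?lee_fin// ?transition_ge0 ?H0.
  - by move=> w _; rewrite mule_ge0 ?lee_fin.
  - by apply: filterS weight_finite => w Hw _; rewrite -muleA transitionE.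
have l'tpath : path <%R 0%R (map fst (rcons l' (t, B))).
  by rewrite map_rcons rcons_path l'path l's.
have := @law_Y (fun s x => \int[lebesgue_measure]_(y in B)
  (k (t - s)%R (y - x)%R * H t y)) l'.
rewrite /= l's => <-//; last by case/andP : s01.
rewrite -box_integral_rcons -law_xi_sets//; last 2 first.
- by rewrite map_rcons last_rcons /=; move: s_gt0 st t1; lra.
- by move=> p; rewrite mem_rcons inE => /predU1P[->/=|/ml'].
rewrite -cats1 cylinder_cat cylinder_cons [cylinder _ [::]]big_nil setIT.
have mtB : measurable (xi t @^-1` B).
  by rewrite -[X in measurable X]setTI; exact: measurable_funP.
rewrite -[X in P X]setIT -integral_indic//; last exact: measurableI.
rewrite [RHS]integral_mkcond; apply: eq_integral => w _.
by rewrite epatch_indic indicI EFinM muleC.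
Qed.

End transition.

(** One version of the conditional probability, a function of [xi s], serves
    for the whole past and for [xi s] alone, because it is measurable for the
    smaller sigma-algebra and has the right integrals over the larger one. At
    [s = 0] the past is almost surely trivial and a constant serves. *)
Theorem weak_markov_of_boxes (s t : R) (B : set R) :
  (0 <= s)%R -> (s < t)%R -> (t <= 1)%R -> measurable B ->
  cond_prob_eq P (sigma_of (fun u => xi u : Omega -> R) [set u | (0 <= u <= s)%R])
    (sigma_of (fun u => xi u : Omega -> R) [set s]) (xi t @^-1` B).
Proof.
move=> s0 st t1 mB.
have mtB : measurable (xi t @^-1` B).
  by rewrite -[X in measurable X]setTI; exact: measurable_funP.
have [q mq [q0 q1 qcyl]] : exists2 q : R -> R, measurable_fun setT q &
    [/\ forall x, (0 <= q x)%R, forall x, (q x <= 1)%R &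
    forall l, (forall p, p \in l -> (0 <= p.1 <= s)%R /\ (0 < p.1)%R) ->
    \int[P]_(w in cylinder (fun r w => xi r w) (rays l)) (q (xi s w))%:E =
    \int[P]_(w in cylinder (fun r w => xi r w) (rays l)) (\1_B (xi t w))%:E].
  have [s_gt0|s_le0] := ltP 0%R s.
    exists (transition s t B); first exact: measurable_transition.
    split; [exact: transition_ge0|exact: transition_le1|] => l ls.
    by apply: transition_cylinder => // p /ls[/andP[_ ->] ->].
  exists (cst (fine (P (xi t @^-1` B)))) => //.
  split => [x|x|[|p l] ls].
  - by rewrite fine_ge0.
  - by rewrite -[leRHS]/(fine 1) fine_le ?fin_num_measure// probability_le1.
  - rewrite [cylinder _ _]big_nil.
    transitivity (\int[P]_w P (xi t @^-1` B)).
      by apply: eq_integral => w _; rewrite /= fineK ?fin_num_measure.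
    by rewrite [LHS](integral_probability_cst P) -[X in P X]setIT -integral_indic.
  - have [/andP[_ ps] p0] := ls _ (mem_head _ _).
    by have := lt_le_trans p0 (le_trans ps s_le0); rewrite ltxx.
have mqs : measurable_fun setT (fun w => (q (xi s w))%:E).
  apply/measurable_EFinP; exact: (measurableT_comp mq).
have sq C : sigma_of (fun u => xi u : Omega -> R) [set u | (0 <= u <= s)%R] C ->
    \int[P]_(w in C) (q (xi s w))%:E = P (xi t @^-1` B `&` C).
  move=> sC; have mC : measurable C by apply: sigma_of_measurable sC => u _.
  rewrite -integral_indic//.
  apply: (positive_times_unique xi0 _ _ _ _ _ _ _ sC) => //.
  - by move=> u /andP[].
  - by move=> w; rewrite lee_fin.
  - apply/measurable_EFinP; exact: measurable_indic.
  - apply: (@le_lt_trans _ _ (\int[P]_w 1)).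
      by apply: ge0_le_integral => // w _; rewrite lee_fin.
    by rewrite (integral_probability_cst P) ltry.
have sub : sigma_of (fun u => xi u : Omega -> R) [set s] `<=`
    sigma_of (fun u => xi u : Omega -> R) [set u | (0 <= u <= s)%R].
  apply: sigma_of_sub; first exact: smallest_sigma_algebra.
  move=> _ x ->; apply: sigma_of_preimage => //; by rewrite /= s0 lexx.
have iq : P.-integrable setT (EFin \o (fun w => q (xi s w))).
  apply: (@le_integrable _ _ _ P setT measurableT _ (cst 1)) => //.
    by move=> w _; rewrite /= normr1 lee_fin ger0_norm.
  exact: finite_measure_integrable_cst.
have pre A : measurable A -> sigma_of (fun u => xi u : Omega -> R) [set s]
    ((fun w => q (xi s w)) @^-1` A).
  move=> mA; rewrite (_ : _ @^-1` _ = xi s @^-1` (q @^-1` A))//.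
  apply: sigma_of_preimage => //.
  by rewrite -[X in measurable X]setTI; exact: mq.
exists (fun w => q (xi s w)), (fun w => q (xi s w)); split.
- by split => // A /pre /sub.
- by split => // C /sub /sq.
- exact: aeW.
Qed.

End markov_from_boxes.

Section scaling.
Context (R : realType) (c : R).
Hypothesis c0 : (0 < c)%R.

Definition scale_times (U : Type) (l : seq (R * U)) := [seq ((c * p.1)%R, p.2) | p <- l].

Lemma box_integral_scale (f g : R -> R -> \bar R) t0 y0 l :
  box_integral (fun t => f (c * t)%R) (fun t => g (c * t)%R) t0 y0 l =
  box_integral f g (c * t0)%R y0 (scale_times l).
Proof.
elim: l t0 y0 => [//|[t A] l IH] t0 y0 /=.
by apply: eq_integral => y _; rewrite IH mulrBr.
Qed.

Lemma rays_scale (l : seq (R * R)) : rays (scale_times l) = scale_times (rays l).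
Proof. by rewrite /rays /scale_times -!map_comp. Qed.

Lemma last_scale U (l : seq (R * U)) :
  last 0%R (map fst (scale_times l)) = (c * last 0 (map fst l))%R.
Proof.
rewrite /scale_times -map_comp -[in LHS](mulr0 c).
by rewrite -(last_map (fun t => c * t)%R) -map_comp.
Qed.

Lemma path_scale U (l : seq (R * U)) :
  path <%R 0%R (map fst l) -> path <%R 0%R (map fst (scale_times l)).
Proof.
rewrite /scale_times -map_comp -[in X in _ -> X](mulr0 c).
rewrite (_ : map _ _ = [seq (c * t)%R | t <- map fst l]); last by rewrite -map_comp.
elim: l 0%R => [//|p l IH] t0 /= /andP[t0p pl].
by rewrite ltr_pM2l// t0p IH.
Qed.

Lemma cylinder_scale (Omega : Type) (V : R -> Omega -> R) l :
  cylinder V (scale_times l) = cylinder (fun t => V (c * t)%R) l.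
Proof. by rewrite /cylinder big_map. Qed.

End scaling.

(** The coordinate [i] is, in law, [t |-> L (c t + u) - L u] with [c = m i].
    There are at least two coordinates of positive activity, so [c < T], as
    [H] requires. *)
Lemma liouville_weak_markov (R : realType) (n : nat) (m : 'I_n -> R)
    (nu : probability R R) (d : measure_display) (Omega : measurableType d)
    (P : probability Omega R) (xi : 'I_n -> R -> {RV P >-> R}) :
  generalised_liouville m nu xi -> weak_markov_consistent xi `[0%R, 1%R].
Proof.
move=> [n2 m0 _ _ [d1 [U1 [P1 [L [bridgeL lawxi]]]]]] i B s t mB s01 t01 st.
have [T0 [cadlagL [lawLT [d2 [U2 [Q [X [f [levyX densX CK fT bL]]]]]]]]] := bridgeL.
set T := (\sum_i m i)%R in T0 cadlagL lawLT densX CK fT bL.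
set u := partial_activity m i; set c := m i.
have c0 : (0 < c)%R := m0 i.
have u0 : (0 <= u)%R by apply: sumr_ge0 => j _; exact: ltW.
have ucT : (u + c <= T)%R.
  rewrite /T [leRHS](bigID (fun j : 'I_n => (j < i)%N))/= lerD2l.
  rewrite (bigD1 i) ?ltnn//= lerDl; apply: sumr_ge0 => j _; exact: ltW.
have cT : (c < T)%R.
  rewrite /T (bigD1 i)//= ltrDl.
  have [j ji] : exists j : 'I_n, j != i.
    case: (eqVneq (val i) 0%N) => [i0|i0].
      by exists (Ordinal n2); rewrite -val_eqE /= i0.
    by exists (Ordinal (ltnW n2)); rewrite -val_eqE /= eq_sym.
  rewrite (bigD1 j)//= ltr_pwDl//; apply: sumr_ge0 => k _; exact: ltW.
have mapc r : (0 <= r <= 1)%R -> (0 <= c * r < T)%R.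
  move=> /andP[r0 r1]; rewrite mulr_ge0 ?(ltW c0)//=.
  by apply: le_lt_trans cT; rewrite ler_piMr// ltW.
have mapc' r : (0 < r <= 1)%R -> (0 < c * r <= T)%R.
  move=> /andP[r0 r1]; rewrite mulr_gt0//=.
  by have /andP[_ /ltW] : (0 <= c * r < T)%R by rewrite mapc// (ltW r0).
pose Y (r : R) : {RV Q >-> R} := (X (c * r) \- X 0)%R.
have cylxi l : (forall p, p \in l -> (0 <= p.1 <= 1)%R /\ measurable p.2) ->
    P (cylinder (fun r w => xi i r w) l) =
    P1 (cylinder (fun r w => L (r * c + u) w - L u w)%R l).
  move=> lD; pose C : set ('I_n -> R -> R) := cylinder (fun r x => x i r) l.
  have := lawxi C; rewrite /C.
  rewrite (_ : [set w | _] = cylinder (fun r w => xi i r w) l); last first.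
    by apply/seteqP; split => w /= /cylinderP wl; apply/cylinderP => p /wl.
  rewrite (_ : [set w | _] = cylinder (fun r w => L (r * c + u) w - L u w)%R l); last first.
    by apply/seteqP; split => w /= /cylinderP wl; apply/cylinderP => p /wl.
  apply.
  pose l2 := [seq ((i, p.1), p.2) | p <- l].
  rewrite (_ : cylinder _ _ = cylinder (fun (p : 'I_n * R) (x : 'I_n -> R -> R) => x p.1 p.2) l2).
    apply: sigma_of_cylinder => _ /mapP[p /lD[p01 mp] ->]; split => //=; rewrite ?in_itv.
  by rewrite /cylinder big_map.
apply: (@weak_markov_of_boxes R _ Omega P (xi i) _ U2 Q Y
  (fun r => f (c * r)%R) (fun r => bridge_weight T f nu (c * r)%R)) => //.
- by move=> r /mapc' /densX[].
- by move=> r x /mapc' /densX[].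
- by move=> r /mapc cr; exact: (measurable_bridge_weight nu T0 densX).
- by move=> r x /mapc cr; exact: (bridge_weight_ge0 nu T0 densX).
- move=> r r' x r0 rr' r'1.
  rewrite mulrBr.
  apply: (bridge_weight_chapman_kolmogorov nu T0 densX CK).
  + by rewrite mulr_ge0// ltW.
  + by rewrite ltr_pM2l.
  + have /mapc/andP[] // : (0 <= r' <= 1)%R by rewrite r'1 (le_trans r0)// ltW.
(* the equality in law gives that [xi i 0] is almost surely 0 *)
- have := cylxi [:: (0%R, [set~ 0%R])].
  rewrite !cylinder_cons ![cylinder _ [::]]big_nil !setIT.
  rewrite (_ : (fun w : U1 => _) @^-1` _ = set0); last first.
    by apply/seteqP; split => w //=; rewrite mul0r add0r subrr.
  rewrite measure0 => E.
  exists (xi i 0%R @^-1` [set~ 0%R]); split.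
  + by rewrite -[X in measurable X]setTI; apply: measurable_funP => //; exact: measurableC.
  + apply: E => p; rewrite inE => /eqP -> /=; rewrite lexx ler01; split => //.
    exact: measurableC.
  + by move=> w /=.
- move=> l l0 lpath l1.
  rewrite cylxi; last first.
    move=> _ /mapP[p pl ->] /=; split; last exact: measurable_itv.
    have /andP[p0 pl1] := path_lt_last lpath (map_f fst pl).
    by rewrite (ltW p0) (le_trans pl1).
  rewrite (box_integral_scale c) mulr0 -rays_scale.
  rewrite -(bridge_increments T0 levyX densX CK fT cadlagL lawLT bL (u := u) (m := c))//.
  + rewrite rays_scale cylinder_scale; congr (P1 _); apply: cylinder_ext => p _.
    by apply/funext => w; rewrite mulrC (addrC u).
  + by rewrite size_map.
  + exact: path_scale.
  + by rewrite last_scale ler_piMr// ltW.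
- move=> g l v mg g0 lpath v1 ml.
  have gE : g = fun r => g ((c * r) / c)%R.
    by apply/funext => r; rewrite mulrC mulKf// gt_eqF.
  rewrite [in LHS]gE (box_integral_scale c f (fun r => g (r / c)%R)) mulr0.
  rewrite (levy_box_integral0 levyX densX) ?last_scale -/v ?(mulrC c v) ?mulfK ?gt_eqF//.
  + apply: eq_integral => w _; rewrite (mulrC v c); congr (_%:E * _).
    by rewrite cylinder_scale.
  + exact: path_scale.
  + have [->|v0] := eqVneq v 0%R; first by rewrite mul0r ltW.
    have := mapc' v; rewrite v1 andbT mulrC => /(_ _)/andP[]//.
    have := mem_last 0%R (map fst l); rewrite -/v inE (negbTE v0)/= => vl.
    by have /andP[] := path_lt_last lpath vl.
  + by move=> _ /mapP[p pl ->] /=; exact: ml.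
- by move: s01; rewrite /= in_itv/= => /andP[].
- by move: t01; rewrite /= in_itv/= => /andP[].
Qed.

(** * Two independent uniform variables from the digits of one *)

Section measures_on_the_line.
Context (R : realType).

Lemma eq_measure_rays (m1 m2 : {measure set R -> \bar R}) :
  (forall x, m1 `]-oo, x]%classic = m2 `]-oo, x]%classic) -> m1 setT < +oo ->
  forall A, measurable A -> m1 A = m2 A.
Proof.
move=> m12 m1oo A mA.
have cylE x l : exists y : R, cylinder (fun (_ : unit) (z : R) => z) (rays ((tt, x) :: l)) =
    `]-oo, y]%classic.
  elim: l x => [x|[[] x'] l IH x].
    by exists x; rewrite /= cylinder_cons [cylinder _ [::]]big_nil setIT.
  have [y yE] := IH (Num.min x x'); exists y; rewrite -yE /= !cylinder_cons setIA.
  congr (_ `&` _); apply/seteqP; split => z /=; rewrite !in_itv/= le_min => /andP //.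
apply: (@path_law_unique_at R unit setT tt _ _ _ _ m1 m2
  (fun (_ : unit) (z : R) => z) (fun (_ : unit) (z : R) => z) I _ _ _ m1oo
  (fun v => A (v tt))) => //.
  by move=> l x _; have [y ->] := cylE x l.
rewrite -[X in measurable X]setTI; exact: measurable_coordinate.
Qed.

(** Half-lines are replaced by Borel sets one coordinate at a time, and at
    each step both sides are finite measures in that coordinate. *)
Lemma product_of_rays d (Omega : measurableType d) (P : probability Omega R) (k : nat)
    (Z : nat -> Omega -> R) (mu : nat -> probability R R) :
  (forall j, measurable_fun setT (Z j)) ->
  (forall x : nat -> R,
    P (\bigcap_(j in [set j | (j < k)%N]) [set w | (Z j w <= x j)%R]) =
    \prod_(j < k) mu j `]-oo, x j]%classic) ->
  forall B : nat -> set R, (forall j, measurable (B j)) ->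
    P (\bigcap_(j in [set j | (j < k)%N]) Z j @^-1` B j) = \prod_(j < k) mu j (B j).
Proof.
move=> mZ rayE.
have mZB j C : measurable C -> measurable (Z j @^-1` C).
  by move=> mC; rewrite -[X in measurable X]setTI; exact: mZ.
suff claim i (B : nat -> set R) (x : nat -> R) : (i <= k)%N -> (forall j, measurable (B j)) ->
    (forall j, (i <= j)%N -> B j = `]-oo, x j]%classic) ->
    P (\bigcap_(j in [set j | (j < k)%N]) Z j @^-1` B j) = \prod_(j < k) mu j (B j).
  move=> B mB.
  rewrite (_ : \bigcap_(j in _) _ = \bigcap_(j in [set j | (j < k)%N]) Z j @^-1`
    (if (j < k)%N then B j else `]-oo, 0%R]%classic)); last first.
    by apply: eq_bigcapr => j /= ->.
  rewrite (claim k _ (fun=> 0%R))//.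
  - by apply: eq_bigr => j _; rewrite ltn_ord.
  - by move=> j; case: ifP.
  - by move=> j kj; rewrite ltnNge kj.
elim: i B x => [|i IH] B x ik mB Bx.
  rewrite (eq_bigr (fun j : 'I_k => mu j `]-oo, x j]%classic)); last first.
    by move=> j _; rewrite Bx.
  rewrite -rayE; congr (P _); apply: eq_bigcapr => j _.
  by rewrite Bx//; apply/seteqP; split => w /=; rewrite in_itv.
(* the constraints on all the coordinates but [i] *)
pose E := \bigcap_(j in [set j | (j < k)%N]) Z j @^-1` (if j == i then setT else B j).
have mE : measurable E.
  by apply: bigcap_measurableType => j _; apply: mZB; case: ifP.
pose c := \prod_(j < k | j != Ordinal ik) mu j (B j).
have c0 : 0 <= c by apply: prode_ge0.
have cfin : c \is a fin_num.
  by apply: prode_fin_num => j _; exact: fin_num_measure.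
pose q : {nonneg R} := NngNum (fine_ge0 c0).
pose m1 := image_measure (mrestr P mE) (mZ i).
pose m2 : {measure set R -> \bar R} := mscale q (mu i).
have m1E A : m1 A = P (\bigcap_(j in [set j | (j < k)%N]) Z j @^-1` (if j == i then A else B j)).
  rewrite [LHS](_ : _ = P (Z i @^-1` A `&` E))//; congr (P _).
  apply/seteqP; split => [w [wA wE] j jk|w wA].
    by have := wE j jk => /=; case: eqP => [->|].
  split; first by have := wA i ik; rewrite /= eqxx.
  by move=> j jk; have := wA j jk => /=; case: eqP.
have m2E A : m2 A = \prod_(j < k) mu j (if val j == i then A else B j).
  rewrite (bigD1 (Ordinal ik))//= eqxx muleC.
  rewrite [LHS](_ : _ = (fine c)%:E * mu i A)// fineK//; congr (_ * _).
  by apply: eq_bigr => j; rewrite -val_eqE/= => /negbTE ->.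
have -> : \bigcap_(j in [set j | (j < k)%N]) Z j @^-1` B j =
    \bigcap_(j in [set j | (j < k)%N]) Z j @^-1` (if j == i then B i else B j).
  by apply: eq_bigcapr => j _; case: eqP => [->|].
rewrite -m1E (eq_measure_rays (m1 := m1) (m2 := m2))//.
- by rewrite m2E; apply: eq_bigr => j _; case: eqP => [->|].
- move=> y; rewrite m1E m2E.
  apply: (IH _ (fun j => if j == i then y else x j)); first exact: ltnW.
    by move=> j; case: ifP => // _; exact: measurable_itv.
  move=> j; case: ifP => // /negbT ji ij; apply: Bx.
  by rewrite ltn_neqAle eq_sym ji.
- rewrite m1E; apply: probability_lty; apply: bigcap_measurableType => j _.
  by apply: mZB; case: ifP.
Qed.

End measures_on_the_line.

Lemma eq_of_halving_bound (R : realType) (a b : R) :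
  (forall n, `|a - b| <= 2^-1 ^+ n)%R -> a = b.
Proof.
move=> ab; apply/eqP; rewrite -subr_eq0 -normr_le0.
have c0 : ((2^-1 : R) ^+ n)%R @[n --> \oo] --> (0 : R)%R.
  by apply: cvg_expr; rewrite ger0_norm ?invr_ge0// invf_lt1// ltr1n.
rewrite -(cvg_lim _ c0)//; apply: limr_ge; first exact: cvgP c0.
exact: nearW.
Qed.

Section binary_digits.
Context (R : realType).

Definition clip (x : R) : R := Num.max 0%R (Num.min 1%R x).

Lemma clip_le0 x : (x <= 0)%R -> clip x = 0%R.
Proof. by move=> x0; rewrite /clip max_l// ge_min x0 orbT. Qed.

Lemma clip_ge1 x : (1 <= x)%R -> clip x = 1%R.
Proof. by move=> x1; rewrite /clip min_l// max_r. Qed.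

Lemma clip_id x : (0 <= x <= 1)%R -> clip x = x.
Proof. by move=> /andP[x0 x1]; rewrite /clip min_r// max_r. Qed.

(** The normalised restriction of Lebesgue measure to the unit interval. *)
Lemma uniform_exists : exists U : probability R R, forall x, U `]-oo, x]%classic = (clip x)%:E.
Proof.
have m01 := @ltr01 R.
pose f : measurableTypeR R -> R := id.
have mf : measurable_fun setT f by move=> _ A mA; rewrite setTI.
pose X : {RV (uniform_prob m01) >-> R} := HB.pack f (isMeasurableFun.Build _ _ _ _ f mf).
exists (distribution (uniform_prob m01) X) => x.
change (uniform_prob m01 (`]-oo, x]%classic : set (measurableTypeR R)) = (clip x)%:E).
rewrite /uniform_prob integral_uniform_pdf//.
rewrite (_ : _ `&` _ = if (x < 0)%R then set0 else `[0%R, Num.min 1%R x]%classic); last first.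
  apply/seteqP; split => z /=; rewrite ?in_itv/=; case: ifPn; rewrite /= ?in_itv/= ?le_min.
  - by move=> x0 [zx /andP[]]; lra.
  - by move=> _ [-> /andP[-> ->]].
  - by [].
  - by move=> _ /and3P[-> -> ->].
case: ifPn => [x0|]; first by rewrite integral_set0 /clip; congr EFin; rewrite
  /Num.max /Num.min; do 2?case: ifPn; lra.
rewrite -leNgt => x0; rewrite (eq_integral (cst 1)); last first.
  move=> z; rewrite inE /= in_itv/= le_min => /and3P[z0 z1 _].
  by rewrite /uniform_pdf z0 z1 /= subr0 invr1.
rewrite integral_cst//=.
rewrite mul1e lebesgue_measure_itv/= lte_fin /clip.
case: ifPn => [x1|].
  rewrite -EFinB; congr EFin; move: x1.
  by rewrite /Num.max /Num.min; do 3?case: ifPn; lra.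
by move=> x1; congr EFin; move: x1; rewrite /Num.max /Num.min; do 3?case: ifPn; lra.
Qed.

Variable U : probability R R.
Hypothesis UE : forall x, U `]-oo, x]%classic = (clip x)%:E.

Definition first_bit (u : R) : R := ((1 / 2 < u)%R)%:R.
Definition drop_bit (u : R) : R := (2 * u - first_bit u)%R.

Lemma measurable_first_bit : measurable_fun setT first_bit.
Proof.
rewrite (_ : first_bit = \1_(`](1/2)%R, +oo[%classic)); first exact: measurable_indic.
apply/funext => u; rewrite /first_bit indicE; congr (_%:R); congr nat_of_bool.
by apply/idP/idP; rewrite inE /= in_itv/= andbT.
Qed.

Lemma measurable_drop_bit : measurable_fun setT drop_bit.
Proof.
apply: measurable_funB; last exact: measurable_first_bit.
exact: measurable_funM.
Qed.

Lemma first_bit0 u : (u <= 1/2)%R -> first_bit u = 0%R.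
Proof. by rewrite /first_bit ltNge => ->. Qed.

Lemma first_bit1 u : (1/2 < u)%R -> first_bit u = 1%R.
Proof. by rewrite /first_bit => ->. Qed.

Lemma drop_bit_law0 A : measurable A ->
  U (`]-oo, (1/2)%R]%classic `&` drop_bit @^-1` A) = (1/2)%R%:E * U A.
Proof.
move=> mA.
pose q : {nonneg R} := NngNum (divr_ge0 (@ler01 R) (ler0n R 2)).
have mh : measurable (`]-oo, (1/2)%R]%classic : set R) by exact: measurable_itv.
rewrite setIC.
apply: (@eq_measure_rays _ (image_measure (mrestr U mh) measurable_drop_bit) (mscale q U)) => //.
- move=> x; change (U (drop_bit @^-1` `]-oo, x]%classic `&` `]-oo, (1/2)%R]%classic) =
    (1 / 2)%R%:E * U `]-oo, x]%classic).
  rewrite (_ : _ `&` _ = `]-oo, Num.min (1/2)%R (x/2)%R]%classic); last first.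
    apply/seteqP; split => u /=; rewrite !in_itv/= le_min /drop_bit.
      by move=> [+ u2]; rewrite u2 first_bit0//=; lra.
    by move=> /andP[u2 ux]; rewrite first_bit0//; split => //; lra.
  rewrite !UE -EFinM; congr EFin.
  have [x0|x0] := leP x 0%R; first by rewrite !clip_le0 ?mulr0 ?ge_min//; lra.
  have [x1|x1] := leP 1%R x.
    by rewrite min_l; [rewrite clip_id ?clip_ge1; lra|lra].
  by rewrite min_r; [rewrite !clip_id; lra|lra].
- by apply: probability_lty; rewrite preimage_setT setTI.
Qed.

Lemma drop_bit_law1 A : measurable A ->
  U (`](1/2)%R, +oo[%classic `&` drop_bit @^-1` A) = (1/2)%R%:E * U A.
Proof.
move=> mA.
pose q : {nonneg R} := NngNum (divr_ge0 (@ler01 R) (ler0n R 2)).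
have mh : measurable (`](1/2)%R, +oo[%classic : set R) by exact: measurable_itv.
rewrite setIC.
apply: (@eq_measure_rays _ (image_measure (mrestr U mh) measurable_drop_bit) (mscale q U)) => //.
- move=> x; change (U (drop_bit @^-1` `]-oo, x]%classic `&` `](1/2)%R, +oo[%classic) =
    (1 / 2)%R%:E * U `]-oo, x]%classic).
  rewrite (_ : _ `&` _ = `]-oo, ((x + 1)/2)%R]%classic `\` `]-oo, (1/2)%R]%classic); last first.
    apply/seteqP; split => u /=; rewrite !in_itv/= andbT /drop_bit.
      by move=> [+ u2]; rewrite first_bit1//= => ux; split; [lra|apply/negP; rewrite -ltNge].
    by move=> [ux /negP]; rewrite -ltNge => u2; rewrite first_bit1//; split => //; lra.
  rewrite measureD//; last exact: probability_lty.
  rewrite (_ : _ `&` _ = `]-oo, Num.min ((x + 1)/2)%R (1/2)%R]%classic).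
    transitivity ((clip ((x + 1) / 2))%:E - (clip (Num.min ((x + 1) / 2) (1 / 2)))%:E).
      by rewrite -!UE.
    rewrite UE -EFinM -EFinB; congr EFin.
    have [x0|x0] := leP x 0%R.
      rewrite (@clip_le0 x)// min_l; last lra.
      by rewrite subrr mulr0.
    rewrite min_r; last lra.
    rewrite (@clip_id (1/2)%R); last lra.
    have [x1|x1] := leP 1%R x; first by rewrite !clip_ge1; lra.
    by rewrite !clip_id; lra.
  by apply/seteqP; split => u /=; rewrite !in_itv/= le_min => /andP.
- by apply: probability_lty; rewrite preimage_setT setTI.
Qed.

(** The partial binary expansions made of the digits of rank 0, 2, 4, and so
    on. *)
Fixpoint even_sum (n : nat) (u : R) : R :=
  if n is n'.+1 then ((first_bit u + even_sum n' (drop_bit (drop_bit u))) / 2)%R else 0%R.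

Lemma even_sum_itv n u : (0 <= even_sum n u <= 1)%R.
Proof.
elim: n u => [|n IH] u /=; first by rewrite lexx ler01.
have := IH (drop_bit (drop_bit u)); rewrite /first_bit; case: ltP => _ /=; lra.
Qed.

Lemma even_sum_nd u : nondecreasing_seq (even_sum ^~ u).
Proof.
apply/nondecreasing_seqP => n; elim: n u => [|n IH] u.
  by have /andP[] := even_sum_itv 1 u.
by rewrite [leLHS]/= [leRHS]/= ler_pM2r ?invr_gt0// lerD2l; exact: IH.
Qed.

Definition even_bits (u : R) : R := limn (even_sum ^~ u).
Definition odd_bits (u : R) : R := even_bits (drop_bit u).

Lemma even_sum_cvg (u : R) : even_sum n u @[n --> \oo] --> even_bits u.
Proof.
apply: nondecreasing_is_cvgn; first exact: even_sum_nd.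
by exists 1%R => _ [n _ <-]; have /andP[] := even_sum_itv n u.
Qed.

Lemma even_bits_itv u : (0 <= even_bits u <= 1)%R.
Proof.
have cu := @even_sum_cvg u; apply/andP; split.
  by apply: limr_ge; [exact: cvgP cu|apply: nearW => n; have /andP[] := even_sum_itv n u].
by apply: limr_le; [exact: cvgP cu|apply: nearW => n; have /andP[] := even_sum_itv n u].
Qed.

(** Dropping a digit exchanges the digits of even and of odd rank. *)
Lemma even_bitsE u : even_bits u = ((first_bit u + odd_bits (drop_bit u)) / 2)%R.
Proof.
suff : even_sum n u @[n --> \oo] --> ((first_bit u + odd_bits (drop_bit u)) / 2)%R.
  by move=> /cvg_lim <-.
rewrite -(cvg_shiftS (even_sum ^~ u)) /=.
apply: cvgM; last exact: cvg_cst.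
by apply: cvgD; [exact: cvg_cst|exact: even_sum_cvg].
Qed.

Lemma measurable_even_bits : measurable_fun setT even_bits.
Proof.
apply: (@measurable_fun_cvg _ _ _ setT even_sum) => [n|u _]; last exact: even_sum_cvg.
elim: n => [|n IH] /=; first exact: measurable_cst.
apply: measurable_funM => //; apply: measurable_funD; first exact: measurable_first_bit.
apply: (measurableT_comp IH); apply: (measurableT_comp measurable_drop_bit).
exact: measurable_drop_bit.
Qed.

Lemma measurable_odd_bits : measurable_fun setT odd_bits.
Proof. exact: (measurableT_comp measurable_even_bits measurable_drop_bit). Qed.

Lemma split_first_bit A : measurable A ->
  U A = U (`]-oo, (1/2)%R]%classic `&` A) + U (`](1/2)%R, +oo[%classic `&` A).
Proof.
move=> mA; rewrite -measureU//; last 3 first.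
- by apply: measurableI => //; exact: measurable_itv.
- by apply: measurableI => //; exact: measurable_itv.
- by apply/seteqP; split => // u [[/=]]; rewrite !in_itv/= andbT => u1 _ [u2 _]; lra.
rewrite -setIUl (_ : _ `|` _ = setT) ?setTI//.
apply/seteqP; split => // u _ /=; rewrite !in_itv/= andbT.
by case: (leP u (1/2)%R); [left|right].
Qed.

(** Condition on the first digit: what remains is again uniform, and its
    digits of odd and even rank play the exchanged roles. *)
Lemma bits_law_recursion (x : R) A : measurable A ->
  U (even_bits @^-1` `]-oo, x]%classic `&` odd_bits @^-1` A) =
  (1/2)%R%:E * U (odd_bits @^-1` `]-oo, (2 * x)%R]%classic `&` even_bits @^-1` A) +
  (1/2)%R%:E * U (odd_bits @^-1` `]-oo, (2 * x - 1)%R]%classic `&` even_bits @^-1` A).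
Proof.
move=> mA.
have me B : measurable B -> measurable (even_bits @^-1` B).
  by move=> mB; rewrite -[X in measurable X]setTI; exact: measurable_even_bits.
have mo B : measurable B -> measurable (odd_bits @^-1` B).
  by move=> mB; rewrite -[X in measurable X]setTI; exact: measurable_odd_bits.
rewrite split_first_bit; last by apply: measurableI; [exact: me|exact: mo].
rewrite -drop_bit_law0; last by apply: measurableI; [exact: mo|exact: me].
rewrite -drop_bit_law1; last by apply: measurableI; [exact: mo|exact: me].
congr (U _ + U _).
- have E u : (u <= 1/2)%R -> (even_bits u <= x)%R = (odd_bits (drop_bit u) <= 2 * x)%R.
    by move=> u2; rewrite even_bitsE first_bit0//; apply/idP/idP; lra.
  apply/seteqP; split => u /=; rewrite !in_itv/= => -[u2 [ex oA]]; split => //; split => //.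
    by rewrite -E.
  by rewrite E.
- have E u : (1/2 < u)%R -> (even_bits u <= x)%R = (odd_bits (drop_bit u) <= 2 * x - 1)%R.
    by move=> u2; rewrite even_bitsE first_bit1//; apply/idP/idP; lra.
  apply/seteqP; split => u /=; rewrite !in_itv/= andbT => -[u2 [ex oA]]; split => //; split => //.
    by rewrite -E.
  by rewrite E.
Qed.

Let mE B : measurable B -> measurable (even_bits @^-1` B).
Proof. by move=> mB; rewrite -[X in measurable X]setTI; exact: measurable_even_bits. Qed.

Let mO B : measurable B -> measurable (odd_bits @^-1` B).
Proof. by move=> mB; rewrite -[X in measurable X]setTI; exact: measurable_odd_bits. Qed.

Lemma drop_bit_law A : measurable A -> U (drop_bit @^-1` A) = U A.
Proof.
move=> mA; rewrite split_first_bit; last first.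
  by rewrite -[X in measurable X]setTI; exact: measurable_drop_bit.
rewrite drop_bit_law0// drop_bit_law1//.
rewrite -(@fineK _ (U A)) ?fin_num_measure// -!EFinM -EFinD; congr EFin; lra.
Qed.

Let m x := fine (U (even_bits @^-1` `]-oo, x]%classic)).
Let F x y := fine (U (even_bits @^-1` `]-oo, x]%classic `&` odd_bits @^-1` `]-oo, y]%classic)).

Let ray (x : R) : measurable (`]-oo, x]%classic : set R). Proof. exact: measurable_itv. Qed.

Let mE_law x : U (even_bits @^-1` `]-oo, x]%classic) = (m x)%:E.
Proof. by rewrite fineK// fin_num_measure//; apply: mE. Qed.

Let F_law x y :
  U (even_bits @^-1` `]-oo, x]%classic `&` odd_bits @^-1` `]-oo, y]%classic) = (F x y)%:E.
Proof. by rewrite fineK// fin_num_measure//; apply: measurableI; [exact: mE|exact: mO]. Qed.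

Let odd_law x : U (odd_bits @^-1` `]-oo, x]%classic) = (m x)%:E.
Proof. by rewrite -mE_law; exact: (drop_bit_law (mE (ray x))). Qed.

Let m_rec x : m x = ((m (2 * x) + m (2 * x - 1)) / 2)%R.
Proof.
have := bits_law_recursion x measurableT.
rewrite !preimage_setT !setIT mE_law !odd_law -!EFinM -EFinD => -[->]; lra.
Qed.

Let F_rec x y : F x y = ((F y (2 * x) + F y (2 * x - 1)) / 2)%R.
Proof.
have := bits_law_recursion x (ray y).
rewrite !(setIC (odd_bits @^-1` _)) !F_law -!EFinM -EFinD => -[->]; lra.
Qed.

Let m_lt0 x : (x < 0)%R -> m x = 0%R.
Proof.
move=> x0; rewrite /m (_ : _ @^-1` _ = set0) ?measure0//.
apply/seteqP; split => // u /=; rewrite in_itv/=.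
by have := even_bits_itv u; lra.
Qed.

Let m_ge1 x : (1 <= x)%R -> m x = 1%R.
Proof.
move=> x1; rewrite /m (_ : _ @^-1` _ = setT) ?[U setT]probability_setT//.
apply/seteqP; split => // u _ /=; rewrite in_itv/=.
by have := even_bits_itv u; lra.
Qed.

Let F_lt0 x y : (y < 0)%R -> F x y = 0%R.
Proof.
move=> y0; rewrite /F (_ : _ `&` _ = set0) ?measure0//.
apply/seteqP; split => // u [_] /=; rewrite in_itv/=.
by have := even_bits_itv (drop_bit u); rewrite -/(odd_bits u); lra.
Qed.

Let F_ge1 x y : (1 <= y)%R -> F x y = m x.
Proof.
move=> y1; rewrite /F /m (_ : _ `&` _ = even_bits @^-1` `]-oo, x])//.
apply/seteqP; split => [u []//|u ux]; split => //=; rewrite in_itv/=.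
by have := even_bits_itv (drop_bit u); rewrite -/(odd_bits u); lra.
Qed.

(** The distribution function satisfies the same halving equation as the one
    of a uniform variable, and that equation halves the distance between two
    bounded solutions. *)
Lemma even_bits_cdf x : m x = clip x.
Proof.
have m01 y : (0 <= m y <= 1)%R.
  rewrite fine_ge0//= -[leRHS]/(fine 1) fine_le ?fin_num_measure//; try exact: mE.
  by apply: probability_le1; exact: mE.
have step n y : (`|m y - clip y| <= 2^-1 ^+ n)%R.
  elim: n y => [|n IH] y.
    have [y0|y0] := leP y 0%R; first by rewrite clip_le0 ?subr0 ?ger0_norm; have := m01 y; lra.
    have [y1|y1] := leP 1%R y; first by rewrite m_ge1 ?clip_ge1// subrr normr0.
    by rewrite clip_id; [rewrite ler_norml; have := m01 y; lra|lra].
  have [y0|y0] := ltP y 0%R.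
    by rewrite m_lt0// clip_le0 ?subrr ?normr0 ?exprn_ge0// ltW.
  have [y1|y1] := leP 1%R y; first by rewrite m_ge1 ?clip_ge1// subrr normr0 exprn_ge0.
  (* one of the two terms of the recursion is 0 or 1, the other is at [2 y] or [2 y - 1] *)
  rewrite m_rec exprS; have [y2|y2] := ltP (2 * y)%R 1%R.
    rewrite (m_lt0 (x := (2 * y - 1)%R)); last lra.
    have := IH (2 * y)%R; rewrite !clip_id; [|lra..].
    rewrite !ler_norml; lra.
  rewrite (m_ge1 y2); have := IH (2 * y - 1)%R; rewrite !clip_id; [|lra..].
  rewrite !ler_norml; lra.
exact: eq_of_halving_bound.
Qed.

(** As for one variable: the joint distribution function and the product
    satisfy the same equation, which halves distances. *)
Lemma even_odd_bits_cdf x y : F x y = (clip x * clip y)%R.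
Proof.
have clip01 z : (0 <= clip z <= 1)%R.
  by rewrite /clip le_max lexx/= ge_max ler01 ge_min lexx.
have F01 a b : (0 <= F a b <= 1)%R.
  rewrite fine_ge0//= -[leRHS]/(fine 1) fine_le ?fin_num_measure//.
  - by apply: measurableI; [exact: mE|exact: mO].
  - by apply: probability_le1; apply: measurableI; [exact: mE|exact: mO].
have step n a b : (`|F a b - clip a * clip b| <= 2^-1 ^+ n)%R.
  elim: n a b => [|n IH] a b.
    have := F01 a b; have : (0 <= clip a * clip b <= 1)%R.
      have /andP[a0 a1] := clip01 a; have /andP[b0 b1] := clip01 b.
      by rewrite mulr_ge0//= mulr_ile1.
    by rewrite ler_norml expr0; lra.
  rewrite F_rec exprS; have [a2|a2] := ltP (2 * a)%R 1%R.
    rewrite (@F_lt0 _ (2 * a - 1)%R); last lra.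
    have ca : clip (2 * a) = (2 * clip a)%R.
      have [a0|a0] := leP a 0%R; first by rewrite !clip_le0 ?mulr0//; lra.
      by rewrite !clip_id; lra.
    have := IH b (2 * a)%R; rewrite ca !ler_norml; lra.
  rewrite (@F_ge1 b (2 * a)%R)// even_bits_cdf.
  have ca : clip (2 * a - 1) = (2 * clip a - 1)%R.
    have [a1|a1] := leP 1%R a; first by rewrite !clip_ge1; lra.
    by rewrite !clip_id; lra.
  have := IH b (2 * a - 1)%R; rewrite ca !ler_norml; lra.
exact: eq_of_halving_bound.
Qed.

Lemma even_odd_bits_independent A B : measurable A -> measurable B ->
  U (even_bits @^-1` A `&` odd_bits @^-1` B) = U A * U B.
Proof.
move=> mA mB.
pose Z j := if j is 0%N then even_bits else odd_bits.
pose C j := if j is 0%N then A else B.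
have bigE (S : nat -> set R) : \bigcap_(j in [set j | (j < 2)%N]) Z j @^-1` S j =
    even_bits @^-1` S 0%N `&` odd_bits @^-1` S 1%N.
  apply/seteqP; split => [u uS|u [u0 u1] [|[]]//].
  by split; [exact: (uS 0%N)|exact: (uS 1%N)].
have := @product_of_rays _ _ _ U 2 Z (fun=> U) _ _ C.
rewrite bigE => -> //.
- by rewrite !big_ord_recl big_ord0 mule1.
- by case=> [|j]; [exact: measurable_even_bits|exact: measurable_odd_bits].
- move=> x; rewrite !big_ord_recl big_ord0 mule1 !UE -EFinM -even_odd_bits_cdf -F_law.
  congr (U _); rewrite -(bigE (fun j => `]-oo, x j]%classic)); apply: eq_bigcapr => j _.
  by apply/seteqP; split => u /=; rewrite in_itv.
- by case.
Qed.

End binary_digits.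

(** * Sampling from a kernel by its quantile function *)

Section quantile.
Context (R : realType) (U : probability R R).
Hypothesis UE : forall x, U `]-oo, x]%classic = (clip x)%:E.

Lemma measurable_of_rays d (T : measurableType d) (X : T -> R) :
  (forall x, measurable [set t | (X t <= x)%R]) -> measurable_fun setT X.
Proof.
move=> mX _ B mB; rewrite setTI.
apply: (@sigma_of_sub R unit T (fun _ => X) setT measurable) => //.
- exact: sigma_algebra_measurable.
- move=> _ x _; rewrite (_ : _ @^-1` _ = [set t | (X t <= x)%R])//.
- exact: (@sigma_of_preimage R unit T (fun _ => X) setT tt).
Qed.

Lemma uniform_inside : U `]0%R, 1%R[%classic = 1.
Proof.
have cU : U `]-oo, (1 - n.+1%:R^-1)%R]%classic @[n --> \oo] --> U `]-oo, 1%R[%classic.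
  rewrite [X in _ --> U X](_ : _ = \bigcup_n `]-oo, (1 - n.+1%:R^-1)%R]%classic).
    apply: nondecreasing_cvg_mu => //.
    - by apply: bigcupT_measurable => n; exact: measurable_itv.
    - move=> n m nm; apply/subsetPset => x /=; rewrite !in_itv/= => /le_trans; apply.
      by rewrite lerD2l lerN2 lef_pV2 ?posrE// ler_nat.
  apply/seteqP; split => x /=.
    rewrite in_itv/= => x1.
    have [n _ nx] : \forall n \near \oo, (harmonic n < 1 - x)%R.
      by apply: cvgr_lt; [exact: cvg_harmonic|rewrite subr_gt0].
    by exists n => //=; rewrite in_itv/= lerBrDl -lerBrDr; exact/ltW/(nx n (leqnn n)).
  by move=> [n _] /=; rewrite !in_itv/= => /le_lt_trans; apply; rewrite ltrBlDr ltrDl.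
have U1 : U `]-oo, 1%R[%classic = 1.
  apply: cvg_unique cU _ => //.
  rewrite (_ : (fun _ => _) = (fun n => (1 - harmonic n)%:E)); last first.
    apply/funext => n; rewrite UE clip_id//; apply/andP; split.
      by rewrite subr_ge0 invf_le1// ler1n.
    by rewrite gerBl.
  apply: cvg_EFin; first exact: nearW.
  rewrite -[X in _ --> X](subr0 1%R); apply: cvgB; [exact: cvg_cst|exact: cvg_harmonic].
rewrite (_ : `]0%R, 1%R[%classic = `]-oo, 1%R[%classic `\` `]-oo, 0%R]%classic); last first.
  apply/seteqP; split => x /=; rewrite !in_itv/=.
    by move=> /andP[x0 x1]; split => //; apply/negP; rewrite -ltNge.
  by move=> [x1 /negP]; rewrite -ltNge => ->.
rewrite measureD//; last exact: probability_lty.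
rewrite (_ : _ `&` _ = `]-oo, 0%R]%classic); last first.
  apply/seteqP; split => x /=; rewrite !in_itv/=; first by case.
  by move=> x0; split => //; lra.
transitivity (1 - (clip (0:R))%:E : \bar R); first by congr (_ - _) => //; exact: UE.
by rewrite clip_le0// sube0.
Qed.

Variable h : R * R -> \bar R.
Hypothesis mh : measurable_fun setT h.
Hypothesis h0 : forall wz, 0 <= h wz.
Hypothesis hneg : forall w z, (z <= 0)%R -> h (w, z) = 0.

Definition kernel_mass w B := \int[lebesgue_measure]_(z in B) h (w, z).
Definition proper_mass w := (0 < kernel_mass w setT)%E && (kernel_mass w setT < +oo)%E.
Definition kernel_cdf w y : R :=
  (fine (kernel_mass w `]-oo, y]%classic) / fine (kernel_mass w setT))%R.

Lemma measurable_section w : measurable_fun setT (fun z : R => h (w, z)).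
Proof.
exact: (measurableT_comp mh (measurable_fun_pair (measurable_cst w) (@measurable_id _ R setT))).
Qed.

Lemma kernel_massE w B : kernel_mass w B =
  weighted_measure lebesgue_measure (measurable_section w) (fun z => h0 (w, z)) B.
Proof. by []. Qed.

Lemma measurable_kernel_mass B : measurable B ->
  measurable_fun setT (fun w => kernel_mass w B).
Proof.
move=> mB.
rewrite (_ : (fun _ => _) = fun w => \int[lebesgue_measure]_z ((\1_B z)%:E * h (w, z))); last first.
  apply/funext => w; rewrite /kernel_mass integral_mkcond; apply: eq_integral => z _.
  by rewrite epatch_indic muleC.
apply: (@measurable_integral_lebesgue _ _ _ (fun zw : R * R =>
    (\1_B zw.1)%:E * h (zw.2, zw.1))).
  apply: emeasurable_funM.
    apply/measurable_EFinP; apply: (measurableT_comp _ measurable_fst).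
    exact: measurable_indic.
  exact: (measurableT_comp mh (measurable_fun_pair measurable_snd measurable_fst)).
by move=> zw; rewrite mule_ge0 ?lee_fin.
Qed.

Lemma kernel_mass_fin w B : measurable B -> proper_mass w -> kernel_mass w B \is a fin_num.
Proof.
move=> mB /andP[_ woo]; rewrite ge0_fin_numE ?kernel_massE//.
apply: le_lt_trans woo; rewrite kernel_massE; apply: le_measure; rewrite ?inE//.
Qed.

Lemma kernel_cdf_nd w y y' : proper_mass w -> (y <= y')%R -> (kernel_cdf w y <= kernel_cdf w y')%R.
Proof.
move=> pw yy'; rewrite ler_wpM2r ?invr_ge0 ?fine_ge0 ?kernel_massE//.
rewrite fine_le -?kernel_massE ?kernel_mass_fin// !kernel_massE.
apply: le_measure; rewrite ?inE//.
by move=> x /=; rewrite !in_itv/= => /le_trans; exact.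
Qed.

Lemma kernel_cdf_le0 w y : (y <= 0)%R -> kernel_cdf w y = 0%R.
Proof.
move=> y0; rewrite /kernel_cdf (_ : kernel_mass w _ = 0) ?mul0r//.
apply: integral0_eq => z; rewrite /= in_itv/= => zy; apply: hneg.
exact: le_trans y0.
Qed.

Lemma kernel_cdf_itv w y : proper_mass w -> (0 <= kernel_cdf w y <= 1)%R.
Proof.
move=> pw; have [w0 woo] := andP pw.
have ? : kernel_mass w setT \is a fin_num by exact: kernel_mass_fin.
rewrite divr_ge0 ?fine_ge0 ?kernel_massE//= ler_pdivrMr ?mul1r; last first.
  by rewrite fine_gt0// w0.
rewrite fine_le -?kernel_massE ?kernel_mass_fin// !kernel_massE.
by apply: le_measure; rewrite ?inE.
Qed.

Lemma kernel_cdf_right_continuous w y : proper_mass w ->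
  kernel_cdf w (y + n.+1%:R^-1)%R @[n --> \oo] --> kernel_cdf w y.
Proof.
move=> pw; apply: cvgM; last exact: cvg_cst.
apply: fine_cvg; rewrite fineK ?kernel_mass_fin// kernel_massE.
rewrite (_ : `]-oo, y]%classic = \bigcap_n `]-oo, (y + n.+1%:R^-1)%R]%classic).
  apply: nonincreasing_cvg_mu => //.
  - change (kernel_mass w `]-oo, (y + 1%:R^-1)%R]%classic < +oo).
    by rewrite ltey_eq kernel_mass_fin.
  - by apply: bigcapT_measurable => n; exact: measurable_itv.
  - move=> n m nm; apply/subsetPset => x /=; rewrite !in_itv/= => /le_trans; apply.
    by rewrite lerD2l lef_pV2 ?posrE// ler_nat.
apply/seteqP; split => x /=.
  by rewrite in_itv/= => xy n _ /=; rewrite in_itv/= (le_trans xy)// lerDl.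
move=> xn; rewrite in_itv/=; apply/ler_addgt0Pr => e e0.
have [n _ ne] : \forall n \near \oo, (harmonic n < e)%R.
  by apply: cvgr_lt; [exact: cvg_harmonic|].
have := xn n I; rewrite /= in_itv/= => /le_trans; apply.
by rewrite lerD2l; exact/ltW/(ne n (leqnn n)).
Qed.

Lemma kernel_cdf_cvg1 w : proper_mass w ->
  kernel_cdf w n%:R @[n --> \oo] --> (1 : R)%R.
Proof.
move=> pw; have [w0 woo] := andP pw.
rewrite -[X in _ --> X](@divff R (fine (kernel_mass w setT))); last first.
  by rewrite gt_eqF// fine_gt0// w0.
apply: cvgM; last exact: cvg_cst.
apply: fine_cvg; rewrite fineK ?kernel_mass_fin// kernel_massE.
rewrite (_ : setT = \bigcup_n `]-oo, n%:R]%classic).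
  apply: nondecreasing_cvg_mu => //.
  - by apply: bigcupT_measurable => n; exact: measurable_itv.
  - move=> n m nm; apply/subsetPset => x /=; rewrite !in_itv/= => /le_trans; apply.
    by rewrite ler_nat.
apply/seteqP; split => x // _; exists (Num.truncn x).+1 => //=.
by rewrite in_itv/= ltW// truncnS_gt.
Qed.

(** The generalised inverse of [kernel_cdf w]. The value [0] elsewhere keeps
    it nonnegative for every argument. *)
Definition quantile (w u : R) : R :=
  if proper_mass w && (0 < u < 1)%R then inf [set y | (u <= kernel_cdf w y)%R] else 0%R.

(** The Galois connection between a right-continuous distribution function and
    its inverse: the infimum is attained. It reduces measurability and the law
    of the quantile to those of [kernel_cdf]. *)
Lemma quantile_le w u y : proper_mass w -> (0 < u < 1)%R ->
  (quantile w u <= y)%R = (u <= kernel_cdf w y)%R.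
Proof.
move=> pw u01; rewrite /quantile pw u01 /=; have /andP[u0 u1] := u01.
set S := [set _ | _].
have S0 : S !=set0.
  have [n _ nu] : \forall n \near \oo, (u < kernel_cdf w n%:R)%R.
    by apply: cvgr_gt; [exact: kernel_cdf_cvg1|].
  by exists n%:R; exact/ltW/(nu n (leqnn n)).
have lS : lbound S 0%R.
  move=> z Sz; rewrite leNgt; apply/negP => z0.
  by move: Sz; rewrite /S /= kernel_cdf_le0 ?(ltW z0)// leNgt u0.
have hS : has_inf S by split => //; exists 0%R.
apply/idP/idP => [Sy|uy]; last by apply: inf_lbound => //; exists 0%R.
have Sn n : (u <= kernel_cdf w (y + n.+1%:R^-1))%R.
  have n0 : (0 < n.+1%:R^-1 :> R)%R by [].
  have [z Sz zlt] := inf_adherent n0 hS.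
  by apply: (le_trans Sz); apply: kernel_cdf_nd => //; apply/ltW/(lt_le_trans zlt); rewrite lerD2r.
have cy := @kernel_cdf_right_continuous w y pw.
rewrite -(cvg_lim _ cy)//; apply: limr_ge; first exact: cvgP cy.
exact: nearW.
Qed.

Lemma quantile_ge0 w u : (0 <= quantile w u)%R.
Proof.
have [/andP[pw u01]|] := boolP (proper_mass w && (0 < u < 1)%R); last first.
  by move=> /negbTE e; rewrite /quantile e.
rewrite leNgt; apply/negP => q0; have := lexx (quantile w u).
by have /andP[u0 _] := u01; rewrite quantile_le// kernel_cdf_le0 ?(ltW q0)// leNgt u0.
Qed.

Lemma measurable_quantile : measurable_fun setT (fun wu : R * R => quantile wu.1 wu.2).
Proof.
have mcdf y : measurable_fun setT (fun w => kernel_cdf w y).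
  apply: measurable_funM.
    apply: (measurableT_comp (fine_measurable measurableT)).
    exact: measurable_kernel_mass.
  rewrite (_ : (fun _ => _) = (fun w => fine (kernel_mass w setT) `^ (-1))%R); last first.
    by apply/funext => x; rewrite powR_inv1// fine_ge0// kernel_massE.
  apply: (measurableT_comp (measurable_powR _)).
  apply: (measurableT_comp (fine_measurable measurableT)).
  exact: measurable_kernel_mass.
have mproper : measurable [set w | proper_mass w].
  have mk := measurable_kernel_mass measurableT.
  rewrite (_ : [set w | _] = (fun w => kernel_mass w setT) @^-1` `]0, (+oo : \bar R)[).
    by rewrite -[X in measurable X]setTI; apply: mk => //; exact: emeasurable_itv.
  by apply/seteqP; split => w; rewrite /= in_itv/= /proper_mass.
pose G : set (R * R) := [set wu | proper_mass wu.1 && (0 < wu.2 < 1)%R].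
have mG : measurable G.
  rewrite (_ : G = [set w | proper_mass w] `*` `]0%R, 1%R[%classic); last first.
    by apply/seteqP; split => wu /=; rewrite in_itv/= => /andP.
  by apply: measurableX => //; exact: measurable_itv.
apply: measurable_of_rays => y.
rewrite (_ : [set _ | _] = (G `&` [set wu : R * R | (wu.2 <= kernel_cdf wu.1 y)%R]) `|`
    (if (0 <= y)%R then ~` G else set0)); last first.
  apply/seteqP; split => wu /=.
    have [Gwu|nG] := boolP (proper_mass wu.1 && (0 < wu.2 < 1)%R).
      by have [pw u01] := andP Gwu; rewrite quantile_le//; left.
    rewrite /quantile (negbTE nG) => ->; right; exact/negP.
  move=> [[/andP[pw u01]]|]; first by rewrite quantile_le.
  by case: ifPn => // y0 /negP/negbTE nG; rewrite /quantile nG.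
apply: measurableU; last by case: ifP => // _; exact: measurableC.
apply: measurableI => //.
have ml : measurable_fun setT (fun wu : R * R => (kernel_cdf wu.1 y - wu.2)%R).
  by apply: measurable_funB => //; exact: (measurableT_comp (mcdf y) measurable_fst).
rewrite (_ : [set _ | _] = (fun wu : R * R => (kernel_cdf wu.1 y - wu.2)%R) @^-1` `[0%R, +oo[%classic).
  by rewrite -[X in measurable X]setTI; apply: ml => //; exact: measurable_itv.
by apply/seteqP; split => wu /=; rewrite in_itv/= andbT subr_ge0.
Qed.

Lemma measurable_quantile_at w : measurable_fun setT (quantile w).
Proof.
exact: (measurableT_comp measurable_quantile
  (measurable_fun_pair (measurable_cst w) (@measurable_id _ R setT))).
Qed.

(** On half-lines, by the Galois connection, this is the distribution function
    of a uniform variable at [kernel_cdf w y]. *)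
Lemma quantile_law w B : proper_mass w -> measurable B ->
  U (quantile w @^-1` B) = ((fine (kernel_mass w setT))^-1)%:E * kernel_mass w B.
Proof.
move=> pw mB; have [w0 woo] := andP pw.
have c0 : (0 <= (fine (kernel_mass w setT))^-1)%R.
  by rewrite invr_ge0 fine_ge0// ltW.
pose q := NngNum c0.
have mid : measurable_fun setT (id : measurableTypeR R -> R) by move=> _ A mA; rewrite setTI.
pose wm : {measure set (measurableTypeR R) -> \bar R} := weighted_measure lebesgue_measure
  (measurable_section w) (fun z => h0 (w, z)).
apply: (@eq_measure_rays _ (image_measure U (measurable_quantile_at w))
  (mscale q (image_measure wm mid))) => //; last first.
  by apply: probability_lty; rewrite preimage_setT.
move=> y; change (U (quantile w @^-1` `]-oo, y]%classic) =
  ((fine (kernel_mass w setT))^-1)%:E * kernel_mass w `]-oo, y]%classic).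
rewrite -(@fineK _ (kernel_mass w `]-oo, y]%classic)) ?kernel_mass_fin//.
rewrite -EFinM mulrC -/(kernel_cdf w y).
have [k0 k1] := andP (kernel_cdf_itv y pw).
rewrite -[RHS](_ : U `]-oo, kernel_cdf w y]%classic = _); last first.
  by rewrite UE clip_id// k0.
have mI : measurable (`]0%R, 1%R[%classic : set R) by exact: measurable_itv.
apply: ae_eq_measure.
- by rewrite -[X in measurable X]setTI; exact: measurable_quantile_at.
- exact: measurable_itv.
exists (~` `]0%R, 1%R[%classic); split.
- exact: measurableC.
- by rewrite [LHS]probability_setC// [X in 1 - X]uniform_inside subee.
- move=> u /=; apply: contra_not => u01; move: u01; rewrite !in_itv/= => u01.
  by rewrite quantile_le.
Qed.

End quantile.

(** * A subordinator from a convolution semigroup of densities *)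

Section iid_blocks.
Context (R : realType) d (Omega : measurableType d) (P : probability Omega R).
Variables (Z : nat -> Omega -> R) (mu : probability R R).
Hypothesis mZ : forall j, measurable_fun setT (Z j).
Hypothesis iidZ : forall K (C : nat -> set R), (forall j, measurable (C j)) ->
  P (\bigcap_(j in [set j | (j < K)%N]) Z j @^-1` C j) = \prod_(j < K) mu (C j).

Let Bl (l : seq (nat * R)) j : set R := \big[setI/setT]_(p <- l | p.1 == j) `]-oo, p.2]%classic.

Let mBl l j : measurable (Bl l j).
Proof. by apply: bigsetI_measurable => p _; exact: measurable_itv. Qed.

Let BlT l j : (forall p, p \in l -> p.1 != j) -> Bl l j = setT.
Proof.
by move=> lj; rewrite /Bl big_seq_cond big1// => p /andP[/lj/negbTE ->].
Qed.

Let cylE l K : (forall p, p \in l -> (p.1 < K)%N) ->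
  P (cylinder Z (rays l)) = \prod_(j < K) mu (Bl l j).
Proof.
move=> lK; rewrite -iidZ//; congr (P _).
rewrite cylinder_raysE; apply/seteqP; split => [w wl j _|w wB p pl].
- rewrite /Bl /= -bigcap_seq_cond => p /= /andP[pl /eqP pj].
  by rewrite in_itv/= -pj; exact: wl.
- have := wB p.1 (lK _ pl); rewrite /= /Bl -bigcap_seq_cond.
  by move=> /(_ p); rewrite /= pl eqxx in_itv/=; exact.
Qed.

Lemma iid_rays_independent N l1 l2 :
  (forall p, p \in l1 -> (p.1 < N)%N) -> (forall p, p \in l2 -> (N <= p.1)%N) ->
  P (cylinder Z (rays l1) `&` cylinder Z (rays l2)) =
  P (cylinder Z (rays l1)) * P (cylinder Z (rays l2)).
Proof.
move=> l1N l2N.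
have [K KP] : exists K, forall p, p \in l1 ++ l2 -> (p.1 < K)%N.
  elim: (l1 ++ l2) => [|p l [K KP]]; first by exists 0%N.
  exists (maxn K p.1.+1) => q; rewrite inE => /predU1P[->|/KP qK].
    by rewrite leq_max leqnn orbT.
  by rewrite leq_max qK.
rewrite -cylinder_cat -map_cat (@cylE (l1 ++ l2) K)// (@cylE l1 K)//; last first.
  by move=> p pl; apply: KP; rewrite mem_cat pl.
rewrite (@cylE l2 K)//; last by move=> p pl; apply: KP; rewrite mem_cat pl orbT.
rewrite -big_split; apply: eq_bigr => j _ /=.
have -> : Bl (l1 ++ l2) j = Bl l1 j `&` Bl l2 j by rewrite /Bl big_cat.
have [jN|Nj] := ltnP j N.
  rewrite (@BlT l2) => [|p /l2N Np]; last by rewrite neq_ltn (leq_trans jN Np) orbT.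
  by rewrite setIT [X in _ * X]probability_setT mule1.
rewrite (@BlT l1) => [|p /l1N pN]; last by rewrite neq_ltn (leq_trans pN Nj).
by rewrite setTI [X in X * _]probability_setT mul1e.
Qed.

(** Independence of cylinders is extended to the two sigma-algebras in turn. *)
Lemma past_future_independent N (A : set (path_space R [set j | (j < N)%N]))
    (C : set (path_space R [set j | (N <= j)%N])) : measurable A -> measurable C ->
  P ((fun w => Z ^~ w) @^-1` A `&` (fun w => Z ^~ w) @^-1` C) =
  P ((fun w => Z ^~ w) @^-1` A) * P ((fun w => Z ^~ w) @^-1` C).
Proof.
move=> mA mC.
have mcyl l : measurable (cylinder Z (rays l)).
  apply: measurable_cylinder => _ /mapP[q _ ->] /=; split => //; exact: measurable_itv.
have mCZ : measurable ((fun w => Z ^~ w) @^-1` C).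
  rewrite -[X in measurable X]setTI.
  exact: (@measurable_path R _ [set j | (N <= j)%N] _ _ Z).
rewrite setIC muleC.
apply: (path_independent_event (V := Z) (D := [set j | (j < N)%N])) => // l1 l1N.
rewrite setIC muleC.
by apply: (path_independent_event (V := Z) (D := [set j | (N <= j)%N])) => // l2 l2N;
  exact: (@iid_rays_independent N).
Qed.

Lemma measurable_block_sum (D : set nat) a b : (forall j, (a <= j < b)%N -> D j) ->
  measurable_fun setT (fun z : path_space R D => \sum_(a <= j < b) z j)%R.
Proof.
move=> aD; have : {subset index_iota a b <= [pred j | (a <= j < b)%N]}.
  by move=> j; rewrite mem_index_iota.
elim: (index_iota a b) => [|j s IH] sab.
  by rewrite (_ : (fun _ => _) = cst 0%R)//; apply/funext => z; rewrite big_nil.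
rewrite (_ : (fun _ => _) = (fun z : path_space R D => z j + \sum_(i <- s) z i)%R); last first.
  by apply/funext => z; rewrite big_cons.
apply: measurable_funD.
  by apply: measurable_coordinate; apply: aD; apply: sab; rewrite mem_head.
by apply: IH => i si; apply: sab; rewrite inE si orbT.
Qed.

(** Induction on the number of blocks: the last sum depends on the variables
    after [N k], the others on the variables before. *)
Lemma blocks_independent k (N : nat -> nat) (B : nat -> set R) :
  (forall j, (N j <= N j.+1)%N) -> (forall j, measurable (B j)) ->
  P (\bigcap_(j in [set j | (j < k)%N])
       [set w | B j (\sum_(N j <= i < N j.+1) Z i w)%R]) =
  \prod_(j < k) P [set w | B j (\sum_(N j <= i < N j.+1) Z i w)%R].
Proof.
move=> ndN mB; elim: k => [|k IH].
  rewrite big_ord0 (_ : \bigcap_(j in _) _ = setT) ?[P setT]probability_setT//.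
  by apply/seteqP; split => // w _ j.
rewrite big_ord_recr/= -IH.
pose A : set (path_space R [set j | (j < N k)%N]) := \bigcap_(j in [set j | (j < k)%N])
  [set z | B j (\sum_(N j <= i < N j.+1) z i)%R].
pose C : set (path_space R [set j | (N k <= j)%N]) :=
  [set z | B k (\sum_(N k <= i < N k.+1) z i)%R].
have mN : {homo N : i j / (i <= j)%N} by apply: homo_leq => // ? ? ?; exact: leq_trans.
have mA : measurable A.
  apply: bigcap_measurableType => j /= jk; rewrite -[X in measurable X]setTI.
  apply: measurable_block_sum => // i /andP[_ ij] /=.
  by apply: (leq_trans ij); exact: mN.
have mC : measurable C.
  rewrite -[X in measurable X]setTI.
  by apply: measurable_block_sum => // i /andP[].
rewrite -(past_future_independent mA mC); congr (P _).
apply/seteqP; split => [w wB|w [wA wC] j /=].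
  by split; [move=> j /= jk; apply: wB; exact: ltnW|exact: (wB k (ltnSn k))].
by rewrite ltnS leq_eqVlt => /predU1P[->//|]; exact: wA.
Qed.

Lemma iid_marginal j B : measurable B -> P (Z j @^-1` B) = mu B.
Proof.
move=> mB; pose C i := if i == j then B else setT.
have := @iidZ j.+1 C.
rewrite (_ : \bigcap_(i in _) _ = Z j @^-1` B); last first.
  apply/seteqP; split => [w wC|w wB i _]; last by rewrite /C /=; case: eqP => [->|].
  by have := wC j (ltnSn j); rewrite /C /= eqxx.
move=> ->; last by move=> i; rewrite /C; case: ifP.
rewrite big_ord_recr/= big1 ?mul1e ?/C ?eqxx// => i _.
by rewrite ltn_eqF// [LHS]probability_setT.
Qed.

Lemma measurable_sum_nat a b : measurable_fun setT (fun w => \sum_(a <= j < b) Z j w)%R.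
Proof.
have mp := @measurable_path R _ setT _ _ Z (fun j _ => mZ j).
exact: (measurableT_comp (measurable_block_sum (D := setT) _) mp).
Qed.

Lemma adjacent_blocks_independent a b c A B : (a <= b <= c)%N ->
  measurable A -> measurable B ->
  P ([set w | A (\sum_(a <= i < b) Z i w)%R] `&` [set w | B (\sum_(b <= i < c) Z i w)%R]) =
  P [set w | A (\sum_(a <= i < b) Z i w)%R] * P [set w | B (\sum_(b <= i < c) Z i w)%R].
Proof.
move=> /andP[ab bc] mA mB.
pose N j := if j is j'.+1 then if j' is 0%N then b else c else a.
pose C j := if j is 0%N then A else B.
have := @blocks_independent 2 N C.
rewrite (_ : \bigcap_(j in _) _ = [set w | A (\sum_(a <= i < b) Z i w)%R] `&`
    [set w | B (\sum_(b <= i < c) Z i w)%R]).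
  move=> ->; first by rewrite !big_ord_recl big_ord0 mule1.
    by case=> [|[]].
  by case.
apply/seteqP; split => [w wC|w [wA wB] [|[]]//].
by split; [exact: (wC 0%N)|exact: (wC 1%N)].
Qed.

End iid_blocks.

Lemma product_probability_setT d1 d2 (T1 : measurableType d1) (T2 : measurableType d2)
    (R : realType) (m1 : probability T1 R) (m2 : probability T2 R) :
  (m1 \x m2) setT = 1.
Proof.
rewrite -setXTT product_measure1E//.
by rewrite [X in X * _]probability_setT [X in _ * X]probability_setT mule1.
Qed.

(** The event [E] and the constant [c] leave room for the other coordinates of
    a larger product, so that coordinates can be treated one after the other. *)
Lemma extend_rectangles d d1 d2 (T : measurableType d) (T1 : measurableType d1)
    (T2 : measurableType d2) (R : realType) (m : {measure set T -> \bar R})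
    (n : {measure set (T1 * T2) -> \bar R}) (E : set T) (X : T -> T1 * T2) (c : \bar R) :
  measurable E -> measurable_fun setT X -> 0 <= c -> c \is a fin_num -> m E < +oo ->
  (forall A B, measurable A -> measurable B ->
    m (E `&` X @^-1` (A `*` B)) = n (A `*` B) * c) ->
  forall C, measurable C -> m (E `&` X @^-1` C) = n C * c.
Proof.
move=> mE mX c0 cfin mEoo rect C mC.
pose q : {nonneg R} := NngNum (fine_ge0 c0).
have qE : (q%:num)%:E = c by rewrite /= fineK.
have := @eq_measure_prod _ _ T1 T2 R (image_measure (mrestr m mE) mX) (mscale q n).
move=> /(_ _ _ C mC) H; rewrite setIC muleC -qE; apply: H.
  move=> A B mA mB; change (m (X @^-1` (A `*` B) `&` E) = (q%:num)%:E * n (A `*` B)).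
  by rewrite qE muleC setIC rect.
by change (m (X @^-1` setT `&` E) < +oo); rewrite preimage_setT setTI.
Qed.

Section splitting.
Context (R : realType) (U : probability R R).
Hypothesis UE : forall x, U `]-oo, x]%classic = (clip x)%:E.
Variables (f : R -> R -> \bar R) (G : R -> probability R R).
Hypothesis mf : forall h, (0 < h)%R -> measurable_fun setT (f h).
Hypothesis f0 : forall h x, (0 < h)%R -> 0 <= f h x.
Hypothesis fneg : forall h x, (0 < h)%R -> (x <= 0)%R -> f h x = 0.
Hypothesis fpos : forall h x, (0 < h)%R -> (0 < x)%R -> 0 < f h x < +oo.
Hypothesis fCK : forall a b x, (0 < a)%R -> (0 < b)%R ->
  \int[lebesgue_measure]_y (f a (x - y)%R * f b y) = f (a + b)%R x.
Hypothesis GE : forall h B, (0 < h)%R -> measurable B ->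
  G h B = \int[lebesgue_measure]_(x in B) f h x.

Lemma integral_law h (k : R -> \bar R) : (0 < h)%R -> measurable_fun setT k ->
  (forall x, 0 <= k x) -> \int[G h]_x k x = \int[lebesgue_measure]_x (k x * f h x).
Proof.
move=> h_gt0 mk k0; apply: integral_of_lebesgue_density => //; first exact: mf.
- by move=> x; exact: f0.
- by move=> A mA; exact: GE.
Qed.

Section halving.
Variable a : R.
Hypothesis a_gt0 : (0 < a)%R.

(** For a fixed sum [w], this is up to a constant the conditional density of
    one of two independent summands with density [f a]. *)
Definition halving_density (wz : R * R) : \bar R := f a (wz.1 - wz.2)%R * f a wz.2.

Let a2 : (0 < a + a)%R. Proof. by rewrite addr_gt0. Qed.

Lemma measurable_halving_density : measurable_fun setT halving_density.
Proof.
apply: emeasurable_funM; last exact: (measurableT_comp (mf a_gt0) measurable_snd).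
by apply: (measurableT_comp (mf a_gt0)); exact: measurable_funB.
Qed.

Lemma halving_density_ge0 wz : 0 <= halving_density wz.
Proof. by rewrite mule_ge0 ?f0. Qed.

Lemma halving_density_neg w z : (z <= 0)%R -> halving_density (w, z) = 0.
Proof. by move=> z0; rewrite /halving_density/= (fneg a_gt0 z0) mule0. Qed.

Lemma halving_mass w : kernel_mass halving_density w setT = f (a + a) w.
Proof. by rewrite -fCK. Qed.

Lemma halving_proper w : (0 < w)%R -> proper_mass halving_density w.
Proof. by move=> w0; rewrite /proper_mass halving_mass; exact: fpos. Qed.

(** A sample of that conditional law when [v] is uniform. *)
Definition half (w v : R) : R := quantile halving_density w v.

Lemma measurable_half : measurable_fun setT (fun wv : R * R => half wv.1 wv.2).
Proof.
exact: (measurable_quantile measurable_halving_density halving_density_ge0 halving_density_neg).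
Qed.

Lemma half_ge0 w v : (0 <= half w v)%R.
Proof.
exact: (quantile_ge0 measurable_halving_density halving_density_ge0 halving_density_neg).
Qed.

Lemma half_le w v : (0 <= w)%R -> (half w v <= w)%R.
Proof.
rewrite le_eqVlt => /predU1P[<-|w0].
  rewrite /half /quantile /proper_mass halving_mass fneg//= ltxx//=.
have [pv|pv] := boolP (0 < v < 1)%R; last by rewrite /half /quantile (negbTE pv) andbF ltW.
rewrite (quantile_le measurable_halving_density halving_density_ge0 halving_density_neg)//;
  last exact: halving_proper.
have -> : kernel_cdf halving_density w w = 1%R.
  rewrite /kernel_cdf (_ : kernel_mass _ _ `]-oo, w]%classic = kernel_mass halving_density w setT).
    rewrite divff// halving_mass gt_eqF// fine_gt0//; exact: fpos.
  rewrite /kernel_mass integral_mkcond; apply: eq_integral => z _.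
  rewrite patchE; case: ifPn => //; rewrite notin_setE /= in_itv/= => /negP.
  rewrite -ltNge => wz; rewrite /halving_density /= (fneg (x := (w - z)%R)) ?mul0e//.
  by rewrite subr_le0 ltW.
by have /andP[_ /ltW] := pv.
Qed.

(** The total mass of the conditional density is [f (a + a) w], by the
    Chapman-Kolmogorov equation: it cancels the density of the sum and leaves
    the joint density [f a (w - z) f a z]. *)
Lemma half_joint_law C D : measurable C -> measurable D ->
  (G (a + a)%R \x U) [set wv | C wv.1 /\ D (half wv.1 wv.2)] =
  (G a \x G a) [set zy | C (zy.1 + zy.2)%R /\ D zy.1].
Proof.
move=> mC mD.
have mind E : measurable E -> measurable_fun setT (fun x : R => (\1_E x)%:E : \bar R).
  by move=> mE; apply/measurable_EFinP; exact: measurable_indic.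
transitivity (\int[lebesgue_measure]_w \int[G a]_z
    ((\1_C w)%:E * (\1_D z)%:E * f a (w - z)%R)).
  transitivity (\int[G (a + a)%R]_w ((\1_C w)%:E * U (half w @^-1` D))).
    rewrite [LHS]/product_measure1; apply: eq_integral => w _ /=.
    rewrite indicE; case: (boolP (w \in C)) => wC; rewrite ?mul1e ?mul0e.
      congr (U _); apply/seteqP; split => v; rewrite /xsection /= inE /=.
        by case.
      by move=> Dv; split => //; exact: set_mem.
    rewrite (_ : xsection _ _ = set0) ?measure0//.
    apply/seteqP; split => // v; rewrite /xsection /= inE /= => -[Cw _].
    by move: wC; rewrite notin_setE.
  have mU : measurable_fun setT (fun w => U (half w @^-1` D)).
    have mS : measurable [set wv : R * R | D (half wv.1 wv.2)].
      by rewrite -[X in measurable X]setTI; exact: measurable_half.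
    rewrite (_ : (fun _ => _) = (fun w => U (xsection [set wv | D (half wv.1 wv.2)] w))).
      exact: measurable_fun_xsection.
    apply/funext => w; congr (U _); apply/seteqP.
    by split => v; rewrite /xsection /= inE.
  rewrite integral_law//; last 2 first.
  - by apply: emeasurable_funM => //; exact: mind.
  - by move=> w; rewrite mule_ge0// lee_fin.
  apply: eq_integral => w _.
  have mk : measurable_fun setT (fun z : R => (\1_D z)%:E * f a (w - z)%R).
    apply: emeasurable_funM; first exact: mind.
    by apply: (measurableT_comp (mf a_gt0)); exact: measurable_funB.
  under [RHS]eq_integral do rewrite -muleA.
  rewrite ge0_integralZl//; [|by move=> z _; rewrite mule_ge0 ?lee_fin ?f0..].
  rewrite -muleA; congr (_ * _).
  rewrite integral_law//; last by move=> z; rewrite mule_ge0 ?lee_fin ?f0.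
  transitivity (kernel_mass halving_density w D); last first.
    rewrite /kernel_mass integral_mkcond; apply: eq_integral => z _.
    by rewrite epatch_indic /halving_density/= muleC muleA.
  have [w0|w0] := ltP 0%R w.
    rewrite (quantile_law UE measurable_halving_density halving_density_ge0
      halving_density_neg)//; last exact: halving_proper.
    have /andP[fw0 fwoo] := fpos a2 w0.
    have ffin : f (a + a)%R w \is a fin_num by rewrite ge0_fin_numE ?(ltW fw0).
    rewrite halving_mass muleAC -[X in _ * X * _](fineK ffin) -EFinM.
    by rewrite mulVf ?mul1e// gt_eqF// fine_gt0// fw0.
  rewrite (fneg a2 w0) mule0; apply/esym/integral0_eq => z _.
  rewrite /halving_density/=; have [z0|z0] := leP z 0%R; first by rewrite (fneg a_gt0 z0) mule0.
  by rewrite (fneg (x := (w - z)%R)) ?mul0e//; lra.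
have mK : measurable_fun setT (fun wz : R * R =>
    (\1_C wz.1)%:E * (\1_D wz.2)%:E * f a (wz.1 - wz.2)%R).
  apply: emeasurable_funM; last first.
    by apply: (measurableT_comp (mf a_gt0)); exact: measurable_funB.
  apply: emeasurable_funM; first exact: (measurableT_comp (mind _ mC) measurable_fst).
  exact: (measurableT_comp (mind _ mD) measurable_snd).
rewrite (@fubini_lebesgue _ _ _ (G a) (fun wz : R * R =>
    (\1_C wz.1)%:E * (\1_D wz.2)%:E * f a (wz.1 - wz.2)%R))//; last first.
  by move=> wz; rewrite mule_ge0 ?f0// mule_ge0 ?lee_fin.
rewrite [RHS]/product_measure1; apply: eq_integral => z _ /=.
have mg : measurable_fun setT (fun w : R => (\1_C w)%:E * f a (w - z)%R).
  apply: emeasurable_funM; first exact: mind.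
  by apply: (measurableT_comp (mf a_gt0)); exact: measurable_funB.
have mCz : measurable [set y : R | C (y + z)%R].
  have mz : measurable_fun setT (fun y : R => (y + z)%R) by exact: measurable_funD.
  by rewrite -[X in measurable X]setTI; exact: mz.
transitivity ((\1_D z)%:E * \int[lebesgue_measure]_w ((\1_C w)%:E * f a (w - z)%R)).
  rewrite -ge0_integralZl//; last by move=> w _; rewrite mule_ge0 ?lee_fin ?f0.
  by apply: eq_integral => w _; rewrite muleA (muleC (\1_D z)%:E).
rewrite -(ge0_integral_shift z)//; last by move=> w; rewrite mule_ge0 ?lee_fin ?f0.
rewrite [X in _ * X](_ : _ = G a [set y | C (y + z)%R]); last first.
  rewrite GE// [RHS]integral_mkcond; apply: eq_integral => y _.
  by rewrite epatch_indic addrK muleC; congr (_ * _%:E).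
rewrite indicE; case: (boolP (z \in D)) => zD; rewrite ?mul1e ?mul0e.
  congr (G a _); apply/seteqP; split => y; rewrite /xsection /= inE /=.
    by rewrite addrC => Cy; split => //; exact: set_mem.
  by rewrite addrC => -[].
rewrite (_ : xsection _ _ = set0) ?measure0//.
apply/seteqP; split => // y; rewrite /xsection /= inE /= => -[_ Dz].
by move: zD; rewrite notin_setE.
Qed.

Lemma half_law A B : measurable A -> measurable B ->
  (G (a + a)%R \x U) [set wv | A (half wv.1 wv.2) /\ B (wv.1 - half wv.1 wv.2)%R] =
  G a A * G a B.
Proof.
move=> mA mB.
have mp1 : measurable_fun setT (fun wv : R * R => (wv.1, half wv.1 wv.2)).
  exact: (measurable_fun_pair measurable_fst measurable_half).
have mp2 : measurable_fun setT (fun zy : R * R => ((zy.1 + zy.2)%R, zy.1)).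
  by apply: measurable_fun_pair => //; exact: measurable_funD.
pose m1 := image_measure (G (a + a)%R \x U) mp1.
pose m2 := image_measure (G a \x G a) mp2.
pose S : set (R * R) := [set wz | A wz.2 /\ B (wz.1 - wz.2)%R].
have mS : measurable S.
  have mB' : measurable_fun setT (fun wz : R * R => (wz.1 - wz.2)%R) by exact: measurable_funB.
  apply: measurableI; first by rewrite -[X in measurable X]setTI; exact: measurable_snd.
  by rewrite -[X in measurable X]setTI; exact: mB'.
have : m1 S = m2 S.
  apply: eq_measure_prod => //.
    by move=> C D mC mD; exact: half_joint_law.
  by rewrite image_measureE preimage_setT [ltLHS](product_probability_setT (G (a + a)%R) U) ltry.
rewrite -(product_measure1E (G a) (G a))// => E.
transitivity (m1 S); first by [].
rewrite E; congr (product_measure1 _ _ _); apply/seteqP.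
by split => -[z y]; rewrite /S /= (addrC z y) addrK.
Qed.

(** A state is an increment with a uniform variable that drives the further
    splittings below it. One half of the digits of that variable splits the
    increment, the other half supplies the two new states. *)
Definition split_state (wu : R * R) : (R * R) * (R * R) :=
  let q := half wu.1 (even_bits wu.2) in
  ((q, even_bits (odd_bits wu.2)), ((wu.1 - q)%R, odd_bits (odd_bits wu.2))).

Lemma measurable_split_state : measurable_fun setT split_state.
Proof.
have mE := @measurable_even_bits R; have mO := @measurable_odd_bits R.
have mO2 : measurable_fun setT (fun wu : R * R => odd_bits wu.2).
  exact: (measurableT_comp mO measurable_snd).
have mq : measurable_fun setT (fun wu : R * R => half wu.1 (even_bits wu.2)).
  apply: (measurableT_comp measurable_half (measurable_fun_pair measurable_fst _)).
  exact: (measurableT_comp mE measurable_snd).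
apply: measurable_fun_pair; apply: measurable_fun_pair => //.
- exact: (measurableT_comp mE mO2).
- exact: measurable_funB.
- exact: (measurableT_comp mO mO2).
Qed.

Lemma product_bits (m : probability R R) (S : set (R * R)) V : measurable S -> measurable V ->
  (m \x U) [set wu | S (wu.1, even_bits wu.2) /\ V (odd_bits wu.2)] = (m \x U) S * U V.
Proof.
move=> mS mV; have mE := @measurable_even_bits R.
rewrite [LHS]/product_measure1 [in RHS]/product_measure1 -ge0_integralZr//; last first.
  exact: measurable_fun_xsection.
apply: eq_integral => w _ /=.
rewrite -(even_odd_bits_independent UE)//; last exact: measurable_xsection.
congr (U _); apply/seteqP; split => u; rewrite /xsection /= !inE//.
Qed.

(** The increment is split by [half_law], and the three uniform variables used
    are independent; the passage from rectangles to arbitrary sets is made in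
    each of the two states separately. *)
Lemma split_law C1 C2 : measurable C1 -> measurable C2 ->
  (G (a + a)%R \x U) (split_state @^-1` (C1 `*` C2)) = (G a \x U) C1 * (G a \x U) C2.
Proof.
move=> mC1 mC2.
pose m := image_measure (G (a + a)%R \x U) measurable_split_state.
have rect A1 V1 A2 V2 : measurable A1 -> measurable V1 -> measurable A2 -> measurable V2 ->
    m ((A1 `*` V1) `*` (A2 `*` V2)) = (G a \x U) (A1 `*` V1) * (G a \x U) (A2 `*` V2).
  move=> mA1 mV1 mA2 mV2.
  pose S : set (R * R) := [set wv | A1 (half wv.1 wv.2) /\ A2 (wv.1 - half wv.1 wv.2)%R].
  pose V : set R := [set u | V1 (even_bits u) /\ V2 (odd_bits u)].
  have mS : measurable S.
    have mB' : measurable_fun setT (fun wz : R * R => (wz.1 - half wz.1 wz.2)%R).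
      exact: (measurable_funB measurable_fst measurable_half).
    apply: measurableI; first by rewrite -[X in measurable X]setTI; exact: measurable_half.
    by rewrite -[X in measurable X]setTI; exact: mB'.
  have mV : measurable V.
    apply: measurableI; rewrite -[X in measurable X]setTI.
      exact: (@measurable_even_bits R).
    exact: (@measurable_odd_bits R).
  transitivity ((G (a + a)%R \x U) S * U V).
    rewrite -product_bits//; congr (product_measure1 _ _ _); apply/seteqP.
    by split => wu /=; rewrite /S /V /=; tauto.
  rewrite half_law// !product_measure1E// (even_odd_bits_independent UE)//.
  by rewrite muleACA.
have mE A V : measurable A -> measurable V -> measurable (setT `*` (A `*` V) : set ((R * R) * (R * R))).
  by move=> mA mV; apply: measurableX => //; exact: measurableX.
have mfin S : measurable S -> m S < +oo.
  move=> mS; apply: (@le_lt_trans _ _ (m setT)).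
    by apply: le_measure; rewrite ?inE.
  by rewrite image_measureE preimage_setT [ltLHS](product_probability_setT (G (a + a)%R) U) ltry.
have nfin S : measurable S -> (G a \x U) S \is a fin_num.
  move=> mS; rewrite ge0_fin_numE//; apply: (@le_lt_trans _ _ ((G a \x U) setT)).
    by apply: le_measure; rewrite ?inE.
  by rewrite product_probability_setT ltry.
have rect2 A2 V2 : measurable A2 -> measurable V2 ->
    m (C1 `*` (A2 `*` V2)) = (G a \x U) C1 * (G a \x U) (A2 `*` V2).
  move=> mA2 mV2.
  have mAV : measurable (A2 `*` V2) by exact: measurableX.
  have XE C : (C `*` (A2 `*` V2) : set ((R * R) * (R * R))) =
      (setT `*` (A2 `*` V2)) `&` fst @^-1` C.
    by apply/seteqP; split => -[x y] /=; tauto.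
  rewrite XE; apply: (@extend_rectangles _ _ _ _ _ _ R m (G a \x U)) => //.
  - exact: mE.
  - exact: nfin.
  - by apply: mfin; exact: mE.
  - by move=> A B mA mB; rewrite -XE; exact: rect.
have XE C : (C1 `*` C : set ((R * R) * (R * R))) = (C1 `*` setT) `&` snd @^-1` C.
  by apply/seteqP; split => -[x y] /=; tauto.
have mC1T : measurable (C1 `*` setT : set ((R * R) * (R * R))) by exact: measurableX.
rewrite -[LHS]/(m (C1 `*` C2)) XE muleC.
apply: (@extend_rectangles _ _ _ _ _ _ R m (G a \x U)) => //.
- exact: nfin.
- exact: mfin.
- by move=> A B mA mB; rewrite -XE rect2// muleC.
Qed.

End halving.

Section tree.

Definition base_density (wz : R * R) : \bar R := f 1 wz.2.

Hypothesis ftot : forall h, (0 < h)%R -> \int[lebesgue_measure]_x f h x = 1.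

Let R01 : (0 < 1 :> R)%R. Proof. exact: ltr01. Qed.

Let measurable_base_density : measurable_fun setT base_density.
Proof. exact: (measurableT_comp (mf R01) measurable_snd). Qed.

Let base_density_ge0 wz : 0 <= base_density wz. Proof. exact: f0. Qed.

Let base_density_neg w z : (z <= 0)%R -> base_density (w, z) = 0.
Proof. by move=> z0; exact: fneg. Qed.

(** The increment over an interval of unit length, with its driving variable. *)
Definition base (u : R) : R * R :=
  (quantile base_density 0 (even_bits u), odd_bits u).

Lemma measurable_base : measurable_fun setT base.
Proof.
apply: measurable_fun_pair; last exact: measurable_odd_bits.
apply: (measurableT_comp _ (@measurable_even_bits R)).
exact: (measurable_quantile_at measurable_base_density base_density_ge0 base_density_neg).
Qed.

Lemma base_law C : measurable C -> U (base @^-1` C) = (G 1%R \x U) C.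
Proof.
move=> mC.
have H := @eq_measure_prod _ _ _ _ R (image_measure U measurable_base) (G 1%R \x U).
apply: H => //; last by apply: probability_lty; rewrite preimage_setT.
move=> A B mA mB.
transitivity (G 1%R A * U B); last exact/esym/product_measure1E.
rewrite image_measureE.
have -> : base @^-1` (A `*` B) = (@even_bits R) @^-1` (quantile base_density 0 @^-1` A) `&`
   (@odd_bits R) @^-1` B by apply/seteqP; split.
have mq : measurable_fun setT (quantile base_density 0%R).
  exact: (measurable_quantile_at measurable_base_density base_density_ge0 base_density_neg).
transitivity (U (quantile base_density 0%R @^-1` A) * U B).
  apply: (even_odd_bits_independent UE) => //.
  by rewrite -[X in measurable X]setTI; exact: mq.
congr (_ * _).
have mass1 : kernel_mass base_density 0 setT = 1 by exact: ftot.
rewrite (quantile_law UE measurable_base_density base_density_ge0 base_density_neg)//.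
  by rewrite mass1 /= invr1 mul1e GE.
by rewrite /proper_mass mass1 lte01 ltry.
Qed.

(** The digits of odd rank of what remains after [j] extractions: an infinite
    sequence of independent uniform variables. *)
Definition seed (j : nat) (u : R) : R := odd_bits (iter j (@even_bits R) u).

Lemma measurable_seed j : measurable_fun setT (seed j).
Proof.
apply: (measurableT_comp (@measurable_odd_bits R)).
elim: j => [|j IH]; first exact: measurable_id.
exact: (measurableT_comp (@measurable_even_bits R) IH).
Qed.

Definition mesh (n : nat) : R := (2^-1 ^+ n)%R.

Lemma mesh_gt0 n : (0 < mesh n)%R.
Proof. by rewrite exprn_gt0// invr_gt0. Qed.

Lemma mesh_half n : mesh n = (mesh n.+1 + mesh n.+1)%R.
Proof. by rewrite /mesh exprS; lra. Qed.

(** The increment over the interval from [j 2^-n] to [(j + 1) 2^-n] in its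
    first component: intervals of length 1 carry fresh states, and the halves
    of an interval carry the two states split from its own. *)
Fixpoint state (n j : nat) (u : R) : R * R :=
  if n is n'.+1 then
    let s := split_state (mesh n) (state n' j./2 u) in if odd j then s.2 else s.1
  else base (seed j u).

Lemma measurable_state n j : measurable_fun setT (state n j).
Proof.
elim: n j => [|n IH] j.
  exact: (measurableT_comp measurable_base (measurable_seed j)).
have ms : measurable_fun setT (fun u => split_state (mesh n.+1) (state n j./2 u)).
  exact: (measurableT_comp (measurable_split_state (mesh_gt0 n.+1)) (IH _)).
rewrite /=; case: (odd j); first exact: (measurableT_comp measurable_snd ms).
exact: (measurableT_comp measurable_fst ms).
Qed.

Lemma iid_of_double (K : nat) d (T : measurableType d) (mu : {measure set T -> \bar R})
  (Z : nat -> R -> T) : mu setT = 1 ->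
  (forall C : nat -> set T, (forall j, measurable (C j)) ->
    U (\bigcap_(j in [set j | (j < K.*2)%N]) Z j @^-1` C j) = \prod_(j < K.*2) mu (C j)) ->
  forall C : nat -> set T, (forall j, measurable (C j)) ->
    U (\bigcap_(j in [set j | (j < K)%N]) Z j @^-1` C j) = \prod_(j < K) mu (C j).
Proof.
move=> mu1 H C mC; pose C' j := if (j < K)%N then C j else setT.
have := H C' _; rewrite /C'.
rewrite (_ : \bigcap_(j in [set j | (j < K.*2)%N]) _ =
  \bigcap_(j in [set j | (j < K)%N]) Z j @^-1` C j); last first.
  apply/seteqP; split => [u uC j jK|u uC j _ /=].
    by have := uC j; rewrite /= jK; apply; rewrite -addnn ltn_addr.
  by case: ifP => // jK; exact: uC.
move=> ->; last by move=> j; case: ifP.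
have KK : (K <= K.*2)%N by rewrite -addnn leq_addr.
rewrite -[RHS](big_mkord xpredT (fun j => mu (C j))).
rewrite -(big_mkord xpredT (fun j => mu (if (j < K)%N then C j else setT))).
rewrite (big_cat_nat (leq0n K) KK)//= [X in _ * X]big1_seq ?mule1.
  by apply: eq_big_nat => j /andP[_ ->].
by move=> j /andP[_]; rewrite mem_index_iota => /andP[Kj _]; rewrite ltnNge Kj.
Qed.

(** At level [0] the states come from independent seeds. To pass from one
    level to the next, [split_law] turns a product of [K] laws into a product
    of [2 K] laws. *)
Lemma state_law n K (C : nat -> set (R * R)) : (forall j, measurable (C j)) ->
  U (\bigcap_(j in [set j | (j < K)%N]) state n j @^-1` C j) =
  \prod_(j < K) (G (mesh n) \x U) (C j).
Proof.
have bigcapS (T : Type) (k : nat) (S : nat -> set T) : \bigcap_(j in [set j | (j < k.+1)%N]) S j =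
    S 0%N `&` \bigcap_(j in [set j | (j < k)%N]) S j.+1.
  apply/seteqP; split => [u uS|u [u0 uS] [|j]//].
    by split; [exact: uS|move=> j jk; exact: uS].
  by move=> jk; exact: uS.
elim: n K C => [|n IH] K C mC.
  rewrite /mesh expr0.
  have -> : \prod_(j < K) (G 1%R \x U) (C j) = \prod_(j < K) U (base @^-1` C j).
    by apply: eq_bigr => j _; rewrite base_law.
  have mbC j : measurable (base @^-1` C j).
    by rewrite -[X in measurable X]setTI; exact: measurable_base.
  elim: K C mC mbC => [|K IHK] C mC mbC.
    rewrite big_ord0 (_ : \bigcap_(j in _) _ = setT) ?[U setT]probability_setT//.
    by apply/seteqP; split => // u _ j.
  rewrite big_ord_recl bigcapS muleC.
  rewrite -[X in _ = X * _](IHK (fun j => C j.+1))//.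
  rewrite -(even_odd_bits_independent UE)//.
    congr (U _); rewrite setIC; congr (_ `&` _).
    apply/seteqP; split => u uC j jK; have := uC j jK; rewrite /= /seed.
      by rewrite iterSr.
    by rewrite iterSr.
  apply: bigcap_measurableType => j _.
  by rewrite -[X in measurable X]setTI; apply: (measurable_state 0 j).
apply: (@iid_of_double _ _ _ (G (mesh n.+1) \x U)); last exact: mC.
  exact: product_probability_setT.
move=> {mC}C mC.
transitivity (U (\bigcap_(j in [set j | (j < K)%N]) state n j @^-1`
   (split_state (mesh n.+1) @^-1` (C j.*2 `*` C j.*2.+1)))).
  congr (U _); apply/seteqP; split => u uC j /= jK.
    split.
      have := uC j.*2; rewrite /= odd_double doubleK; apply.
      by rewrite ltn_double.
    have := uC j.*2.+1; rewrite /= odd_double uphalf_double; apply.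
    by rewrite -doubleS leq_double.
  have jK2 : (j./2 < K)%N by rewrite ltn_half_double.
  have [] := uC _ jK2; have := odd_double_half j.
  by case: (odd j) => /= e; rewrite ?add1n ?add0n in e; rewrite e.
rewrite IH; last first.
  move=> j; rewrite -[X in measurable X]setTI; apply: measurable_split_state => //.
    exact: mesh_gt0.
  exact: measurableX.
transitivity (\prod_(j < K) ((G (mesh n.+1) \x U) (C j.*2) * (G (mesh n.+1) \x U) (C j.*2.+1))).
  by apply: eq_bigr => j _; rewrite [in LHS]mesh_half split_law//; exact: mesh_gt0.
elim: (K) => [|k IHk]; first by rewrite !big_ord0.
by rewrite big_ord_recr/= IHk doubleS !big_ord_recr/= muleA.
Qed.

Definition inc n j u : R := (state n j u).1.

Lemma measurable_inc n j : measurable_fun setT (inc n j).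
Proof. exact: (measurableT_comp measurable_fst (measurable_state n j)). Qed.

Lemma inc_law n K (B : nat -> set R) : (forall j, measurable (B j)) ->
  U (\bigcap_(j in [set j | (j < K)%N]) inc n j @^-1` B j) =
  \prod_(j < K) G (mesh n) (B j).
Proof.
move=> mB; have := @state_law n K (fun j => B j `*` setT).
rewrite (_ : \bigcap_(j in _) _ = \bigcap_(j in [set j | (j < K)%N]) inc n j @^-1` B j).
  move=> ->; last by move=> j; exact: measurableX.
  apply: eq_bigr => j _; rewrite product_measure1E//.
  by rewrite [X in _ * X]probability_setT mule1.
by apply: eq_bigcapr => j _; apply/seteqP; split => // u [].
Qed.

Lemma inc_ge0 n j u : (0 <= inc n j u)%R.
Proof.
rewrite /inc; elim: n j => [|n IH] j.
  exact: (quantile_ge0 measurable_base_density base_density_ge0 base_density_neg).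
rewrite /=; case: (odd j) => /=.
  by rewrite subr_ge0; apply: half_le => //; exact: mesh_gt0.
by apply: half_ge0; exact: mesh_gt0.
Qed.

(** The right half is defined as the remainder, so increments add up exactly,
    without an exceptional null set. *)
Lemma inc_split n j u : inc n j u = (inc n.+1 j.*2 u + inc n.+1 j.*2.+1 u)%R.
Proof.
by rewrite /inc /= odd_double/= doubleK uphalf_double addrC subrK.
Qed.

(** Translation invariance of Lebesgue measure and Fubini's theorem show that
    the sum has the convolution of [f a] and [f b] as its density, which is [f
    (a + b)]. *)
Lemma convolution_law d (Omega : measurableType d) (P : probability Omega R)
    (X Y : Omega -> R) a b B : (0 < a)%R -> (0 < b)%R ->
  measurable_fun setT X -> measurable_fun setT Y ->
  (forall A C, measurable A -> measurable C ->
    P (Y @^-1` A `&` X @^-1` C) = G b A * G a C) -> measurable B ->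
  P [set w | B (Y w + X w)%R] = G (a + b)%R B.
Proof.
move=> a_gt0 b_gt0 mX mY lawXY mB.
have mYX : measurable_fun setT (fun w => (Y w, X w)) by exact: measurable_fun_pair.
pose S : set (R * R) := [set yx | B (yx.1 + yx.2)%R].
have mS : measurable S.
  have mD : measurable_fun setT (fun yx : R * R => (yx.1 + yx.2)%R) by exact: measurable_funD.
  by rewrite -[X in measurable X]setTI; exact: mD.
transitivity ((G b \x G a) S).
  have H := @eq_measure_prod _ _ _ _ R (image_measure P mYX) (G b \x G a).
  apply: H => //; last by apply: probability_lty; rewrite preimage_setT.
  move=> A C mA mC; transitivity (G b A * G a C); last exact/esym/product_measure1E.
  exact: lawXY.
have mind : measurable_fun setT (fun x : R => (\1_B x)%:E : \bar R).
  by apply/measurable_EFinP; exact: measurable_indic.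
have mK : measurable_fun setT (fun xy : R * R => (\1_B xy.1)%:E * f a (xy.1 - xy.2)%R).
  apply: emeasurable_funM; first exact: (measurableT_comp mind measurable_fst).
  by apply: (measurableT_comp (mf a_gt0)); exact: measurable_funB.
transitivity (\int[G b]_y \int[lebesgue_measure]_x ((\1_B x)%:E * f a (x - y)%R)).
  rewrite /product_measure1; apply: eq_integral => y _ /=.
  have mg : measurable_fun setT (fun x : R => (\1_B x)%:E * f a (x - y)%R).
    apply: emeasurable_funM => //.
    by apply: (measurableT_comp (mf a_gt0)); exact: measurable_funB.
  rewrite -(ge0_integral_shift y)//; last by move=> x; rewrite mule_ge0 ?lee_fin ?f0.
  rewrite GE//; last exact: measurable_xsection.
  rewrite [LHS]integral_mkcond; apply: eq_integral => x _.
  rewrite epatch_indic addrK muleC; congr (_%:E * _).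
  by rewrite !indicE; congr (_%:R); congr nat_of_bool; apply/idP/idP;
    rewrite /xsection !inE /S /= ?inE /= addrC.
rewrite -(@fubini_lebesgue _ _ _ (G b) (fun xy : R * R =>
   (\1_B xy.1)%:E * f a (xy.1 - xy.2)%R))//; last first.
  by move=> xy; rewrite mule_ge0 ?f0// lee_fin.
rewrite GE//; last by rewrite addr_gt0.
rewrite [RHS]integral_mkcond; apply: eq_integral => x _ /=.
have mfx : measurable_fun setT (fun y : R => f a (x - y)%R).
  by apply: (measurableT_comp (mf a_gt0)); exact: measurable_funB.
rewrite ge0_integralZl//; last by move=> y _; exact: f0.
rewrite epatch_indic muleC; congr (_ * _).
rewrite integral_law//; last by move=> y; exact: f0.
exact: fCK.
Qed.

Hypothesis G0E : forall B : set R, measurable B -> G 0%R B = (\1_B (0%R : R))%:E.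

Lemma inc_sum_law n a b B : (a <= b)%N -> measurable B ->
  U [set u | B (\sum_(a <= i < b) inc n i u)%R] = G ((b - a)%:R * mesh n)%R B.
Proof.
have iid := @inc_law n.
have minc := measurable_inc n.
have empty a' b' C : (b' <= a')%N -> measurable C ->
    U [set u | C (\sum_(a' <= i < b') inc n i u)%R] = G ((b' - a')%:R * mesh n)%R C.
  move=> ba mC; rewrite (eqP ba) mul0r G0E// indicE.
  under eq_set do rewrite big_geq//.
  have [C0|C0] := boolP (0%R \in C).
    rewrite (_ : [set _ | _] = setT) ?[U setT]probability_setT//.
    by apply/seteqP; split => // u _ /=; exact: set_mem.
  rewrite (_ : [set _ | _] = set0) ?measure0//.
  by apply/seteqP; split => // u /=; move: C0; rewrite notin_setE.
elim: b B => [|b IH] B; first by move=> a0 mB; exact: empty.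
rewrite leq_eqVlt => /predU1P[<- mB|]; first exact: empty.
rewrite ltnS => ab mB.
have single C : measurable C -> U [set u | C (\sum_(b <= i < b.+1) inc n i u)%R] = G (mesh n) C.
  move=> mC; under eq_set do rewrite big_nat1.
  exact: (iid_marginal iid).
have [->|anb] := eqVneq a b; first by rewrite subSnn mul1r single.
have ab' : (0 < b - a)%N by rewrite subn_gt0 ltn_neqAle anb.
transitivity (U [set u | B (\sum_(a <= i < b) inc n i u + \sum_(b <= i < b.+1) inc n i u)%R]).
  by congr (U _); apply/seteqP; split => u /=; rewrite -big_cat_nat//.
rewrite subSn// -(natr1 (b - a)) mulrDl mul1r addrC.
apply: convolution_law => //.
- exact: mesh_gt0.
- by rewrite mulr_gt0 ?ltr0n ?mesh_gt0.
- exact: measurable_sum_nat.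
- exact: measurable_sum_nat.
- move=> A C mA mC.
  by rewrite -IH// -single// -(adjacent_blocks_independent minc iid)// ab leqnSn.
Qed.

(** The index after that of the cell containing [t], so that the sum below
    covers a point strictly to the right of [t]. *)
Definition cell n (t : R) : nat := (Num.truncn (t / mesh n)%R).+1.

Definition approx n t u : R := (\sum_(0 <= i < cell n t) inc n i u)%R.

Lemma le_cell n s t : (s <= t)%R -> (cell n s <= cell n t)%N.
Proof.
move=> st; rewrite ltnS; apply: le_truncn.
by rewrite ler_pM2r// invr_gt0 mesh_gt0.
Qed.

Lemma cell_refine n t : (cell n.+1 t <= (cell n t).*2)%N.
Proof.
rewrite doubleS ltnS truncn_le_nat.
have tE : (t / mesh n.+1 = 2 * (t / mesh n))%R.
  have := mesh_gt0 n.+1; rewrite (mesh_half n) => m0; field; lra.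
by rewrite tE -doubleS -muln2 mulnC natrM ltr_pM2l// truncnS_gt.
Qed.

Lemma approx_double n N u : (\sum_(0 <= i < N) inc n i u = \sum_(0 <= i < N.*2) inc n.+1 i u)%R.
Proof.
elim: N => [|N IH]; first by rewrite !big_geq.
by rewrite doubleS !big_nat_recr//= IH inc_split addrA.
Qed.

(** Refining the mesh can only bring the covered end point closer to [t]. *)
Lemma approx_nonincreasing t u : nonincreasing_seq (fun n => approx n t u).
Proof.
apply/nonincreasing_seqP => n; rewrite /approx [leRHS]approx_double.
rewrite (big_cat_nat (leq0n _) (cell_refine n t))/= lerDl.
by apply: sumr_ge0 => i _; exact: inc_ge0.
Qed.

Lemma approx_ge0 n t u : (0 <= approx n t u)%R.
Proof. by apply: sumr_ge0 => i _; exact: inc_ge0. Qed.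

Lemma le_approx n s t u : (s <= t)%R -> (approx n s u <= approx n t u)%R.
Proof.
move=> st; rewrite /approx (big_cat_nat (leq0n _) (le_cell n st))/= lerDl.
by apply: sumr_ge0 => i _; exact: inc_ge0.
Qed.

Lemma measurable_approx n t : measurable_fun setT (approx n t).
Proof. exact: (measurable_sum_nat (measurable_inc n)). Qed.

(** Covering more than [[0, t]] makes the limit decreasing, and a decreasing
    limit of functions that are locally constant to the right of [t] is
    right-continuous. *)
Definition subordinator (t u : R) : R := limn (fun n => approx n t u).

Lemma approx_cvg t u : approx n t u @[n --> \oo] --> subordinator t u.
Proof.
apply: nonincreasing_is_cvgn; first exact: approx_nonincreasing.
by exists 0%R => _ [n _ <-]; exact: approx_ge0.
Qed.

Lemma subordinator_le n t u : (subordinator t u <= approx n t u)%R.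
Proof.
have c := @approx_cvg t u.
have c' : limn (fun n => approx n t u) = subordinator t u by [].
rewrite -c'; apply: limr_le; first exact: cvgP c.
by exists n => // k /= nk; exact: approx_nonincreasing.
Qed.

Lemma subordinator_ge0 t u : (0 <= subordinator t u)%R.
Proof.
have c := @approx_cvg t u; apply: limr_ge; first exact: cvgP c.
by apply: nearW => n; exact: approx_ge0.
Qed.

Lemma le_subordinator s t u : (s <= t)%R -> (subordinator s u <= subordinator t u)%R.
Proof.
move=> st; have cs := @approx_cvg s u; have ct := @approx_cvg t u.
apply: ler_lim; [exact: cvgP cs|exact: cvgP ct|].
by apply: nearW => n; exact: le_approx.
Qed.

Lemma measurable_subordinator t : measurable_fun setT (subordinator t).
Proof.
apply: (@measurable_fun_cvg _ _ _ setT (fun n => approx n t)) => [n|u _].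
  exact: measurable_approx.
exact: approx_cvg.
Qed.

(** To the right of [t] the [n]th approximation is constant for a while and
    dominates the process, whose paths are monotone; on the left, monotone
    paths have limits. *)
Lemma subordinator_cadlag u : cadlag [set t | (0 <= t)%R] (subordinator ^~ u).
Proof.
move=> t /= t0; split.
  apply/cvgrPdist_lt => e e0.
  have ce := @approx_cvg t u.
  have [n _ nP] : \forall n \near \oo, (approx n t u < subordinator t u + e)%R.
    by apply: cvgr_lt ce _ _; rewrite ltrDl.
  have {}nP := nP n (leqnn n).
  (* the right end of the cell of [t] *)
  pose r := ((cell n t)%:R * mesh n)%R.
  have tr : (t < r)%R by rewrite -ltr_pdivrMr ?mesh_gt0// truncnS_gt.
  have cr s : (t <= s)%R -> (s < r)%R -> cell n s = cell n t.
    move=> ts sr; congr S; apply: truncn_def.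
    rewrite ltr_pdivrMr ?mesh_gt0// sr andbT.
    apply: (@le_trans _ _ (t / mesh n)%R); last by rewrite ler_pM2r// invr_gt0 mesh_gt0.
    by rewrite truncn_le divr_ge0// ltW// mesh_gt0.
  exists (r - t)%R; first by rewrite /= subr_gt0.
  move=> s /=; rewrite /ball/= => sr ts _.
  have sr' : (s < r)%R by move: sr; rewrite ltr0_norm ?subr_lt0//; lra.
  rewrite distrC ger0_norm ?subr_ge0; last by apply: le_subordinator; exact: ltW.
  rewrite ltrBlDl; apply: le_lt_trans (subordinator_le n s u) _.
  by rewrite /approx cr// ltW.
have [t_gt0|t_le0] := ltP 0%R t; last first.
  exists 0%R => A _; exists 1%R => // s _ /= st s0.
  by have := lt_le_trans st (le_trans t_le0 s0); rewrite ltxx.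
pose S := [set subordinator s u | s in [set s | (0 <= s < t)%R]].
have S0 : S !=set0 by exists (subordinator 0%R u), 0%R => //=; rewrite lexx.
have Sub : has_sup S.
  split => //; exists (subordinator t u) => _ [s /andP[_ st] <-].
  by apply: le_subordinator; exact: ltW.
exists (sup S); apply/cvgrPdist_lt => e e0.
have [_ [s0 /= /andP[s00 s0t] <-] s0e] := sup_adherent e0 Sub.
exists (t - s0)%R; first by rewrite /= subr_gt0.
move=> s /=; rewrite /ball/= => st ts sI.
have s0s : (s0 < s)%R by move: st; rewrite gtr0_norm ?subr_gt0//; lra.
have sS : (subordinator s u <= sup S)%R.
  by apply: sup_upper_bound => //; exists s => //=; rewrite ts andbT; lra.
have := le_subordinator u (ltW s0s).
by rewrite ger0_norm ?subr_ge0//; lra.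
Qed.

Hypothesis mean1 : \int[lebesgue_measure]_x (x%:E * f 1 x) < +oo.

Lemma integral_inc n j (k : R -> \bar R) : measurable_fun setT k -> (forall x, 0 <= k x) ->
  \int[U]_u k (inc n j u) = \int[G (mesh n)]_x k x.
Proof.
move=> mk k0; rewrite -(ge0_integral_image U (measurable_inc n j))//.
by apply: eq_measure_integral => A mA _; exact: (iid_marginal (@inc_law n)).
Qed.

(** The value at [0] is below the first increment of every mesh, whose mean is
    halved at each refinement. *)
Lemma subordinator_start : {ae U, forall u, subordinator 0%R u = 0%R}.
Proof.
have mEinc n j : measurable_fun setT (fun u => (inc n j u)%:E).
  by apply/measurable_EFinP; exact: measurable_inc.
have inc0 n j u : 0 <= (inc n j u)%:E by rewrite lee_fin inc_ge0.
pose c n := \int[U]_u (inc n 0 u)%:E.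
have mM : measurable_fun setT (fun x : R => (Num.max 0 x)%:E : \bar R).
  by apply/measurable_EFinP; exact: measurable_maxr.
have M0 (x : R) : 0 <= ((Num.max 0 x)%:E : \bar R) by rewrite lee_fin le_max lexx.
have cE n j : \int[U]_u (inc n j u)%:E = c n.
  (* integrals over a law are for functions that are nonnegative everywhere *)
  rewrite /c; transitivity (\int[U]_u (Num.max 0 (inc n j u))%:E).
    by apply: eq_integral => u _; rewrite max_r// inc_ge0.
  rewrite (integral_inc n j mM M0) -(integral_inc n 0 mM M0).
  by apply: eq_integral => u _; rewrite max_r// inc_ge0.
have c0oo : c 0%N < +oo.
  apply: le_lt_trans mean1; rewrite /c.
  have -> : \int[U]_u (inc 0 0 u)%:E = \int[U]_u (Num.max 0 (inc 0 0 u))%:E.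
    by apply: eq_integral => u _; rewrite max_r// inc_ge0.
  rewrite (integral_inc 0 0 mM M0) /mesh expr0 integral_law//.
  rewrite le_eqVlt; apply/orP; left; apply/eqP; apply: eq_integral => x _.
  have [x0|x0] := leP x 0%R; first by rewrite fneg// ?mule0.
  by [].
have c_ge0 n : 0 <= c n by apply: integral_ge0.
have cS n : c n = c n.+1 + c n.+1.
  rewrite -{1}(cE n.+1 0%N) -(cE n.+1 1%N) -ge0_integralD//.
  by apply: eq_integral => u _; rewrite (inc_split n 0 u) EFinD.
have cfin n : c n \is a fin_num.
  elim: n => [|n IH]; first by rewrite ge0_fin_numE.
  by move: IH; rewrite cS fin_numD => /andP[].
have cn n : c n = (2^-1 ^+ n)%:E * c 0%N.
  elim: n => [|n IH]; first by rewrite expr0 mul1e.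
  have [a aE] : exists a, c 0%N = a%:E by exists (fine (c 0%N)); rewrite fineK.
  have [b bE] : exists b, c n.+1 = b%:E by exists (fine (c n.+1)); rewrite fineK.
  have ab : (2^-1 ^+ n * a = b + b)%R.
    by apply: EFin_inj; rewrite EFinM -aE -IH cS bE -EFinD.
  rewrite bE aE -EFinM; congr EFin.
  by rewrite exprS -mulrA ab; lra.
have mX : measurable_fun setT (fun u => (subordinator 0 u)%:E).
  by apply/measurable_EFinP; exact: measurable_subordinator.
have X0 u : 0 <= (subordinator 0 u)%:E by rewrite lee_fin subordinator_ge0.
have cell0 n : cell n 0 = 1%N by rewrite /cell mul0r truncn0.
have Xc n : \int[U]_u (subordinator 0 u)%:E <= c n.
  apply: ge0_le_integral => // u _; rewrite lee_fin.
  by have := subordinator_le n 0 u; rewrite /approx cell0 big_nat1.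
have int0 : \int[U]_u (subordinator 0 u)%:E = 0.
  apply/le_anti/andP; split; last exact: integral_ge0.
  have lim0 : c n @[n --> \oo] --> 0.
    rewrite (_ : c = fun n => (2^-1 ^+ n)%:E * c 0%N); last exact/funext.
    rewrite -(mul0e (c 0%N)); apply: cvgeZr => //; apply: cvg_EFin; first exact: nearW.
    by apply: cvg_expr; rewrite ger0_norm ?invr_ge0// invf_lt1// ltr1n.
  rewrite -(cvg_lim _ lim0)//; apply: lime_ge; first exact: cvgP lim0.
  exact: nearW.
have := (@ae_eq_integral_abs _ _ _ U setT measurableT _ mX).1.
rewrite (eq_integral (fun u => (subordinator 0 u)%:E)); last first.
  by move=> u _; rewrite gee0_abs.
move=> /(_ int0); apply: filterS => u /(_ I) /=.
by move=> [].
Qed.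

Hypothesis contG : forall (a : nat -> R) (h x : R), (0 < h)%R ->
  a n @[n --> \oo] --> h -> G (a n) `]-oo, x]%classic @[n --> \oo] --> G h `]-oo, x]%classic.

Lemma mesh_cvg0 : mesh n @[n --> \oo] --> (0 : R)%R.
Proof. by apply: cvg_expr; rewrite ger0_norm ?invr_ge0// invf_lt1// ltr1n. Qed.

Lemma cell_cvg t : (0 <= t)%R -> ((cell n t)%:R * mesh n)%R @[n --> \oo] --> t.
Proof.
move=> t0; apply: (@squeeze_cvgr _ _ _ _ (cst t) (fun n => t + mesh n)%R).
- apply: nearW => n; have tm : (0 <= t / mesh n)%R by rewrite divr_ge0// ltW// mesh_gt0.
  have /andP[t1 t2] := truncn_itv tm; apply/andP; split.
    by rewrite -ler_pdivrMr ?mesh_gt0// ltW.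
  by rewrite /cell -natr1 mulrDl mul1r lerD2r -ler_pdivlMr ?mesh_gt0.
- exact: cvg_cst.
- by rewrite -[X in _ --> X](addr0 t); apply: cvgD; [exact: cvg_cst|exact: mesh_cvg0].
Qed.

Lemma approx_increment n s t u : (s <= t)%R ->
  (approx n t u - approx n s u = \sum_(cell n s <= i < cell n t) inc n i u)%R.
Proof.
move=> st; rewrite /approx (big_cat_nat (leq0n _) (le_cell n st))/=.
by rewrite [LHS]addrC addKr.
Qed.

Lemma cdf_right_continuous (m : probability R R) x :
  m `]-oo, (x + n.+1%:R^-1)%R]%classic @[n --> \oo] --> m `]-oo, x]%classic.
Proof.
rewrite (_ : `]-oo, x]%classic = \bigcap_n `]-oo, (x + n.+1%:R^-1)%R]%classic).
  apply: nonincreasing_cvg_mu => //.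
  - exact: probability_lty.
  - by apply: bigcapT_measurable => n; exact: measurable_itv.
  - move=> n k nk; apply/subsetPset => y /=; rewrite !in_itv/= => /le_trans; apply.
    by rewrite lerD2l lef_pV2 ?posrE// ler_nat.
apply/seteqP; split => y /=.
  by rewrite in_itv/= => xy n _ /=; rewrite in_itv/= (le_trans xy)// lerDl.
move=> yn; rewrite in_itv/=; apply/ler_addgt0Pr => e e0.
have [n _ ne] : \forall n \near \oo, (harmonic n < e)%R.
  by apply: cvgr_lt; [exact: cvg_harmonic|].
have := yn n I; rewrite /= in_itv/= => /le_trans; apply.
by rewrite lerD2l; exact/ltW/(ne n (leqnn n)).
Qed.

Lemma cvg_prod_fin k (a : nat -> nat -> \bar R) (b : nat -> \bar R) :
  (forall j, b j \is a fin_num) -> (forall j, (j < k)%N -> a n j @[n --> \oo] --> b j) ->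
  \prod_(j < k) a n j @[n --> \oo] --> \prod_(j < k) b j.
Proof.
move=> bfin ab; elim: k ab => [|k IH] ab.
  by under eq_fun do rewrite big_ord0; rewrite big_ord0; exact: cvg_cst.
under eq_fun do rewrite big_ord_recr/=; rewrite big_ord_recr/=.
apply: cvgeM; last by exact: ab.
  by rewrite mule_def_fin// prode_fin_num.
by apply: IH => j jk; apply: ab; exact: ltnW.
Qed.

(** Increments of the approximations are sums over disjoint blocks, with law
    [G] at times that tend to [t (j+1) - t j]. Continuity of [G] in time on
    half-lines gives the limit; where [t j = t (j+1)] the blocks are empty. *)
Lemma increments_rays k (t x : nat -> R) : (0 <= t 0%N)%R ->
  (forall j, (j < k)%N -> (t j <= t j.+1)%R) ->
  U (\bigcap_(j in [set j | (j < k)%N])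
       [set u | (subordinator (t j.+1) u - subordinator (t j) u <= x j)%R]) =
  \prod_(j < k) G (t j.+1 - t j)%R `]-oo, x j]%classic.
Proof.
move=> t00 tnd.
have t_ge0 j : (j <= k)%N -> (0 <= t j)%R.
  elim: j => [//|j IH] jk; apply: le_trans (tnd _ jk); exact/IH/ltnW.
pose l := [seq (j, x j) | j <- iota 0 k].
have mem_l q : q \in l -> (q.1 < k)%N /\ q.2 = x q.1.
  by move=> /mapP[j]; rewrite mem_iota add0n => /andP[_ jk] ->.
have cylE (V : nat -> R -> R) e : cylinder V (rays (shift_rays e l)) =
    \bigcap_(j in [set j | (j < k)%N]) [set u | (V j u <= x j + e)%R].
  rewrite cylinder_raysE; apply/seteqP; split => [u ul j /= jk|u ul _ /mapP[q ql ->]].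
    apply: (ul (j, x j + e)%R); rewrite /shift_rays -map_comp; apply/mapP.
    by exists j; rewrite ?mem_iota.
  by have [qk ->] := mem_l q ql; exact: ul.
pose W n j u := (approx n (t j.+1) u - approx n (t j) u)%R.
pose W' j u := (subordinator (t j.+1) u - subordinator (t j) u)%R.
pose p e := \prod_(j < k) G (t j.+1 - t j)%R `]-oo, (x j + e)%R]%classic.
have l0 : shift_rays 0 l = l.
  by rewrite /shift_rays -[RHS]map_id; apply: eq_map => -[? ?]; rewrite /= addr0.
have := @cylinder_limit R nat _ _ U W W' l p.
rewrite -[in cylinder W' _]l0 cylE /p.
under eq_bigcapr do rewrite addr0.
move=> ->; last 5 first.
- by move=> n q _; apply: measurable_funB; exact: measurable_approx.
- by move=> q _; apply: measurable_funB; exact: measurable_subordinator.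
- by move=> q u _; apply: cvgB; exact: approx_cvg.
- move=> e e0.
  (* only [t 0], ..., [t k] are ordered, so the blocks stop at [k] *)
  pose N n j := cell n (t (minn j k)).
  have NE n : U (cylinder (W n) (rays (shift_rays e l))) =
      \prod_(j < k) G ((N n j.+1 - N n j)%:R * mesh n)%R `]-oo, (x j + e)%R]%classic.
    have ndN j : (N n j <= N n j.+1)%N.
      apply: le_cell; have [jk|kj] := ltnP j k.
        by rewrite (minn_idPl jk) tnd.
      by rewrite (minn_idPr (leqW kj)).
    have := @blocks_independent R _ _ U (inc n) (G (mesh n)) (measurable_inc n) (@inc_law n)
      k (N n) (fun j => `]-oo, (x j + e)%R]%classic) ndN (fun j => measurable_itv _).
    rewrite cylE => H; transitivity (U (\bigcap_(j in [set j | (j < k)%N])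
       [set w | `]-oo, (x j + e)%R]%classic (\sum_(N n j <= i < N n j.+1) inc n i w)%R])).
      congr (U _); apply: eq_bigcapr => j /= jk; apply/seteqP.
      by split => u /=; rewrite in_itv/= /W approx_increment ?tnd// /N (minn_idPl jk)
        (minn_idPl (ltnW jk)).
    rewrite [LHS]H; apply: eq_bigr => j _; exact: inc_sum_law.
  under eq_fun do rewrite NE.
  apply: (cvg_prod_fin (a := fun n j => G ((N n j.+1 - N n j)%:R * mesh n)%R `]-oo, (x j + e)%R]%classic)
    (b := fun j => G (t j.+1 - t j)%R `]-oo, (x j + e)%R]%classic)).
    by move=> j; exact: fin_num_measure.
  move=> j jk; rewrite /N (minn_idPl jk) (minn_idPl (ltnW jk)).
  have := tnd _ jk; rewrite le_eqVlt => /predU1P[tj|tj].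
    rewrite -tj subrr; under eq_fun do rewrite subnn mul0r; exact: cvg_cst.
  have gap : ((cell n (t j.+1) - cell n (t j))%:R * mesh n)%R @[n --> \oo] --> (t j.+1 - t j)%R.
    under eq_fun do rewrite natrB ?le_cell ?(ltW tj)// mulrBl.
    by apply: cvgB; apply: cell_cvg; apply: t_ge0; rewrite // ltnW.
  have tj0 : (0 < t j.+1 - t j)%R by rewrite subr_gt0.
  exact: contG gap.
- under eq_bigr do rewrite addr0.
  apply: (cvg_prod_fin (a := fun n j => G (t j.+1 - t j)%R `]-oo, (x j + n.+1%:R^-1)%R]%classic)
    (b := fun j => G (t j.+1 - t j)%R `]-oo, x j]%classic)).
    by move=> j; exact: fin_num_measure.
  by move=> j jk; exact: cdf_right_continuous.
by under eq_bigr do rewrite addr0.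
Qed.

Lemma subordinator_increments k (t : nat -> R) (B : nat -> set R) : (0 <= t 0%N)%R ->
  (forall j, (j < k)%N -> (t j <= t j.+1)%R) -> (forall j, measurable (B j)) ->
  U (\bigcap_(j in [set j | (j < k)%N])
       [set u | B j (subordinator (t j.+1) u - subordinator (t j) u)%R]) =
  \prod_(j < k) G (t j.+1 - t j)%R (B j).
Proof.
move=> t00 tnd mB.
apply: (@product_of_rays _ _ _ U k
  (fun j u => subordinator (t j.+1) u - subordinator (t j) u)%R
  (fun j => G (t j.+1 - t j)%R)) => //.
- by move=> j; apply: measurable_funB; exact: measurable_subordinator.
- by move=> x; exact: increments_rays.
Qed.

Lemma subordinator_increment s t B : (0 <= s <= t)%R -> measurable B ->
  U [set u | B (subordinator t u - subordinator s u)%R] = G (t - s)%R B.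
Proof.
move=> /andP[s0 st] mB.
have := @subordinator_increments 1 (fun j => if j is 0%N then s else t) (fun=> B) s0.
rewrite big_ord_recl big_ord0 mule1 => <-//; last by case.
congr (U _); apply/seteqP; split => [u uB [|]//|u uB].
exact: (uB 0%N).
Qed.

Let X0 t u := subordinator t u.

HB.instance Definition _ t := isMeasurableFun.Build _ _ _ _ (X0 t) (measurable_subordinator t).

Definition subordinator_process (t : R) : {RV U >-> R} := X0 t.

(** Both conditions on the increments are instances of their joint law. *)
Lemma subordinator_levy : levy_process subordinator_process.
Proof.
split.
- exact: subordinator_cadlag.
- exact: subordinator_start.
- move=> k t B t0 tnd mB.
  rewrite [LHS](subordinator_increments t0 tnd mB); apply: eq_bigr => j _.
  have t_ge0 i : (i <= k)%N -> (0 <= t i)%R.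
    by elim: i => [//|i IH] ik; apply: le_trans (tnd _ ik); exact/IH/ltnW.
  rewrite -[RHS]/(U [set u | B j (subordinator (t j.+1) u - subordinator (t j) u)%R]).
  by rewrite subordinator_increment// t_ge0 ?tnd// ltnW.
- move=> s t B /andP[s0 st] mB.
  rewrite [LHS]subordinator_increment ?s0// [RHS]subordinator_increment ?lexx ?subr_ge0//.
  by rewrite subr0.
Qed.

(** Almost surely the process starts at [0], so its value at [t] is an
    increment. *)
Lemma subordinator_density t : (0 < t)%R -> has_density (subordinator_process t) (f t).
Proof.
move=> t0; split; [exact: mf|by move=> x; exact: f0|] => B mB.
rewrite -GE// -[in RHS](subr0 t) -subordinator_increment//; last by rewrite lexx ltW.
transitivity (U (subordinator t @^-1` B)); first by [].
apply: ae_eq_measure.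
- by rewrite -[X in measurable X]setTI; exact: measurable_subordinator.
- have mD : measurable_fun setT (fun u => subordinator t u - subordinator 0 u)%R.
    by apply: measurable_funB; exact: measurable_subordinator.
  by rewrite -[X in measurable X]setTI; exact: mD.
- by apply: filterS subordinator_start => u u0 /=; rewrite u0 subr0.
Qed.

End tree.
End splitting.

(** * The gamma semigroup *)

Section gamma_densities.
Context (R : realType).
Local Notation leb := (@lebesgue_measure R).

(** The power [x^(t-1)] is written with the exponential and the logarithm, so
    that its algebra is that of exponents. *)
Definition gamma_weight (t x : R) : R :=
  if (0 < x)%R then expR ((t - 1) * ln x - x) else 0%R.

Lemma gamma_weight_ge0 t x : (0 <= gamma_weight t x)%R.
Proof. by rewrite /gamma_weight; case: ifP => _ //; exact: expR_ge0. Qed.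

Lemma gamma_weight_gt0 t x : (0 < x)%R -> (0 < gamma_weight t x)%R.
Proof. by move=> x0; rewrite /gamma_weight x0 expR_gt0. Qed.

Lemma gamma_weight_neg t x : (x <= 0)%R -> gamma_weight t x = 0%R.
Proof. by move=> x0; rewrite /gamma_weight ltNge x0. Qed.

Lemma measurable_gamma_weight t : measurable_fun setT (gamma_weight t).
Proof.
apply: measurable_fun_ifT => //.
  exact: measurable_fun_ltr.
apply: measurableT_comp => //; apply: measurable_funB => //.
by apply: measurable_funM => //; exact: measurable_ln.
Qed.

Lemma measurable_gamma_weight_EFin t : measurable_fun setT (fun x => (gamma_weight t x)%:E).
Proof. by apply/measurable_EFinP; exact: measurable_gamma_weight. Qed.

(** Euler's Gamma function. *)
Definition gamma_mass t : \bar R := \int[leb]_x (gamma_weight t x)%:E.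

Lemma integral_powR_itv (t e : R) : (0 < t)%R -> (0 < e < 1)%R ->
  \int[leb]_(x in `[e, 1%R]) (t * x `^ (t - 1))%:E <= 1.
Proof.
move=> t0 /andP[e0 e1].
have pos x : x \in `[e, 1%R] -> (0 < x)%R.
  by rewrite in_itv/= => /andP[ex _]; exact: lt_le_trans ex.
have pos' x : x \in `[e, 1%R] -> x \in `]0%R, +oo[ by move=> /pos x0; rewrite in_itv/= x0.
have dpow (p x : R) : x \in `[e, 1%R] -> derivable (fun y : R => y `^ p)%R x 1%R.
  by move=> /pos' xp; exact: derivable_powR.
have cpow (p : R) : {within `[e, 1%R], continuous (fun y : R => y `^ p)%R}.
  by apply: derivable_within_continuous => x; exact: dpow.
have := cpow t; move=> /(continuous_within_itvP _ e1)[_ rpow lpow].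
rewrite (@continuous_FTC2 R (fun x => t * x `^ (t - 1))%R (fun y => y `^ t)%R)//.
- by rewrite powR1 leeBlDr// leeDl// lee_fin powR_ge0.
- move=> x; apply: cvgM; first exact: cvg_cst.
  exact: cpow.
- split => // x xe; apply: dpow; move: xe; rewrite !in_itv/= => /andP[/ltW -> /ltW ->//].
- move=> x xe; rewrite powR_derive1// in_itv/= andbT; apply: pos.
  by move: xe; rewrite !in_itv/= => /andP[/ltW -> /ltW ->].
Qed.

Lemma gamma_weight_le1 t x : (0 < x <= 1)%R -> (gamma_weight t x <= x `^ (t - 1))%R.
Proof.
move=> /andP[x0 x1]; rewrite /gamma_weight x0 /powR gt_eqF// ler_expR.
by rewrite lerBlDr lerDl ltW.
Qed.

(** The bound [ln y <= y - 1] at [y = x / (2 t)] shows that half of the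
    exponential decay absorbs the power. *)
Lemma gamma_weight_ge1 t x : (0 < t)%R -> (1 <= x)%R ->
  (gamma_weight t x <= expR (t * (ln (2 * t) - 1)) * expR (- (2^-1 * x)))%R.
Proof.
move=> t0 x1; have x0 : (0 < x)%R by exact: lt_le_trans x1.
rewrite /gamma_weight x0 -expRD ler_expR.
have lnx : (0 <= ln x)%R by exact: ln_ge0.
have t2 : (0 < 2 * t)%R by rewrite mulr_gt0.
have bound : (ln x <= x / (2 * t) - 1 + ln (2 * t))%R.
  have -> : ln x = (ln (x / (2 * t)) + ln (2 * t))%R.
    by rewrite -lnM ?posrE ?divr_gt0// divfK// gt_eqF.
  rewrite lerD2r; have := @le_ln1Dx R (x / (2 * t) - 1).
  have -> : (1 + (x / (2 * t) - 1) = x / (2 * t))%R by ring.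
  by apply; rewrite -subr_gt0 opprK subrK divr_gt0.
have : (t * ln x <= t * (x / (2 * t) - 1 + ln (2 * t)))%R by rewrite ler_pM2l.
have -> : (t * (x / (2 * t) - 1 + ln (2 * t)) = x / 2 + t * (ln (2 * t) - 1))%R.
  by field; rewrite gt_eqF.
nra.
Qed.

Lemma integral_powR_unit (t : R) : (0 < t)%R ->
  \int[leb]_(x in `]0%R, 1%R]) (t * x `^ (t - 1))%:E <= 1.
Proof.
move=> t0.
have mg : measurable_fun setT (fun x : R => (t * x `^ (t - 1))%:E).
  by apply/measurable_EFinP; apply: measurable_funM => //; exact: measurable_powR.
have g0 (x : R) : 0 <= (t * x `^ (t - 1))%:E.
  by rewrite lee_fin mulr_ge0 ?powR_ge0// ltW.
change (weighted_measure leb mg g0 `]0%R, 1%R]%classic <= 1).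
have cU : weighted_measure leb mg g0 `[n.+2%:R^-1%R, 1%R]%classic @[n --> \oo] -->
    weighted_measure leb mg g0 `]0%R, 1%R]%classic.
  rewrite (_ : `]0%R, 1%R]%classic = \bigcup_n `[n.+2%:R^-1%R, 1%R]%classic).
    apply: nondecreasing_cvg_mu => //.
    - by apply: bigcupT_measurable => n; exact: measurable_itv.
    - move=> n m nm; apply/subsetPset => x /=; rewrite !in_itv/= => /andP[nx ->].
      by rewrite andbT (le_trans _ nx)// lef_pV2 ?posrE// ler_nat.
  apply/seteqP; split => x /=.
    rewrite in_itv/= => /andP[x0 x1].
    have [n _ nx] : \forall n \near \oo, (harmonic n < x)%R.
      by apply: cvgr_lt; [exact: cvg_harmonic|].
    by exists n => //=; rewrite in_itv/= x1 andbT; exact/ltW/(nx n.+1 (leqnSn n)).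
  by move=> [n _] /=; rewrite !in_itv/= => /andP[nx ->]; rewrite andbT (lt_le_trans _ nx).
rewrite -(cvg_lim _ cU)//; apply: lime_le; first exact: cvgP cU.
apply: nearW => n; apply: integral_powR_itv => //.
by rewrite invr_gt0 ltr0n/= invf_lt1// ltr1n.
Qed.

(** Near [0] the weight is below the integrable power [x^(t-1)], and beyond
    [1] it is below a multiple of the density of an exponential law of rate
    [1/2]. *)
Lemma gamma_mass_lty t : (0 < t)%R -> gamma_mass t < +oo.
Proof.
move=> t0; pose K := expR (t * (ln (2 * t) - 1)).
pose g (x : R) := (t^-1 * ((t * x `^ (t - 1)) * \1_(`]0%R, 1%R]%classic) x))%R.
pose k (x : R) := ((2 * K) * exponential_pdf 2^-1 x)%R.
have K0 : (0 <= 2 * K)%R by rewrite mulr_ge0// expR_ge0.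
have ind0 (x : R) : (0 <= \1_(`]0%R, 1%R]%classic) x :> R)%R by rewrite indicE.
have g0 x : (0 <= g x)%R.
  by rewrite mulr_ge0 ?invr_ge0 ?(ltW t0)// mulr_ge0// mulr_ge0 ?powR_ge0// ltW.
have k0 x : (0 <= k x)%R by rewrite mulr_ge0// exponential_pdf_ge0.
have bound x : (gamma_weight t x <= g x + k x)%R.
  have [x0|x0] := leP x 0%R; first by rewrite gamma_weight_neg// addr_ge0.
  have [x1|x1] := leP x 1%R.
    apply: (@le_trans _ _ (g x)); last by rewrite lerDl.
    rewrite /g indicE mem_set ?mulr1; last by rewrite /= in_itv/= x0.
    by rewrite mulrA mulVf ?mul1r ?gt_eqF// gamma_weight_le1// x0.
  apply: (@le_trans _ _ (k x)); last by rewrite lerDr.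
  rewrite /k exponential_pdfE; last by rewrite ltW.
  have -> : (2 * K * (2^-1 * expR (- 2^-1 * x)) = K * expR (- (2^-1 * x)))%R.
    by rewrite mulNr; field.
  by apply: gamma_weight_ge1 => //; exact: ltW.
have mg1 : measurable_fun setT (fun x : R => (t * x `^ (t - 1) * \1_(`]0%R, 1%R]%classic) x)%R).
  apply: measurable_funM; last exact: measurable_indic.
  by apply: measurable_funM => //; exact: measurable_powR.
have mg : measurable_fun setT (EFin \o g).
  by apply/measurable_EFinP; apply: measurable_funM.
have mk : measurable_fun setT (EFin \o k).
  by apply/measurable_EFinP; apply: measurable_funM => //; exact: measurable_exponential_pdf.
apply: (@le_lt_trans _ _ (\int[leb]_x ((g x)%:E + (k x)%:E))).
  apply: ge0_le_integral => //.
  - by move=> x _; rewrite lee_fin gamma_weight_ge0.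
  - exact: measurable_gamma_weight_EFin.
  - exact: emeasurable_funD.
  - by move=> x _; rewrite -EFinD lee_fin.
rewrite ge0_integralD//; [|by move=> x _; rewrite lee_fin..].
apply: lte_add_pinfty.
  rewrite /g; under eq_integral do rewrite EFinM.
  rewrite ge0_integralZl//; last 3 first.
  - exact/measurable_EFinP.
  - by move=> x _; rewrite lee_fin !mulr_ge0 ?powR_ge0// ltW.
  - by rewrite lee_fin invr_ge0 ltW.
  apply: (@le_lt_trans _ _ (t^-1%:E * 1)); last by rewrite mule1 ltry.
  apply: lee_wpmul2l; first by rewrite lee_fin invr_ge0 ltW.
  apply: le_trans (integral_powR_unit t0).
  rewrite [leRHS]integral_mkcond le_eqVlt; apply/orP; left; apply/eqP.
  by apply: eq_integral => x _; rewrite epatch_indic EFinM.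
rewrite /k; under eq_integral do rewrite EFinM.
rewrite ge0_integralZl//; last 2 first.
- by apply/measurable_EFinP; exact: measurable_exponential_pdf.
- by move=> x _; rewrite lee_fin exponential_pdf_ge0.
by rewrite integral_exponential_pdf ?mule1 ?ltry// invr_gt0.
Qed.

(** On [[1, 2]] the logarithm lies between [0] and [1], which bounds the
    weight below by a positive constant. *)
Lemma gamma_mass_gt0 t : (0 < t)%R -> 0 < gamma_mass t.
Proof.
(* a lower bound of the weight on [[1, 2]] *)
move=> t0; pose c := expR (- (t + 1) - 2).
apply: (@lt_le_trans _ _ (\int[leb]_(x in `[1%R, 2%R]) (cst c%:E x))).
  rewrite integral_cst//= lebesgue_measure_itv/= lte_fin ltr1n/= -EFinB -EFinM lte_fin.
  by rewrite mulr_gt0 ?expR_gt0//; lra.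
apply: (@le_trans _ _ (\int[leb]_(x in `[1%R, 2%R]) (gamma_weight t x)%:E)).
  apply: ge0_le_integral => //.
  - by move=> x _; rewrite lee_fin expR_ge0.
  - by apply: measurable_funTS; exact: measurable_gamma_weight_EFin.
  - move=> x; rewrite /= in_itv/= => /andP[x1 x2].
    have x0 : (0 < x)%R by exact: lt_le_trans x1.
    rewrite lee_fin /gamma_weight x0 ler_expR.
    have l0 : (0 <= ln x)%R by exact: ln_ge0.
    have l1 : (ln x <= 1)%R.
      have := @le_ln1Dx R (x - 1); have -> : (1 + (x - 1) = x)%R by ring.
      by move=> H; apply: le_trans (H _) _; lra.
    nra.
apply: ge0_subset_integral => //; first exact: measurable_gamma_weight_EFin.
by move=> x _; rewrite lee_fin gamma_weight_ge0.
Qed.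

Definition beta_weight (a b v : R) : R :=
  if (0 < v < 1)%R then expR ((a - 1) * ln (1 - v) + (b - 1) * ln v) else 0%R.

Definition beta_mass (a b : R) : \bar R := \int[leb]_v (beta_weight a b v)%:E.

Lemma beta_weight_ge0 a b v : (0 <= beta_weight a b v)%R.
Proof. by rewrite /beta_weight; case: ifP => _ //; exact: expR_ge0. Qed.

Lemma measurable_beta_weight a b : measurable_fun setT (fun v => (beta_weight a b v)%:E).
Proof.
apply/measurable_EFinP; apply: measurable_fun_ifT => //.
  by apply: measurable_and => //; exact: measurable_fun_ltr.
apply: measurableT_comp => //; apply: measurable_funD; apply: measurable_funM => //.
apply: (measurableT_comp (@measurable_ln R)); exact: measurable_funB.
Qed.

(** The substitution [y = x v] separates the variables of the convolution. *)
Lemma gamma_weight_scale a b x v : (0 < x)%R ->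
  (gamma_weight a (x - x * v) * gamma_weight b (x * v) * x =
   gamma_weight (a + b) x * beta_weight a b v)%R.
Proof.
move=> x0; rewrite /beta_weight.
have [v0|v0] /= := ltP 0%R v; last first.
  have xv0 : (x * v <= 0)%R by rewrite mulr_ge0_le0// ltW.
  by rewrite (gamma_weight_neg b xv0) !mulr0 mul0r.
have [v1|v1] := ltP v 1%R; last first.
  rewrite gamma_weight_neg ?mul0r ?mulr0// subr_le0 -[leLHS]mulr1.
  by rewrite ler_pM2l.
have xv : (0 < x * v)%R by rewrite mulr_gt0.
have v1' : (0 < 1 - v)%R by rewrite subr_gt0.
have xE : (x - x * v = x * (1 - v))%R by ring.
rewrite xE /gamma_weight x0 xv mulr_gt0// !lnM ?posrE//.
have xx : x = expR (ln x) by rewrite lnK ?posrE.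
rewrite [X in (_ * X = _)%R]xx -!expRD; congr expR; ring.
Qed.

Lemma measurable_gamma_shift a x :
  measurable_fun setT (fun y : R => (gamma_weight a (x - y))%:E).
Proof.
apply: (measurableT_comp (measurable_gamma_weight_EFin a)).
exact: measurable_funB.
Qed.

Lemma gamma_weight_convolution a b x :
  \int[leb]_y ((gamma_weight a (x - y))%:E * (gamma_weight b y)%:E) =
  (gamma_weight (a + b) x)%:E * beta_mass a b.
Proof.
have [x0|x0] := leP x 0%R.
  rewrite [in RHS]gamma_weight_neg// mul0e; apply: integral0_eq => y _.
  have [y0|y0] := leP y 0%R; first by rewrite (gamma_weight_neg b y0) mule0.
  by rewrite gamma_weight_neg ?mul0e//; lra.
have mk : measurable_fun setT (fun y : R => (gamma_weight a (x - y))%:E * (gamma_weight b y)%:E).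
  by apply: emeasurable_funM; [exact: measurable_gamma_shift|exact: measurable_gamma_weight_EFin].
have k0 y : 0 <= (gamma_weight a (x - y))%:E * (gamma_weight b y)%:E.
  by rewrite mule_ge0 ?lee_fin ?gamma_weight_ge0.
rewrite (ge0_integral_affine 0 x0)// /beta_mass.
have mkx : measurable_fun setT (fun v : R =>
    (gamma_weight a (x - (x * v + 0)))%:E * (gamma_weight b (x * v + 0))%:E).
  by apply: (measurableT_comp mk); apply: measurable_funD => //; exact: measurable_funM.
rewrite -ge0_integralZl//; last by rewrite lee_fin ltW.
rewrite -ge0_integralZl//; last 3 first.
- exact: measurable_beta_weight.
- by move=> v _; rewrite lee_fin beta_weight_ge0.
- by rewrite lee_fin gamma_weight_ge0.
apply: eq_integral => v _.
rewrite addr0; transitivity (gamma_weight a (x - x * v) * gamma_weight b (x * v) * x)%R%:E.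
  by rewrite !EFinM muleC.
by rewrite gamma_weight_scale// EFinM.
Qed.

(** The integral of the convolution of two weights, computed in both orders. *)
Lemma gamma_beta a b : gamma_mass a * gamma_mass b = gamma_mass (a + b) * beta_mass a b.
Proof.
have w0 t (x : R) : setT x -> 0 <= (gamma_weight t x)%:E.
  by move=> _; rewrite lee_fin gamma_weight_ge0.
have B0 : 0 <= beta_mass a b.
  by apply: integral_ge0 => v _; rewrite lee_fin beta_weight_ge0.
transitivity (\int[leb]_x \int[leb]_y ((gamma_weight a (x - y))%:E * (gamma_weight b y)%:E)).
  have mh : measurable_fun setT (fun xy : R * R =>
      (gamma_weight a (xy.1 - xy.2))%:E * (gamma_weight b xy.2)%:E).
    apply: emeasurable_funM.
      apply: (measurableT_comp (measurable_gamma_weight_EFin a)).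
      exact: measurable_funB.
    exact: (measurableT_comp (measurable_gamma_weight_EFin b) measurable_snd).
  have h0 (xy : R * R) : 0 <= (gamma_weight a (xy.1 - xy.2))%:E * (gamma_weight b xy.2)%:E.
    by rewrite mule_ge0 ?lee_fin ?gamma_weight_ge0.
  have fub := (fubini_tonelli (m1 := leb) (m2 := leb) (fun xy : R * R =>
      (gamma_weight a (xy.1 - xy.2))%:E * (gamma_weight b xy.2)%:E) mh h0).
  transitivity (\int[leb]_y \int[leb]_x ((gamma_weight a (x - y))%:E * (gamma_weight b y)%:E));
    last exact/esym/fub.
  have ga0 : 0 <= gamma_mass a.
    by apply: integral_ge0 => y _; rewrite lee_fin gamma_weight_ge0.
  have inner y : \int[leb]_x ((gamma_weight a (x - y))%:E * (gamma_weight b y)%:E) =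
      gamma_mass a * (gamma_weight b y)%:E.
    have gb0 : 0 <= (gamma_weight b y)%:E by rewrite lee_fin gamma_weight_ge0.
    have msh : measurable_fun setT (fun x : R => (gamma_weight a (x - y))%:E).
      by apply: (measurableT_comp (measurable_gamma_weight_EFin a)); exact: measurable_funB.
    have sh0 (x : R) : setT x -> 0 <= (gamma_weight a (x - y))%:E.
      by move=> _; rewrite lee_fin gamma_weight_ge0.
    rewrite (ge0_integralZr leb measurableT msh sh0 gb0).
    - congr (_ * _).
      apply: (@ge0_integral_shift R (- y) (fun x => (gamma_weight a x)%:E)).
        exact: measurable_gamma_weight_EFin.
      by move=> x; rewrite lee_fin gamma_weight_ge0.
  transitivity (\int[leb]_y (gamma_mass a * (gamma_weight b y)%:E)); last first.
    by apply: eq_integral => y _; rewrite inner.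
  exact/esym/(ge0_integralZl leb measurableT (measurable_gamma_weight_EFin b) (w0 b) ga0).
transitivity (\int[leb]_x ((gamma_weight (a + b) x)%:E * beta_mass a b)).
  by apply: eq_integral => x _; exact: gamma_weight_convolution.
exact: (ge0_integralZr leb measurableT (measurable_gamma_weight_EFin (a + b)) (w0 _) B0).
Qed.

Definition gamma_density (t x : R) : \bar R :=
  (gamma_weight t x * (fine (gamma_mass t))^-1)%:E.

Lemma gamma_massE t : (0 < t)%R -> gamma_mass t = (fine (gamma_mass t))%:E.
Proof.
move=> t0; have g0 := gamma_mass_gt0 t0; have goo := gamma_mass_lty t0.
by rewrite fineK// ge0_fin_numE// ltW.
Qed.

Lemma fine_gamma_mass_gt0 t : (0 < t)%R -> (0 < fine (gamma_mass t))%R.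
Proof. by move=> t0; rewrite -lte_fin -gamma_massE// gamma_mass_gt0. Qed.

Lemma measurable_gamma_density t : measurable_fun setT (gamma_density t).
Proof.
apply/measurable_EFinP; apply: measurable_funM => //.
exact: measurable_gamma_weight.
Qed.

Lemma gamma_density_ge0 t x : 0 <= gamma_density t x.
Proof.
rewrite lee_fin mulr_ge0 ?gamma_weight_ge0// invr_ge0 fine_ge0//.
by apply: integral_ge0 => y _; rewrite lee_fin gamma_weight_ge0.
Qed.

Lemma gamma_density_neg t x : (x <= 0)%R -> gamma_density t x = 0.
Proof. by move=> x0; rewrite /gamma_density gamma_weight_neg// mul0r. Qed.

Lemma gamma_density_gt0 t x : (0 < t)%R -> (0 < x)%R -> 0 < gamma_density t x < +oo.
Proof.
move=> t0 x0; rewrite ltry andbT lte_fin mulr_gt0 ?gamma_weight_gt0//.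
by rewrite invr_gt0 fine_gamma_mass_gt0.
Qed.

Lemma gamma_density_integral t D : measurable D ->
  \int[leb]_(x in D) gamma_density t x =
  \int[leb]_(x in D) (gamma_weight t x)%:E * ((fine (gamma_mass t))^-1)%:E.
Proof.
move=> mD; rewrite /gamma_density; under eq_integral do rewrite EFinM.
have w0 (x : R) : D x -> 0 <= (gamma_weight t x)%:E.
  by move=> _; rewrite lee_fin gamma_weight_ge0.
have mw : measurable_fun D (fun x => (gamma_weight t x)%:E).
  by apply: measurable_funTS; exact: measurable_gamma_weight_EFin.
have g0 : 0 <= ((fine (gamma_mass t))^-1)%:E.
  rewrite lee_fin invr_ge0 fine_ge0//.
  by apply: integral_ge0 => y _; rewrite lee_fin gamma_weight_ge0.
exact: (ge0_integralZr leb mD mw w0 g0).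
Qed.

Lemma gamma_density_mass t : (0 < t)%R -> \int[leb]_x gamma_density t x = 1.
Proof.
move=> t0; rewrite (gamma_density_integral t measurableT) -/(gamma_mass t).
have g0 := fine_gamma_mass_gt0 t0.
by rewrite gamma_massE//= -EFinM mulfV// gt_eqF.
Qed.

(** The convolution of two weights is a multiple of the weight of the sum, and
    [gamma_beta] says that the multiple is the quotient of the normalising
    constants. *)
Lemma gamma_chapman_kolmogorov a b x : (0 < a)%R -> (0 < b)%R ->
  \int[leb]_y (gamma_density a (x - y)%R * gamma_density b y) = gamma_density (a + b)%R x.
Proof.
move=> a0 b0; have ab0 : (0 < a + b)%R by rewrite addr_gt0.
set ca := fine (gamma_mass a); set cb := fine (gamma_mass b).
have ca0 : (0 < ca)%R := fine_gamma_mass_gt0 a0.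
have cb0 : (0 < cb)%R := fine_gamma_mass_gt0 b0.
set cab := fine (gamma_mass (a + b)); have cab0 : (0 < cab)%R := fine_gamma_mass_gt0 ab0.
pose k y := (gamma_weight a (x - y))%:E * (gamma_weight b y)%:E.
have mk : measurable_fun setT k.
  by apply: emeasurable_funM; [exact: measurable_gamma_shift|exact: measurable_gamma_weight_EFin].
have k0 (y : R) : setT y -> 0 <= k y.
  by move=> _; rewrite /k mule_ge0// lee_fin gamma_weight_ge0.
have cc0 : 0 <= (ca^-1 * cb^-1)%R%:E by rewrite lee_fin mulr_ge0// invr_ge0 ltW.
transitivity (\int[leb]_y (k y * (ca^-1 * cb^-1)%R%:E)).
  apply: eq_integral => y _; rewrite /gamma_density /k -/ca -/cb !EFinM.
  by rewrite muleACA.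
rewrite (ge0_integralZr leb measurableT mk k0 cc0) gamma_weight_convolution.
have B : beta_mass a b = (ca * cb / cab)%R%:E.
  have := gamma_beta a b.
  rewrite (gamma_massE a0) (gamma_massE b0) (gamma_massE ab0) -/ca -/cb -/cab.
  have Bge0 : 0 <= beta_mass a b.
    by apply: integral_ge0 => v _; rewrite lee_fin beta_weight_ge0.
  case: (beta_mass a b) Bge0 => [r| |] //= r0; last first.
    by rewrite gt0_muley// lte_fin.
  move=> E; have E' : (ca * cb = cab * r)%R by apply: EFin_inj; rewrite !EFinM.
  by congr EFin; rewrite E' mulrC mulKf// gt_eqF.
rewrite B /gamma_density -/cab.
transitivity ((gamma_weight (a + b) x * (ca * cb / cab) * (ca^-1 * cb^-1))%R%:E).
  by rewrite [RHS]EFinM [in RHS]EFinM.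
congr EFin.
by field; rewrite !gt_eqF.
Qed.

(** Since [x x^(t-1) = x^t], the mean is a quotient of two Gamma values. *)
Lemma gamma_mean : \int[leb]_x (x%:E * gamma_density 1 x) < +oo.
Proof.
have x2 (x : R) : x%:E * gamma_density 1 x =
    (gamma_weight 2 x)%:E * ((fine (gamma_mass 1))^-1)%:E.
  have [x0|x0] := leP x 0%R.
    by rewrite gamma_density_neg// mule0 gamma_weight_neg// mul0e.
  rewrite /gamma_density -!EFinM; congr EFin; rewrite mulrA; congr (_ * _)%R.
  rewrite /gamma_weight x0.
  have xx : x = expR (ln x) by rewrite lnK ?posrE.
  rewrite [X in (X * _ = _)%R]xx -expRD; congr expR; ring.
have c0 : 0 <= ((fine (gamma_mass 1))^-1)%:E.
  by rewrite lee_fin invr_ge0 ltW// fine_gamma_mass_gt0.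
have w0 (x : R) : setT x -> 0 <= (gamma_weight 2 x)%:E.
  by move=> _; rewrite lee_fin gamma_weight_ge0.
under eq_integral do rewrite x2.
rewrite (ge0_integralZr leb measurableT (measurable_gamma_weight_EFin 2) w0 c0).
by rewrite -/(gamma_mass 2) gamma_massE// -EFinM ltry.
Qed.

Lemma gamma_weight_continuous (a : nat -> R) h x :
  a n @[n --> \oo] --> h -> gamma_weight (a n) x @[n --> \oo] --> gamma_weight h x.
Proof.
move=> ah; rewrite /gamma_weight; case: ltP => _; last exact: cvg_cst.
apply: (@cvg_comp _ _ _ (fun n => (a n - 1) * ln x - x)%R expR); last exact: continuous_expR.
apply: cvgB; last exact: cvg_cst.
by apply: cvgM; [apply: cvgB => //; exact: cvg_cst|exact: cvg_cst].
Qed.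

(** For fixed [x] the weight is monotone in [t], so an end point of the
    interval dominates. *)
Lemma gamma_weight_bound l r t x : (l <= t <= r)%R ->
  (gamma_weight t x <= gamma_weight l x + gamma_weight r x)%R.
Proof.
move=> /andP[lt tr]; have [x0|x0] := leP x 0%R.
  by rewrite !gamma_weight_neg// addr0.
rewrite /gamma_weight x0; have [lx|lx] := leP 0%R (ln x).
  apply: (@le_trans _ _ (expR ((r - 1) * ln x - x))); last by rewrite lerDr expR_ge0.
  by rewrite ler_expR lerD2r ler_wpM2r// lerD2r.
apply: (@le_trans _ _ (expR ((l - 1) * ln x - x))); last by rewrite lerDl expR_ge0.
by rewrite ler_expR lerD2r ler_wnM2r ?(ltW lx)// lerD2r.
Qed.

(** Dominated convergence: close to [h] the parameters stay in [[h/2, 2h]]. *)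
Lemma gamma_integral_continuous (a : nat -> R) (h : R) D : (0 < h)%R -> measurable D ->
  a n @[n --> \oo] --> h ->
  \int[leb]_(x in D) (gamma_weight (a n) x)%:E @[n --> \oo] -->
  \int[leb]_(x in D) (gamma_weight h x)%:E.
Proof.
move=> h0 mD ah.
have [N _ NP] : \forall n \near \oo, (h / 2 <= a n <= 2 * h)%R.
  near=> n; apply/andP; split; apply/ltW; near: n.
    by apply: cvgr_gt ah _ _; lra.
  by apply: cvgr_lt ah _ _; lra.
rewrite -(cvg_shiftn N).
pose g x := (gamma_weight (h / 2) x)%:E + (gamma_weight (2 * h) x)%:E.
have ig : leb.-integrable D g.
  apply: (@integrableS _ _ _ leb setT) => //.
  have iw t : (0 < t)%R -> leb.-integrable setT (fun x => (gamma_weight t x)%:E).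
    move=> t0; apply/integrableP; split; first exact: measurable_gamma_weight_EFin.
    apply: le_lt_trans (gamma_mass_lty t0); rewrite le_eqVlt; apply/orP; left; apply/eqP.
    by apply: eq_integral => x _; rewrite gee0_abs// lee_fin gamma_weight_ge0.
  by apply: integrableD => //; apply: iw; lra.
pose F (n : nat) (x : R) : \bar R := (gamma_weight (a (n + N)%N) x)%:E.
have mF n : measurable_fun D (F n).
  by apply: measurable_funTS; exact: measurable_gamma_weight_EFin.
have Fcvg x : D x -> F n x @[n --> \oo] --> (gamma_weight h x)%:E.
  move=> _; apply: cvg_EFin; first exact: nearW.
  by apply: gamma_weight_continuous; rewrite (cvg_shiftn N a).
have gfin x : D x -> g x \is a fin_num by [].
have Fg n x : D x -> `|F n x| <= g x.
  move=> _; rewrite /F gee0_abs ?lee_fin ?gamma_weight_ge0//.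
  change ((gamma_weight (a (n + N)%N) x)%:E <=
    (gamma_weight (h / 2) x + gamma_weight (2 * h) x)%:E).
  rewrite lee_fin.
  by apply: gamma_weight_bound; apply: NP; rewrite /= leq_addl.
exact: (dominated_cvg mD mF Fcvg gfin ig Fg).
Unshelve. all: by end_near. Qed.

Lemma gamma_cdf_continuous (a : nat -> R) (h x : R) : (0 < h)%R ->
  a n @[n --> \oo] --> h ->
  \int[leb]_(y in `]-oo, x]) gamma_density (a n) y @[n --> \oo] -->
  \int[leb]_(y in `]-oo, x]) gamma_density h y.
Proof.
move=> h0 ah; have mx : measurable (`]-oo, x]%classic : set R) by exact: measurable_itv.
rewrite gamma_density_integral//; under eq_fun do rewrite gamma_density_integral//.
have fin D : measurable D -> \int[leb]_(y in D) (gamma_weight h y)%:E \is a fin_num.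
  move=> mD; rewrite ge0_fin_numE.
    apply: le_lt_trans (gamma_mass_lty h0); apply: ge0_subset_integral => //.
      exact: measurable_gamma_weight_EFin.
    by move=> y _; rewrite lee_fin gamma_weight_ge0.
  by apply: integral_ge0 => y _; rewrite lee_fin gamma_weight_ge0.
apply: cvgeM.
- by rewrite mule_def_fin// fin.
- exact: gamma_integral_continuous.
apply: cvg_EFin; first exact: nearW.
apply: cvgV; first by rewrite gt_eqF// fine_gamma_mass_gt0.
apply: fine_cvg; rewrite -gamma_massE//.
exact: gamma_integral_continuous.
Qed.

End gamma_densities.

(** * A bridge that is not strongly consistent *)

Section probability_density.
Context (R : realType) (g : R -> \bar R).
Local Notation leb := (@lebesgue_measure R).
Hypotheses (mg : measurable_fun setT g) (g0 : forall x, 0 <= g x).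
Hypothesis g1 : \int[leb]_x g x = 1.

Let dens : set (measurableTypeR R) -> \bar R := weighted_measure leb mg g0.

HB.instance Definition _ := Measure.on dens.

HB.instance Definition _ := Measure_isProbability.Build _ _ _ dens g1.

Let idR : measurableTypeR R -> R := id.

Let measurable_idR : measurable_fun setT idR.
Proof. by move=> _ A mA; rewrite setTI. Qed.

HB.instance Definition _ := isMeasurableFun.Build _ _ _ _ idR measurable_idR.

Lemma probability_of_density : exists m : probability R R,
  forall B, measurable B -> m B = \int[leb]_(x in B) g x.
Proof. by exists (distribution dens idR). Qed.

End probability_density.

(** The laws of the increments are the gamma laws, completed by the Dirac mass
    at the time [0]. *)
Lemma gamma_process_exists (R : realType) :
  exists (U : probability R R) (X : R -> {RV U >-> R}),
    [/\ levy_process X, forall t, (0 < t)%R -> has_density (X t) (gamma_density t),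
        forall s t u, (s <= t)%R -> (X s u <= X t u)%R
      & forall t u, (0 <= X t u)%R].
Proof.
have [U UE] := uniform_exists R; exists U.
have /choice[G GP] : forall h : R, exists m : probability R R,
    ((0 < h)%R -> forall B, measurable B ->
       m B = \int[lebesgue_measure]_(x in B) gamma_density h x) /\
    (h = 0%R -> forall B, measurable B -> m B = (\1_B (0%R : R))%:E).
  move=> h; have [h0|h0] := ltP 0%R h.
    have [m mE] := probability_of_density (measurable_gamma_density h)
      (gamma_density_ge0 h) (gamma_density_mass h0).
    by exists m; split => // hE; move: h0; rewrite hE ltxx.
  exists (dirac (0%R : R)); split=> //.
have GE h B : (0 < h)%R -> measurable B ->
    G h B = \int[lebesgue_measure]_(x in B) gamma_density h x.
  by move=> h0; exact: (GP h).1.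
have G0E B : measurable B -> G 0%R B = (\1_B (0%R : R))%:E by exact: (GP 0%R).2.
have contG (a : nat -> R) (h x : R) : (0 < h)%R -> a n @[n --> \oo] --> h ->
    G (a n) `]-oo, x]%classic @[n --> \oo] --> G h `]-oo, x]%classic.
  move=> h0 ah; rewrite GE//.
  have [N _ NP] : \forall n \near \oo, (0 < a n)%R by apply: cvgr_gt ah _ _.
  have aN : a (n + N)%N @[n --> \oo] --> h by rewrite (cvg_shiftn N a).
  rewrite -(cvg_shiftn N).
  rewrite (_ : (fun _ => _) = (fun n =>
    \int[lebesgue_measure]_(y in `]-oo, x]) gamma_density (a (n + N)%N) y)).
    exact: gamma_cdf_continuous.
  apply/funext => n; apply: GE; last exact: measurable_itv.
  by apply: NP; rewrite /= leq_addl.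
have mf (h : R) : (0 < h)%R -> measurable_fun setT (gamma_density h).
  by move=> _; exact: measurable_gamma_density.
have f0 (h x : R) : (0 < h)%R -> 0 <= gamma_density h x.
  by move=> _; exact: gamma_density_ge0.
have fneg (h x : R) : (0 < h)%R -> (x <= 0)%R -> gamma_density h x = 0.
  by move=> _; exact: gamma_density_neg.
have fpos := @gamma_density_gt0 R; have fCK := @gamma_chapman_kolmogorov R.
exists (subordinator_process U mf f0 fneg fpos fCK); split.
- exact: (subordinator_levy UE mf f0 fneg fpos fCK GE (@gamma_density_mass R) G0E
    (@gamma_mean R) contG).
- exact: (subordinator_density UE mf f0 fneg fpos fCK GE (@gamma_density_mass R) G0E
    (@gamma_mean R) contG).
- by move=> s t u; exact: le_subordinator.
- by move=> t u; exact: subordinator_ge0.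
Qed.

Lemma cadlag_subset (R : realType) (I J : set R) (x : R -> R) :
  J `<=` I -> cadlag I x -> cadlag J x.
Proof.
move=> JI cx t Jt; have [r [l lP]] := cx t (JI _ Jt).
have sub (F : set_system R) (FF : Filter F) (p : R) :
    x @ within I F --> p -> x @ within J F --> p.
  move=> Ip A /Ip; rewrite /= /nbhs /= /within /=.
  by apply: filterS => s sA Js; apply: sA; exact: JI.
by split; [exact: sub|exists l; exact: sub].
Qed.

Lemma cadlag_shift (R : realType) (x : R -> R) (u : R) : (0 <= u)%R ->
  cadlag [set t | (0 <= t)%R] x ->
  cadlag `[0%R, 1%R] (fun t => x (t + u) - x u)%R.
Proof.
move=> u0 cx t; rewrite /= in_itv/= => /andP[t0 t1].
have tu0 : [set t | (0 <= t)%R] (t + u)%R by rewrite /= addr_ge0.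
have [r [l lP]] := cx _ tu0.
have sub p : x @ within [set t | (0 <= t)%R] (at_right (t + u)%R) --> p ->
    (fun s => x (s + u) - x u)%R @ within `[0%R, 1%R] (at_right t) --> (p - x u)%R.
  move=> xp; apply: cvgB; last exact: cvg_cst.
  move=> A /xp [e /= e0 eA]; exists e => // s /= st ts; rewrite in_itv/= => /andP[s0 _].
  apply: eA => /=; last exact: addr_ge0.
    by move: st; rewrite /ball/= opprD addrACA subrr addr0.
  by rewrite ltrD2r.
have subl p : x @ within [set t | (0 <= t)%R] (at_left (t + u)%R) --> p ->
    (fun s => x (s + u) - x u)%R @ within `[0%R, 1%R] (at_left t) --> (p - x u)%R.
  move=> xp; apply: cvgB; last exact: cvg_cst.
  move=> A /xp [e /= e0 eA]; exists e => // s /= st ts; rewrite in_itv/= => /andP[s0 _].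
  apply: eA => /=; last exact: addr_ge0.
    by move: st; rewrite /ball/= opprD addrACA subrr addr0.
  by rewrite ltrD2r.
by split; [exact: sub|exists (l - x u)%R; exact: subl].
Qed.

Section conditioned_process.
Context (R : realType) d (O : measurableType d) (Q : probability O R).
Variables (X : R -> {RV Q >-> R}) (f : R -> R -> \bar R).
Local Notation leb := (@lebesgue_measure R).
Hypothesis levyX : levy_process X.
Hypothesis densX : forall t, (0 < t)%R -> has_density (X t) (f t).
Hypothesis ndX : forall s t w, (s <= t)%R -> (X s w <= X t w)%R.
Hypothesis X_ge0 : forall t w, (0 <= X t w)%R.
Hypothesis fneg : forall h x, (0 < h)%R -> (x <= 0)%R -> f h x = 0.
Hypothesis fpos : forall h x, (0 < h)%R -> (0 < x)%R -> 0 < f h x < +oo.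
Hypothesis fCK : forall a b x, (0 < a)%R -> (0 < b)%R ->
  \int[leb]_y (f a (x - y)%R * f b y) = f (a + b)%R x.

Let mf h : (0 < h)%R -> measurable_fun setT (f h).
Proof. by move=> /densX[]. Qed.

Let f0 h x : (0 < h)%R -> 0 <= f h x.
Proof. by move=> /densX[]. Qed.

Let densX' T : (forall t, (0 < t <= T)%R -> has_density (X t) (f t)).
Proof. by move=> t /andP[t0 _]; exact: densX. Qed.

Lemma increment_law s t B : (0 <= s)%R -> (s < t)%R -> measurable B ->
  Q [set w | B (X t w - X s w)%R] = \int[leb]_(x in B) f (t - s)%R x.
Proof.
move=> s0 st mB; exact: (increment_density levyX (densX' (T := t)) s0 st (lexx t) mB).
Qed.

Lemma density_integral_gt0 h a b : (0 < h)%R -> (0 <= a)%R -> (a < b)%R ->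
  0 < \int[leb]_(x in `]a, b[) f h x.
Proof.
move=> h0 a0 ab; have fh0 := f0 _ h0.
rewrite lt0e integral_ge0 ?andbT//; apply/eqP => int0.
have mab : measurable (`]a, b[%classic : set (measurableTypeR R)) by exact: measurable_itv.
have mfab : measurable_fun (`]a, b[%classic : set (measurableTypeR R)) (f h).
  by apply: measurable_funTS; exact: mf.
have [N [mN N0 abN]] : ae_eq leb `]a, b[%classic (f h) (cst 0).
  apply/(ae_eq_integral_abs leb mab mfab); rewrite -[RHS]int0.
  by apply: eq_integral => x _; rewrite gee0_abs.
have : leb `]a, b[%classic <= leb N.
  apply: le_measure; rewrite ?inE// => x xab; apply: abN => /= /(_ xab) fx0.
  have x0 : (0 < x)%R by move: xab; rewrite /= in_itv/= => /andP[ax _]; exact: le_lt_trans ax.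
  by have := fpos h0 x0; rewrite fx0 ltxx.
by rewrite N0 lebesgue_measure_itv/= lte_fin ab -EFinB lee_fin leNgt subr_gt0 ab.
Qed.

Let K : set O := [set w | (X 2 w <= 4)%R].

Let mK : measurable K.
Proof.
rewrite (_ : K = X 2 @^-1` `]-oo, 4%R]%classic).
  by rewrite -[X in measurable X]setTI; exact: measurable_funP.
by apply/seteqP; split => w /=; rewrite in_itv.
Qed.

Let QK_gt0 : 0 < Q K.
Proof.
have [_ _ dX2] := densX (ltr0n R 2 : (0 < 2%:R)%R).
have QKE : Q K = \int[leb]_(x in `]-oo, 4%R]) f 2 x.
  rewrite -dX2; last exact: measurable_itv.
  by congr (Q _); apply/seteqP; split => w /=; rewrite in_itv.
rewrite QKE; apply: (@lt_le_trans _ _ (\int[leb]_(x in `]0%R, 1%R[) f 2 x)).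
  by apply: density_integral_gt0.
apply: ge0_subset_integral => //.
- by apply: measurable_funTS; exact: mf.
- by move=> x _; exact: f0.
- by move=> x /=; rewrite !in_itv/= => /andP[_ x1]; lra.
Qed.

(** The law given the event [X 2 <= 4], which has positive probability, so
    that no disintegration is involved. *)
Definition conditioned : probability O R := mnormalize (mrestr Q mK) Q.

Local Notation P' := conditioned.
Let c : R := fine (Q K).

Lemma conditionedE A : measurable A -> P' A = Q (A `&` K) * (c^-1)%:E.
Proof.
move=> mA; rewrite /conditioned /= /mnormalize.
have QKfin : Q K \is a fin_num by exact: fin_num_measure.
have E : (mrestr Q mK : {measure set O -> \bar R}) setT = Q K by rewrite /= /mrestr setTI.
rewrite E gt_eqF//= ; case: ifPn => [/eqP QKoo|_]; last by [].
by move: QKfin; rewrite QKoo.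
Qed.

Definition conditioned_bridge (t : R) : {RV P' >-> R} := X t.

Local Notation L := conditioned_bridge.

Definition conditioned_end_law : probability R R := distribution P' (L 2).

Local Notation nu := conditioned_end_law.
Let J : set R := `]-oo, 4%R]%classic.

Let mJ : measurable J. Proof. exact: measurable_itv. Qed.

Let c_gt0 : (0 < c)%R.
Proof. by rewrite /c fine_gt0// QK_gt0 probability_lty. Qed.

Let ci0 : 0 <= (c^-1)%:E.
Proof. by rewrite lee_fin invr_ge0 ltW. Qed.

Let T2 : (0 < 2 :> R)%R. Proof. by []. Qed.

Let end_density (z : R) : \bar R := (c^-1)%:E * ((\1_J z)%:E * f 2 z).

Let mJ1 : measurable_fun setT (fun z : R => (\1_J z)%:E : \bar R).
Proof. by apply/measurable_EFinP; exact: measurable_indic. Qed.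

Let measurable_end_density : measurable_fun setT end_density.
Proof.
apply: measurable_funeM; apply: emeasurable_funM => //; exact: mf.
Qed.

Let end_density_ge0 z : 0 <= end_density z.
Proof. by rewrite mule_ge0// mule_ge0 ?lee_fin ?f0. Qed.

Let preimage_measurable t B : measurable B -> measurable (X t @^-1` B).
Proof. by move=> mB; rewrite -[Y in measurable Y]setTI; exact: measurable_funP. Qed.

Lemma end_lawE B : measurable B -> nu B = \int[leb]_(z in B) end_density z.
Proof.
move=> mB; rewrite -[LHS]/(P' (X 2 @^-1` B)) conditionedE; last exact: preimage_measurable.
have [_ _ dX2] := densX T2.
rewrite (_ : X 2 @^-1` B `&` K = X 2 @^-1` (B `&` J)); last first.
  by apply/seteqP; split => w /=; rewrite /J /= in_itv.
rewrite -[Q _]/(distribution Q (X 2) (B `&` J)) dX2; last exact: measurableI.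
have mJf : measurable_fun B (fun z : R => (\1_J z)%:E * f 2 z).
  by apply: measurable_funTS; apply: emeasurable_funM => //; exact: mf.
have Jf0 (z : R) : B z -> 0 <= (\1_J z)%:E * f 2 z by rewrite mule_ge0 ?lee_fin ?f0.
transitivity ((c^-1)%:E * \int[leb]_(z in B) ((\1_J z)%:E * f 2 z)); last first.
  exact/esym/(ge0_integralZl leb mB mJf Jf0 ci0).
rewrite muleC; congr (_ * _).
rewrite integral_mkcondr; apply: eq_integral => z _.
by rewrite epatch_indic muleC.
Qed.

Let end_law_pos : {ae nu, forall z, 0 < f 2 z < +oo}.
Proof.
exists `]-oo, 0%R]%classic; split; first exact: measurable_itv.
  rewrite end_lawE; last exact: measurable_itv.
  apply: integral0_eq => z; rewrite /= in_itv/= => z0.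
  by rewrite /end_density (fneg T2 z0) !mule0.
move=> z /=; apply: contra_notP; rewrite in_itv/= => /negP.
by rewrite -ltNge => z0; exact: fpos.
Qed.

Let invf := inv_density 2 f.

Let bridge_integral_expectation (txs : seq (R * R)) (z : R) :
  let v := last 0%R (map fst txs) in
  path <%R 0%R (rcons (map fst txs) 2%R) ->
  bridge_integral f 2 z 0 0 txs =
  \int[Q]_w ((\1_(cylinder (fun t w => X t w - X 0 w)%R (rays txs)) w)%:E *
    f (2 - v)%R (z - (X v w - X 0 w))%R).
Proof.
move=> v; rewrite rcons_path -/v => /andP[txpath vT].
rewrite bridge_integralE.
have mapE : map fst (rays txs) = map fst txs by rewrite -map_comp.
have v2 : (0 < 2 - v)%R by rewrite subr_gt0.
rewrite (levy_box_integral0 levyX (densX' (T := 2%R))) ?mapE -/v//.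
- by apply: (measurableT_comp (mf v2)); exact: measurable_funB.
- by move=> x; exact: f0.
- exact: ltW.
- by move=> _ /mapP[q _ ->]; exact: measurable_itv.
Qed.

(** The density of the generating law and the bridge distribution function at
    [z] both contain [f 2 z], once as a factor and once as a divisor. After
    cancellation, and Fubini, what is left is the probability that [X]
    satisfies the bounds and that [X 2] lies in [B] and below [4]. *)
Lemma conditioned_is_bridge : levy_random_bridge 2 nu L.
Proof.
split; first exact: T2.
split.
  case: levyX => cX _ _ _ w; apply: (@cadlag_subset _ [set t | (0 <= t)%R]); last exact: cX.
  by move=> t; rewrite /= in_itv/= => /andP[].
split; first by [].
exists d, O, Q, X, f; split => //.
- exact: densX'.
- move=> s t x s0 st tT; rewrite fCK ?subr_gt0//; congr f; ring.
move=> txs txs0 txpath.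
have [cX X0 _ _] := levyX.
pose v := last 0%R (map fst txs).
have vpath := txpath; rewrite rcons_path -/v in vpath; have {vpath}[txp vT] := andP vpath.
have v2 : (0 < 2 - v)%R by rewrite subr_gt0.
have v0 : (0 <= v)%R.
  have := mem_last 0%R (map fst txs); rewrite -/v inE => /predU1P[->//|vin].
  by have /andP[/ltW] := path_lt_last txp vin.
pose Y (t : R) w := (X t w - X 0 w)%R.
have mY t : measurable_fun setT (Y t) by exact: measurable_funB.
have mcyl : measurable (cylinder Y (rays txs)).
  by apply: measurable_cylinder => _ /mapP[q _ ->] /=; split => //; exact: measurable_itv.
pose I (w : O) : \bar R := (\1_(cylinder Y (rays txs)) w)%:E.
have mI : measurable_fun setT I by apply/measurable_EFinP; exact: measurable_indic.
have I0 w : 0 <= I w by rewrite lee_fin.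
pose b z := bridge_integral f 2 z 0 0 txs.
have bE z : b z = \int[Q]_w (I w * f (2 - v)%R (z - Y v w)%R).
  exact: bridge_integral_expectation.
have mh : measurable_fun setT (fun zw : R * O => I zw.2 * f (2 - v)%R (zw.1 - Y v zw.2)%R).
  apply: emeasurable_funM; first exact: (measurableT_comp mI measurable_snd).
  apply: (measurableT_comp (mf v2)); apply: measurable_funB => //.
  exact: (measurableT_comp (mY v) measurable_snd).
have h0 (zw : R * O) : 0 <= I zw.2 * f (2 - v)%R (zw.1 - Y v zw.2)%R.
  by rewrite mule_ge0// f0.
have mb : measurable_fun setT b.
  rewrite (_ : b = fun z => \int[Q]_w (I w * f (2 - v)%R (z - Y v w)%R)); last exact/funext.
  exact: (@measurable_integral_snd _ _ _ _ _ _ _ Q id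
    (fun zw : R * O => I zw.2 * f (2 - v)%R (zw.1 - Y v zw.2)%R)).
have b0 z : 0 <= b z by rewrite bE; apply: integral_ge0 => w _; exact: (h0 (z, w)).
have bneg z : (z <= 0)%R -> b z = 0.
  move=> z0; rewrite bE; apply: integral0_eq => w _.
  rewrite fneg ?mule0// subr_le0 (le_trans z0)// subr_ge0; exact: ndX.
have invf0 z : 0 <= invf z.
  rewrite lee_fin invr_ge0 fine_ge0//; exact: f0.
have minvf : measurable_fun setT invf.
  exact: (measurable_inv_density T2 (densX' (T := 2%R))).
exists (fun z => b z * invf z); split; last first.
  have := inv_density_ae end_law_pos; apply: filterS => z iz.
  by rewrite /bridge_cdf /invf iz.
split; first exact: emeasurable_funM.
move=> B mB.
pose A := [set w | forall tx, tx \in txs -> (L tx.1 w <= tx.2)%R].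
have AE : A = cylinder (fun t w => X t w) (rays txs) by rewrite cylinder_raysE.
have mA : measurable A.
  rewrite AE; apply: measurable_cylinder => _ /mapP[q _ ->] /=.
  by split; [exact: measurable_funP|exact: measurable_itv].
have mB1 : measurable_fun setT (fun z : R => (\1_B z)%:E : \bar R).
  by apply/measurable_EFinP; exact: measurable_indic.
rewrite -[LHS]/(P' (A `&` X 2 @^-1` B)) conditionedE; last first.
  by apply: measurableI => //; exact: preimage_measurable.
transitivity (\int[leb]_z (((\1_B z)%:E * (b z * invf z)) * end_density z)); last first.
  rewrite -(integral_of_lebesgue_density measurable_end_density end_density_ge0 end_lawE).
  - by rewrite [RHS]integral_mkcond; apply: eq_integral => z _; rewrite epatch_indic muleC.
  - by apply: emeasurable_funM => //; exact: emeasurable_funM.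
  - by move=> z; rewrite mule_ge0 ?lee_fin// mule_ge0.
pose B' := B `&` J.
have mB' : measurable B' by exact: measurableI.
have mB'1 : measurable_fun setT (fun z : R => (\1_B' z)%:E : \bar R).
  by apply/measurable_EFinP; exact: measurable_indic.
transitivity (\int[leb]_z ((c^-1)%:E * ((\1_B' z)%:E * b z))); last first.
  apply: eq_integral => z _; rewrite /end_density /B' indicI/= EFinM.
  have [z0|z0] := leP z 0%R; first by rewrite bneg// mul0e !(mule0, mul0e).
  have /andP[fz0 fzoo] := fpos T2 z0.
  have fzE : invf z * f 2 z = 1.
    have fin : f 2 z \is a fin_num by rewrite ge0_fin_numE// ltW.
    rewrite /invf /inv_density -[X in _ * X](fineK fin) -EFinM mulVf// gt_eqF// fine_gt0//.
    by rewrite fz0.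
  rewrite -[in LHS](mule1 (b z)) -fzE.
  set x1 := (\1_B z)%:E; set x2 := (\1_J z)%:E; set x3 := (c^-1)%:E.
  by rewrite [RHS]muleACA [X in _ = _ * X]muleACA (muleC x1 x3) (muleC (b z) x2) !muleA.
have mBb : measurable_fun setT (fun z : R => (\1_B' z)%:E * b z).
  by apply: emeasurable_funM.
have Bb0 (z : R) : setT z -> 0 <= (\1_B' z)%:E * b z by move=> _; rewrite mule_ge0 ?lee_fin.
rewrite (ge0_integralZl leb measurableT mBb Bb0 ci0) muleC; congr (_ * _).
transitivity (\int[Q]_w \int[leb]_z ((\1_B' z)%:E * (I w * f (2 - v)%R (z - Y v w)%R))); last first.
  have mk : measurable_fun setT (fun zw : R * O => (\1_B' zw.1)%:E *
      (I zw.2 * f (2 - v)%R (zw.1 - Y v zw.2)%R)).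
    by apply: emeasurable_funM => //; exact: (measurableT_comp mB'1 measurable_fst).
  rewrite -(@fubini_lebesgue _ _ _ Q (fun zw : R * O => (\1_B' zw.1)%:E *
      (I zw.2 * f (2 - v)%R (zw.1 - Y v zw.2)%R)) mk); last first.
    by move=> zw; apply: mule_ge0; [rewrite lee_fin|exact: h0].
  apply: eq_integral => z _; rewrite bE /=.
  have mhz : measurable_fun setT (fun w => I w * f (2 - v)%R (z - Y v w)%R).
    exact: (measurableT_comp mh (measurable_fun_pair (measurable_cst z) (@measurable_id _ O setT))).
  have hz0 w : setT w -> 0 <= I w * f (2 - v)%R (z - Y v w)%R by move=> _; exact: (h0 (z, w)).
  have iz0 : 0 <= ((\1_B' z)%:E : \bar R) by rewrite lee_fin.
  exact: (ge0_integralZl Q measurableT mhz hz0 iz0).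
pose l := rcons (rays txs) (2%R, B').
have mapE : map fst (rays txs) = map fst txs by rewrite -map_comp.
have lE : last 0%R (map fst l) = 2%R by rewrite map_rcons last_rcons.
have ml p : p \in l -> measurable p.2.
  by rewrite mem_rcons inE => /predU1P[->//|/mapP[q _ ->]]; exact: measurable_itv.
transitivity (box_integral f (fun _ _ => 1) 0 0 l).
  rewrite (levy_box_integral0 levyX (densX' (T := 2%R)) (g := fun _ _ => 1)) ?lE//; last first.
    by rewrite map_rcons mapE.
  under eq_integral do rewrite mule1.
  rewrite integral_indic//; last first.
    by apply: measurable_cylinder => p pl; split; [exact: mY|exact: ml].
  rewrite setIT; apply: ae_eq_measure.
  - apply: measurableI; first by apply: measurableI => //; exact: preimage_measurable.
    exact: mK.
  - by apply: measurable_cylinder => p pl; split; [exact: mY|exact: ml].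
  apply: filterS X0 => w w0; rewrite /l -cats1 cylinder_cat cylinder_cons [cylinder _ [::]]big_nil setIT.
  rewrite AE; split.
    move=> [[/cylinderP wl wB] wK]; split; last by rewrite /= /Y w0 subr0.
    by apply/cylinderP => p /wl; rewrite w0 subr0.
  move=> [/cylinderP wl]; rewrite /= /Y w0 subr0 => -[wB wJ]; split.
    split => //; apply/cylinderP => p /wl; by rewrite w0 subr0.
  by move: wJ; rewrite /J /= in_itv.
rewrite /l box_integral_rcons.
pose g s y := \int[leb]_(z in B') (f (2 - s)%R (z - y)%R * 1).
rewrite -[LHS]/(box_integral f g 0 0 (rays txs)).
have mg : measurable_fun setT (g v).
  rewrite (_ : g v = fun y => \int[leb]_z ((\1_B' z)%:E * f (2 - v)%R (z - y)%R)).
    apply: (@measurable_integral_lebesgue _ _ _ (fun zy : R * R =>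
      (\1_B' zy.1)%:E * f (2 - v)%R (zy.1 - zy.2)%R)).
      apply: emeasurable_funM; first exact: (measurableT_comp mB'1 measurable_fst).
      by apply: (measurableT_comp (mf v2)); exact: measurable_funB.
    by move=> zy; rewrite mule_ge0 ?lee_fin// f0.
  apply/funext => y; rewrite /g integral_mkcond; apply: eq_integral => z _.
  by rewrite epatch_indic mule1 muleC.
rewrite (levy_box_integral0 levyX (densX' (T := 2%R))) ?mapE -/v//; last 3 first.
- by move=> y; apply: integral_ge0 => z _; rewrite mule1 f0.
- exact: ltW.
- by move=> _ /mapP[q _ ->]; exact: measurable_itv.
apply: eq_integral => w _.
have mfz : measurable_fun setT (fun z : R => (\1_B' z)%:E * f (2 - v)%R (z - Y v w)%R).
  apply: emeasurable_funM => //.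
  by apply: (measurableT_comp (mf v2)); exact: measurable_funB.
have fz0 (z : R) : setT z -> 0 <= (\1_B' z)%:E * f (2 - v)%R (z - Y v w)%R.
  by move=> _; rewrite mule_ge0 ?lee_fin// f0.
transitivity (I w * \int[leb]_z ((\1_B' z)%:E * f (2 - v)%R (z - Y v w)%R)).
  congr (_ * _); rewrite /g integral_mkcond; apply: eq_integral => z _.
  by rewrite epatch_indic mule1 muleC.
rewrite -(ge0_integralZl leb measurableT mfz fz0 (I0 w)); apply: eq_integral => z _.
by rewrite muleCA.
Qed.

Let one : 'I_2 -> R := fun=> 1%R.

Lemma partial_activity0 : partial_activity one ord0 = 0%R.
Proof. by rewrite /partial_activity big_pred0. Qed.

Lemma partial_activity1 : partial_activity one ord_max = 1%R.
Proof.
rewrite /partial_activity (bigD1 ord0)//= big_pred0 ?addr0// => j.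
by case: j => [[|[|]]].
Qed.

Definition bridge_coordinates (i : 'I_2) (t : R) : {RV P' >-> R} :=
  (L (t * one i + partial_activity one i) \- L (partial_activity one i))%R.

Local Notation xi := bridge_coordinates.

Lemma end_law_no_continuous_singular_part : no_continuous_singular_part nu.
Proof.
exists (mzero : {measure set R -> \bar R}), nu; split.
- by move=> B mB; rewrite /mzero add0e.
- by exists set0.
- move=> N nN A mA AN; have lA : leb A = 0 by exact: nN.
  transitivity (\int[leb]_(z in A) end_density z); first exact: end_lawE.
  have mdA : measurable_fun (A : set (measurableTypeR R)) end_density.
    by apply: measurable_funTS; exact: measurable_end_density.
  have mA' : measurable (A : set (measurableTypeR R)) by exact: mA.
  rewrite -(@integral0 _ _ _ leb A); apply: ge0_ae_eq_integral => //.
  by exists A; split => // x /= /not_implyP[].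
Qed.

(** The generating law has a density, and the process is its own
    representation as increments of a bridge. *)
Lemma conditioned_liouville : generalised_liouville one nu xi.
Proof.
split => //.
- exact: end_law_no_continuous_singular_part.
- case: levyX => cX _ _ _ i w.
  have pa0 : (0 <= partial_activity one i)%R by apply: sumr_ge0.
  have := cadlag_shift pa0 (cX w); rewrite /bridge_coordinates /=.
  rewrite (_ : (fun t => _) = (fun t => X (t * one i + partial_activity one i)%R w -
    X (partial_activity one i) w)%R)//.
  by apply/funext => t; rewrite mulr1.
exists d, O, P', L; split; last by [].
have -> : (\sum_i one i = 2)%R by rewrite sumr_const card_ord.
exact: conditioned_is_bridge.
Qed.

Let tau (j : nat) : R := (j%:R / 2)%R.

Let I j w : R := (X (tau j.+1) w - X (tau j) w)%R.

Let mI j : measurable_fun setT (I j).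
Proof. exact: measurable_funB. Qed.

Let tauS j : (tau j.+1 - tau j = 1/2)%R.
Proof. by rewrite /tau -natr1; lra. Qed.

Let tau_nd j : (tau j <= tau j.+1)%R.
Proof. by have := tauS j; lra. Qed.

Let preI j C : measurable C -> measurable (I j @^-1` C).
Proof. by move=> mC; rewrite -[Y in measurable Y]setTI; exact: mI. Qed.

Lemma four_increments (C : nat -> set R) : (forall j, measurable (C j)) ->
  Q (I 0 @^-1` C 0%N `&` (I 1 @^-1` C 1%N `&` (I 2 @^-1` C 2%N `&` I 3 @^-1` C 3%N))) =
  Q (I 0 @^-1` C 0%N) * (Q (I 1 @^-1` C 1%N) * (Q (I 2 @^-1` C 2%N) * Q (I 3 @^-1` C 3%N))).
Proof.
move=> mC; case: levyX => _ _ indX _.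
have t00 : (0 <= tau 0)%R by rewrite /tau mul0r.
have := indX 4%N tau C t00 (fun j _ => tau_nd j) mC.
rewrite !big_ord_recl big_ord0 mule1 => <-; congr (Q _).
apply/seteqP; split => [w [w0 [w1 [w2 w3]]] [|[|[|[|]]]]//|w wC].
by split; [exact: (wC 0%N)|split; [exact: (wC 1%N)|split; [exact: (wC 2%N)|exact: (wC 3%N)]]].
Qed.

Lemma increment_law_half j C : measurable C ->
  Q (I j @^-1` C) = \int[leb]_(x in C) f (1/2)%R x.
Proof.
move=> mC; rewrite -(tauS j); apply: (@increment_law (tau j) (tau j.+1)) => //.
  by rewrite /tau divr_ge0.
by have := tauS j; lra.
Qed.

Lemma increment_interval_gt0 j a b : (0 <= a)%R -> (a < b)%R -> 0 < Q (I j @^-1` `]a, b[).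
Proof.
by move=> a0 ab; rewrite increment_law_half//; apply: density_integral_gt0.
Qed.

Let D0 : set R := `]-oo, (1/2)%R[%classic.
Let D1 : set R := `]2%R, (5/2)%R[%classic.

Let mD0 : measurable D0. Proof. exact: measurable_itv. Qed.

Let mD1 : measurable D1. Proof. exact: measurable_itv. Qed.

Let D0_gt0 j : 0 < Q (I j @^-1` D0).
Proof.
apply: (@lt_le_trans _ _ (Q (I j @^-1` `]0%R, (1/2)%R[))).
  by apply: increment_interval_gt0; lra.
apply: le_measure; rewrite ?inE; [exact: preI|exact: (preI j mD0)|].
by move=> w /=; rewrite !in_itv/= => /andP[].
Qed.

Let D1_gt0 j : 0 < Q (I j @^-1` D1).
Proof. by apply: increment_interval_gt0; lra. Qed.

Let X0_ae : {ae Q, forall w, X 0 w = 0%R}. Proof. by case: levyX. Qed.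

Let end_sum w : (X 2 w = X 0 w + (I 0 w + (I 1 w + (I 2 w + I 3 w))))%R.
Proof.
have e0 : tau 0 = 0%R by rewrite /tau mul0r.
have e4 : tau 4 = 2%R by rewrite /tau; lra.
by rewrite /I -{1}e4 -{1}e0; ring.
Qed.

(** If the conditioned probability of [S] vanishes although [S] contains,
    within [X 2 <= 4], a product event of the four independent increments over
    half units, then one factor vanishes; only the first one can. *)
Lemma conditioned_null_first_increment (S : set O) (N : set R) (C : nat -> set R) :
  measurable S -> measurable N ->
  (forall j, measurable (C j)) -> (forall j, 0 < Q (I j @^-1` C j)) ->
  (forall w, X 0 w = 0%R -> N (I 0 w) -> C 0%N (I 0 w) -> C 1%N (I 1 w) -> C 2%N (I 2 w) ->
     C 3%N (I 3 w) -> S w /\ K w) ->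
  P' S = 0 -> Q (I 0 @^-1` (N `&` C 0%N)) = 0.
Proof.
move=> mS mN mC C_gt0 CS; rewrite conditionedE// => /eqP.
rewrite mule_eq0 => /orP[/eqP QSK|]; last first.
  by rewrite eqe invr_eq0 gt_eqF// c_gt0.
pose C' j := if j is 0%N then N `&` C 0%N else C j.
have mC' j : measurable (C' j) by case: j => [|j] //=; exact: measurableI.
pose F := I 0 @^-1` C' 0%N `&` (I 1 @^-1` C' 1%N `&` (I 2 @^-1` C' 2%N `&` I 3 @^-1` C' 3%N)).
have mF : measurable F by do 3?[apply: measurableI]; exact: preI.
have mSK : measurable (S `&` K) by exact: measurableI.
have mFSK : measurable (F `&` (S `&` K)) by exact: measurableI.
have : Q F = 0.
  apply/le_anti; rewrite measure_ge0 andbT -QSK.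
  rewrite (@ae_eq_measure _ _ _ Q F (F `&` (S `&` K)))//.
  - by apply: le_measure; rewrite ?inE// => w [].
  - apply: filterS X0_ae => w w0; split => [Fw|[]//]; split => //.
    by have [[Nw w0'] [w1 [w2 w3]]] := Fw; exact: CS.
rewrite four_increments//= => /eqP.
rewrite mule_eq0 => /orP[/eqP//|].
by rewrite !mule_eq0 !(gt_eqF (C_gt0 _)).
Qed.

Lemma sigma_of_single d' (T : measurableType d') (V : R -> T -> R) s (C : set T) :
  sigma_of V [set s] C -> exists2 B, measurable B & C = V s @^-1` B.
Proof.
have : sigma_of V [set s] `<=` preimage_set_system setT (V s) measurable.
  apply: sigma_of_sub.
    by apply: sigma_algebra_preimage; exact: sigma_algebra_measurable.
  by move=> _ x ->; exists `]-oo, x]%classic; rewrite ?setTI//; exact: measurable_itv.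
by move=> /[apply] -[B mB <-]; exists B; rewrite ?setTI.
Qed.

Let xiE i t w : xi i t w =
  (X (t * one i + partial_activity one i) w - X (partial_activity one i) w)%R.
Proof. by []. Qed.

Let xi0_half w : xi ord0 (1/2) w = I 0 w.
Proof. by rewrite xiE partial_activity0 mulr1 addr0 /I /tau mul0r. Qed.

Let xi1_half w : xi ord_max (1/2) w = I 2 w.
Proof.
rewrite xiE partial_activity1 mulr1 /I /tau.
have e3 : (1 / 2 + 1 = 3%:R / 2 :> R)%R by lra.
have e2 : (1 = 2%:R / 2 :> R)%R by lra.
by rewrite -e3 -e2.
Qed.

Let xi0_one w : xi ord0 1 w = (I 0 w + I 1 w)%R.
Proof.
rewrite xiE partial_activity0 mulr1 addr0 /I /tau mul0r.
have e2 : (1 = 2%:R / 2 :> R)%R by lra.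
by rewrite -e2; ring.
Qed.

Let I_ge0 j w : (0 <= I j w)%R.
Proof. by rewrite subr_ge0; apply: ndX; exact: tau_nd. Qed.

(** Suppose a version of the conditional probability of [A], the event that
    the first coordinate exceeds [2] at time [1], is a function of [I 0], and
    let [N] be the event where it is not positive. Then [A] and [N] have null
    intersection, and so have the event [E] that [I 2 > 2] and the complement
    of [N], since [A] and [E] are incompatible. With [I 0 < 1/2], either
    increment [I 1] or [I 2] can lie in [(2, 5/2)] while the remaining ones
    are below [1/2]; so both [N] and its complement are null on [I 0 < 1/2],
    which has positive probability. *)
Lemma conditioned_not_strong : ~ strong_markov_consistent xi `[0%R, 1%R].
Proof.
pose B : set R := `]2%R, +oo[%classic.
have mB : measurable B by exact: measurable_itv.
have h01 : `[0%R, 1%R]%classic ((1/2)%R : R) by rewrite /= in_itv/=; lra.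
have o01 : `[0%R, 1%R]%classic (1%R : R) by rewrite /= in_itv/=; lra.
have h1 : (1/2 < 1 :> R)%R by lra.
move=> /(_ ord0 B _ _ mB h01 o01 h1) [Y [Z [[_ iY YE] [sZ iZ ZE] YZ]]].
set A := xi ord0 1%R @^-1` B in YE ZE.
have mA : measurable A by rewrite -[V in measurable V]setTI; exact: measurable_funP.
pose E := xi ord_max (1/2)%R @^-1` B.
have mE : measurable E by rewrite -[V in measurable V]setTI; exact: measurable_funP.
pose N := Z @^-1` `]-oo, 0%R]%classic.
have sN : coord_sigma xi ord0 (1/2)%R N by apply: sZ; exact: measurable_itv.
have [N0 mN0 NE] := sigma_of_single sN.
have NP w : N w <-> N0 (I 0 w) by rewrite NE -xi0_half.
have mN : measurable N.
  by rewrite NE -[V in measurable V]setTI; exact: measurable_funP.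
have mS := measurableC mN.
have AN : P' (A `&` N) = 0.
  apply/le_anti; rewrite measure_ge0 andbT -ZE//.
  rewrite -(@integral0 _ _ _ P' N); apply: le_integral => //.
  - exact: integrableS iZ.
  - by apply: integrable0.
  - by move=> w; rewrite inE /N /= in_itv/= lee_fin.
have BP (y : R) : B y <-> (2 < y)%R by rewrite /B /= in_itv/= andbT.
have AP w : A w <-> (2 < I 0 w + I 1 w)%R by rewrite -xi0_one; exact: BP.
have EP w : E w <-> (2 < I 2 w)%R by rewrite -xi1_half; exact: BP.
have disj w : K w -> A w -> E w -> False.
  move=> Kw /AP + /EP.
  have := end_sum w; have := X_ge0 0 w; have := I_ge0 3 w; move: Kw; rewrite /K /=; lra.
have EN : P' (E `&` ~` N) = 0.
  have sEN : full_filtration xi (1/2)%R (E `&` ~` N).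
    have h2 : (0 <= (1/2 : R) <= 1/2)%R by lra.
    apply: sigma_of_setI.
      exact: (@sigma_of_preimage _ _ _ (fun p : 'I_2 * R => xi p.1 p.2 : O -> R) _ (ord_max, (1/2)%R)).
    rewrite NE preimage_setC.
    apply: (@sigma_of_preimage _ _ _ (fun p : 'I_2 * R => xi p.1 p.2 : O -> R) _ (ord0, (1/2)%R)) => //.
    exact: measurableC.
  have mEN : measurable (E `&` ~` N) by exact: measurableI.
  have Y0 : \int[P']_(w in E `&` ~` N) (Y w)%:E = 0.
    rewrite YE// conditionedE; last exact: measurableI.
    rewrite (_ : A `&` _ `&` K = set0) ?measure0 ?mul0e//.
    by apply/seteqP; split => // w [[wA [wE _]] wK]; exact: (disj w).
  have mZ : measurable_fun setT (EFin \o Z) by case/integrableP : iZ.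
  have mY : measurable_fun setT (EFin \o Y) by case/integrableP : iY.
  have Z0 : \int[P']_(w in E `&` ~` N) (Z w)%:E = 0.
    rewrite -Y0; apply: ae_eq_integral => //; [exact: measurable_funTS|exact: measurable_funTS|].
    by apply: filterS YZ => w -> _.
  have mZN : measurable_fun (E `&` ~` N) (EFin \o Z) by exact: measurable_funTS.
  have [M [mM M0 subM]] : ae_eq P' (E `&` ~` N) (EFin \o Z) (cst 0).
    apply/(ae_eq_integral_abs P' mEN mZN); rewrite -[RHS]Z0; apply: eq_integral => w.
    rewrite inE => -[_]; rewrite /N /= in_itv/= => /negP; rewrite -ltNge => Zw.
    by rewrite gtr0_norm.
  apply/le_anti; rewrite measure_ge0 andbT -M0; apply: le_measure; rewrite ?inE//.
  move=> w [Ew Nw]; apply: subM => /= /(_ (conj Ew Nw)) [Zw0].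
  by apply: Nw; rewrite /N /= in_itv/= Zw0.
(* [I 1] in (2, 5/2) forces [A]; [I 2] in (2, 5/2) forces [E] *)
pose C1 (j : nat) := if j == 1%N then D1 else D0.
pose C2 (j : nat) := if j == 2%N then D1 else D0.
have N1 : Q (I 0 @^-1` (N0 `&` C1 0%N)) = 0.
  apply: (conditioned_null_first_increment (S := A `&` N) (C := C1)) => //.
  - exact: measurableI.
  - by move=> j; rewrite /C1; case: ifP.
  - by move=> j; rewrite /C1; case: ifP.
  - move=> w w0 Nw; rewrite /C1 /D0 /D1 /= !in_itv/= => i0 i1 i2 i3.
    have := end_sum w; have := I_ge0 0 w; rewrite w0 => ? ?.
    split; last by rewrite /K /=; lra.
    by split; [apply/AP; lra|apply/NP].
have N2 : Q (I 0 @^-1` (~` N0 `&` C2 0%N)) = 0.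
  apply: (conditioned_null_first_increment (S := E `&` ~` N) (C := C2)) => //.
  - exact: measurableI.
  - exact: measurableC.
  - by move=> j; rewrite /C2; case: ifP.
  - by move=> j; rewrite /C2; case: ifP.
  - move=> w w0 Nw; rewrite /C2 /D0 /D1 /= !in_itv/= => i0 i1 i2 i3.
    have := end_sum w; rewrite w0 => ?.
    split; last by rewrite /K /=; lra.
    by split; [apply/EP; lra|move/NP].
have := D0_gt0 0; rewrite (_ : I 0 @^-1` D0 =
  I 0 @^-1` (N0 `&` C1 0%N) `|` I 0 @^-1` (~` N0 `&` C2 0%N)); last first.
  by rewrite -preimage_setU -setIUl setUv setTI.
rewrite lt0e => /andP[/eqP + _]; apply.
apply/le_anti; rewrite measure_ge0 andbT.
have m1 : measurable (I 0 @^-1` (N0 `&` C1 0%N)).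
  by apply: preI; exact: (measurableI _ _ mN0 mD0).
have m2 : measurable (I 0 @^-1` (~` N0 `&` C2 0%N)).
  by apply: preI; exact: (measurableI _ _ (measurableC mN0) mD0).
apply: (@le_trans _ _ (Q (I 0 @^-1` (N0 `&` C1 0%N)) + Q (I 0 @^-1` (~` N0 `&` C2 0%N)))).
  exact: measureU2.
by rewrite N1 N2 adde0.
Qed.

End conditioned_process.

Local Close Scope ereal_scope.

Theorem proposition3p18 (R : realType) :
  (forall (n : nat) (m : 'I_n -> R) (nu : probability R R)
      (d : measure_display) (Omega : measurableType d)
      (P : probability Omega R) (xi : 'I_n -> R -> {RV P >-> R}),
    generalised_liouville m nu xi ->
    weak_markov_consistent xi `[0, 1]) /\
  (exists (n : nat) (m : 'I_n -> R) (nu : probability R R)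
      (d : measure_display) (Omega : measurableType d)
      (P : probability Omega R) (xi : 'I_n -> R -> {RV P >-> R}),
    generalised_liouville m nu xi /\
    ~ strong_markov_consistent xi `[0, 1]).
Proof.
split; first by move=> n m nu d Omega P xi; exact: liouville_weak_markov.
have [U [X [levyX densX ndX X_ge0]]] := gamma_process_exists R.
have fneg (h x : R) : 0 < h -> x <= 0 -> gamma_density h x = 0%E.
  by move=> _; exact: gamma_density_neg.
have fpos := @gamma_density_gt0 R.
have fCK := @gamma_chapman_kolmogorov R.
exists 2%N, (fun=> 1), (conditioned_end_law X), _, _, _,
  (bridge_coordinates X); split.
  by apply: (conditioned_liouville (f := @gamma_density R)).
by apply: (conditioned_not_strong (f := @gamma_density R)).
Qed.
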